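(* Fix $n$ and a color $1\le i\le n$. (1) Let $\Gamma$ be a colored planar diagram (glued from essential diagrams) having a boundary end of color $i$ whose orientation points out of $\Gamma$, and write $\mathcal{C}'(\Gamma)[\mathcal X]$ for its matrix factorization when this end is labelled by the sequence $\mathcal X$ of $i$ variables; let $R$ be the polynomial ring in the variables of all other boundary ends, and let $\omega\in R$ be such that the potential of $\mathcal C'(\Gamma)[\mathcal X]$ is $\omega+F_i(\mathcal X)$. Then in $\mathrm{HMF}^{gr}_{\mathbb{Q}[\mathcal{X}_{i,1}]\otimes R,\ \omega+F_i(\mathcal{X}_{i,1})}$ $$\mathcal{C}'(\Gamma)[\mathcal{X}_{i,2}]\boxtimes\mathcal L_i(\mathcal{X}_{i,1};\mathcal{X}_{i,2})\simeq\mathcal{C}'(\Gamma)[\mathcal{X}_{i,1}].$$ (2) Let $\Gamma$ be as in (1), except that the distinguished end of color $i$ points into $\Gamma$, so that the potential of $\mathcal C'(\Gamma)[\mathcal X]$ is $\omega-F_i(\mathcal X)$ with $\omega\in R$. Then in $\mathrm{HMF}^{gr}_{\mathbb{Q}[\mathcal{X}_{i,1}]\otimes R,\ \omega-F_i(\mathcal{X}_{i,1})}$ $$\mathcal{C}'(\Gamma)[\mathcal{X}_{i,2}]\boxtimes\mathcal L_i(\mathcal{X}_{i,2};\mathcal{X}_{i,1})\simeq\mathcal{C}'(\Gamma)[\mathcal{X}_{i,1}].$$ (3) In $\mathrm{HMF}^{gr}_{\mathbb{Q},0}$ the matrix factorization of the circle colored $i$ satisfies $$\mathcal L_i(\mathcal{X}_{i,1};\mathcal{X}_{i,2})\big|_{\mathcal{X}_{i,2}\to\mathcal{X}_{i,1}}\simeq\big(J_{F_i},0,0,0\big)\{-in+i^2\}\langle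 i\rangle,\qquad J_{F_i}=\mathbb{Q}[\mathcal{X}_{i,1}]\Big/\Big\langle\frac{\partial F_i}{\partial x_{1,1}},\dots,\frac{\partial F_i}{\partial x_{i,1}}\Big\rangle.$$
   Context: MATRIX FACTORIZATIONS. For a graded module $M$, $M\{m\}$ is $M$ with grading shifted up by $m$ (degree $i+m$ part of $M\{m\}$ is $M^i$). For a $\mathbb{Z}$-graded polynomial ring $R$ over $\mathbb{Q}$ and homogeneous $\omega\in R$, a matrix factorization with potential $\omega$ is $(M_0,M_1,d_0,d_1)$ with $M_0,M_1$ free graded $R$-modules (infinite rank allowed), $R$-linear $d_0:M_0\to M_1$, $d_1:M_1\to M_0$, $d_1d_0=\omega$, $d_0d_1=\omega$. Morphisms are pairs of grading-preserving $R$-linear maps commuting with differentials; $\mathrm{HMF}^{gr}_{R,\omega}$ is the category with morphisms modulo null-homotopic ones ($f_0=h_1d_{M_0}+d_{N_1}h_0$, $f_1=h_0d_{M_1}+d_{N_0}h_1$). Shift $\{m\}$ acts on both modules; $\overline M\langle1\rangle=(M_1,M_0,-d_1,-d_0)$ and $\langle i\rangle=\langle1\rangle^i$. Tensor product: $$\overline M\boxtimes\overline N=\left(\begin{matrix}M_0\otimes N_0\\ \oplus\\ M_1\otimes N_1\end{matrix},\ \begin{matrix}M_1\otimes N_0\\ \oplus\\ M_0\otimes N_1\end{matrix},\ \begin{pmatrix}d_{M_0}&-d_{N_1}\\ d_{N_0}&d_{M_1}\end{pmatrix},\ \begin{pmatrix}d_{M_1}&d_{N_1}\\ -d_{N_0}&d_{M_0}\end{pmatrix}\right),$$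 where for factorizations over polynomial rings in named variables the tensor product of modules is over the polynomial ring in the common variables; potentials add. $K(a;b)_A=(A,A\{\tfrac12(\deg b-\deg a)\},a,b)$ for homogeneous $a,b\in A$ (if an entry specializes to $0$ it keeps its nominal degree). A factorization over a larger ring whose potential lies in a polynomial subring $R$ is regarded as a factorization over $R$ (of possibly infinite rank). ESSENTIAL DIAGRAMS. Fix $n$. $F_i$ is the polynomial with $F_i(e_1,\dots,e_i)=t_1^{n+1}+\cdots+t_i^{n+1}$, $e_j$ the elementary symmetric polynomials of $t_1,\dots,t_i$. $\mathcal X_{i,k}=(x_{1,k},\dots,x_{i,k})$ is a sequence of variables with $\deg x_{j,k}=2j$. All sequences $\mathbf x=(x_1,\dots,x_p)$ below are of this kind ($\deg x_j=2j$). Line colored $i$ ($1\le i\le n$), outgoing end labelled $\mathbf x$, incoming end labelled $\mathbf y$ (both of length $i$): $$\mathcal L_i(\mathbf x;\mathbf y)=\boxtimes_{j=1}^iK\Big(\tfrac{F_i(y_1,\dots,y_{j-1},x_j,x_{j+1},\dots,x_i)-F_i(y_1,\dots,y_{j-1},y_j,x_{j+1},\dots,x_i)}{x_j-y_j};\,x_j-y_j\Big)_{\mathbb{Q}[\mathbf x,\mathbf y]},$$ of potential $F_i(\mathbf x)-F_i(\mathbf y)$. For $1\le p,q\le n-1$, $r=p+q\le n$, $\mathbf x,\mathbf y,\mathbf z$ of lengths $p,q,r$, let $e_j=e_j(\mathbf x,\mathbf y)$ be the degree $2j$ term of $(1+x_1+\dots+x_p)(1+y_1+\dots+y_q)$,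 $1\le j\le r$. Merging vertex (edges $p,q$ labelled $\mathbf x,\mathbf y$ merge into an edge $r$ labelled $\mathbf z$): $$\mathcal M_{p,q}(\mathbf x,\mathbf y;\mathbf z)=\boxtimes_{j=1}^rK\Big(\tfrac{F_r(e_1,\dots,e_{j-1},z_j,z_{j+1},\dots,z_r)-F_r(e_1,\dots,e_{j-1},e_j,z_{j+1},\dots,z_r)}{z_j-e_j};\,z_j-e_j\Big)_{\mathbb{Q}[\mathbf x,\mathbf y,\mathbf z]},$$ of potential $F_r(\mathbf z)-F_p(\mathbf x)-F_q(\mathbf y)$. Splitting vertex (edge $r$ labelled $\mathbf z$ splits into edges $p,q$ labelled $\mathbf x,\mathbf y$): $$\mathcal S_{p,q}(\mathbf x,\mathbf y;\mathbf z)=\boxtimes_{j=1}^rK\Big(\tfrac{F_r(z_1,\dots,z_{j-1},e_j,e_{j+1},\dots,e_r)-F_r(z_1,\dots,z_{j-1},z_j,e_{j+1},\dots,e_r)}{e_j-z_j};\,e_j-z_j\Big)_{\mathbb{Q}[\mathbf x,\mathbf y,\mathbf z]}\{-pq\},$$ of potential $F_p(\mathbf x)+F_q(\mathbf y)-F_r(\mathbf z)$. GLUING. A colored planar diagram $\Gamma$ is obtained from essential diagrams (lines, merging and splitting vertices) by disjoint union and by gluing an outgoing end to an incoming end of the same color. $\mathcal C'(\Gamma)$ is the tensor product $\boxtimes$ of the factorizations of its pieces, with the variable sequences at glued ends identified; it is regarded as a matrix factorization over the polynomial ring in the variables of the boundary ends, its potential being the sum of $F_c(\mathcal X)$ over outgoing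 boundary ends minus the sum over incoming boundary ends ($c$ the color, $\mathcal X$ the label of the end). *)

(* Defs.v *)
From HB Require Import structures.
From mathcomp Require Import all_boot all_order all_algebra.
From mathcomp Require Import perm generic_quotient ring_quotient.
From mathcomp Require Import mpoly.
From mathcomp Require Import boolp.

Set Implicit Arguments.
Unset Strict Implicit.
Unset Printing Implicit Defensive.

Import GRing.Theory Num.Theory.
Local Open Scope ring_scope.
Local Open Scope quotient_scope.

Section NamedVariables.
Variable V : finType.

Definition amb := {mpoly rat[#|V|]}.

Definition supported (S : {set V}) : {pred amb} := fun p : amb =>
  all (fun m : 'X_{1..#|V|} => [forall k, (m k != 0%N) ==> (enum_val k \in S)])
      (msupp p).

Lemma supported_subring (S : {set V}) : subring_closed (supported S).
Proof.
have msM (m1 m2 : 'X_{1..#|V|}) :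
    [forall k, (m1 k != 0%N) ==> (enum_val k \in S)] ->
    [forall k, (m2 k != 0%N) ==> (enum_val k \in S)] ->
    [forall k, ((m1 + m2)%MM k != 0%N) ==> (enum_val k \in S)].
  move=> /forallP h1 /forallP h2; apply/forallP => k; rewrite mnmDE.
  have := h1 k; have := h2 k.
  by case: (m1 k) => [|?] //=; case: (m2 k).
split.
- rewrite unfold_in /supported msupp1 /= andbT.
  by apply/forallP => k; rewrite mnm0E.
- move=> p q /allP hp /allP hq; apply/allP => m /msuppB_le.
  by rewrite mem_cat => /orP[/hp|/hq].
- move=> p q /allP hp /allP hq; apply/allP => m /msuppM_le.
  by case/allpairsP => -[m1 m2] /= [/hp h1 /hq h2 ->]; apply: msM.
Qed.

HB.instance Definition _ (S : {set V}) :=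
  GRing.isSubringClosed.Build amb (supported S) (supported_subring S).

(* [Qs S] is Q[S], the polynomial ring in the variables of S. *)
Record Qs (S : {set V}) := QS { qval : amb; _ : supported S qval }.
HB.instance Definition _ (S : {set V}) := [isSub for @qval S].
HB.instance Definition _ (S : {set V}) := [Choice of Qs S by <:].
HB.instance Definition _ (S : {set V}) :=
  [SubChoice_isSubComNzRing of Qs S by <:].

(* Renames each variable v to s v; a variable whose new name is not in T is
   sent to 0, so that the result is always in Q[T]. *)
Definition subst (s : V -> V) (T : {set V}) : amb -> amb :=
  mmap (@mpolyC #|V| rat)
    (fun k => if s (enum_val k) \in T then 'X_(enum_rank (s (enum_val k)))
              else 0).
HB.instance Definition _ s T := GRing.RMorphism.on (subst s T).

Lemma subst_supported s T p : supported T (subst s T p).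
Proof.
change (subst s T p \in supported T).
rewrite /subst /mmap; apply: rpred_sum => m _; apply: rpredM.
  rewrite unfold_in /supported; apply/allP => m'; rewrite msuppC.
  case: ifP => // _; rewrite inE => /eqP ->.
  by apply/forallP => k; rewrite mnm0E.
apply: rpred_prod => k _; apply: rpredX; case: ifP => [hT|_]; last exact: rpred0.
rewrite unfold_in /supported msuppX /= andbT; apply/forallP => l.
rewrite mnm1E; have [<-|//] := eqVneq (enum_rank (s (enum_val k))) l.
by rewrite /= enum_rankK hT.
Qed.

Lemma subst_id T p : supported T p -> subst id T p = p.
Proof.
move=> /allP hp; rewrite /subst /mmap [RHS]mpolyE big_seq [RHS]big_seq.
apply: eq_bigr => m /hp /forallP hm; rewrite mul_mpolyC; congr (_ *: _).
rewrite -mmap1_id; apply: eq_bigr => k _.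
have := hm k; have [->|_ /= ->] := eqVneq (m k) 0%N; first by rewrite !expr0.
by rewrite enum_valK.
Qed.

Definition psubst (s : V -> V) (S T : {set V}) (p : Qs S) : Qs T :=
  QS (subst_supported s T (qval p)).

Lemma psubst_zmod s S T : zmod_morphism (psubst s (S := S) T).
Proof. by move=> p q; apply: val_inj; rewrite /= rmorphB. Qed.
Lemma psubst_monoid s S T : monoid_morphism (psubst s (S := S) T).
Proof.
by split=> [|p q]; apply: val_inj; rewrite /= ?rmorph1 ?rmorphM.
Qed.
HB.instance Definition _ s S T :=
  GRing.isZmodMorphism.Build (Qs S) (Qs T)
    (psubst s (S := S) T) (@psubst_zmod s S T).
HB.instance Definition _ s S T :=
  GRing.isMonoidMorphism.Build (Qs S) (Qs T)
    (psubst s (S := S) T) (@psubst_monoid s S T).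

(* The inclusion of Q[S] in Q[T]; only meant for S \subset T. *)
Local Notation emb := (psubst id).

Lemma emb_val (S T : {set V}) (p : Qs S) :
  S \subset T -> qval (emb T p) = qval p.
Proof.
move=> sST; apply: subst_id; case: p => p /= /allP hp.
apply/allP => m /hp /forallP hm; apply/forallP => k; apply/implyP => hk.
by apply: (subsetP sST); exact: implyP (hm k) hk.
Qed.

(* A polynomial that lies in Q[S], as an element of Q[S]. *)
Definition inQ (S : {set V}) (p : amb) : Qs S := QS (subst_supported id S p).

Lemma inQ_val (S : {set V}) (p : amb) :
  supported S p -> qval (inQ S p) = p.
Proof. exact: subst_id. Qed.

Variable wt : V -> nat.

Definition mnmwt (m : 'X_{1..#|V|}) : nat :=
  (\sum_(v : V) m (enum_rank v) * wt v)%N.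

Definition whomog (S : {set V}) (d : int) (p : Qs S) : bool :=
  all (fun m : 'X_{1..#|V|} => (mnmwt m)%:Z == d) (msupp (qval p)).

(* A module with a designated set of homogeneous elements in each degree; that
   these form a grading is part of [free_graded]. *)
Record gmod (S : {set V}) := GMod {
  gm_car :> lmodType (Qs S);
  gm_deg : int -> gm_car -> Prop }.

(* There is a homogeneous basis b, with b k of degree g k. *)
Definition free_graded (S : {set V}) (M : gmod S) : Prop :=
  exists (B : eqType) (b : B -> M) (g : B -> int),
  [/\ forall m : M, exists (s : seq B) (c : B -> Qs S),
        m = \sum_(k <- s) c k *: b k,
      forall (s : seq B) (c : B -> Qs S), uniq s ->
        \sum_(k <- s) c k *: b k = 0 -> forall k, k \in s -> c k = 0 &
      forall (d : int) (m : M), gm_deg d m <->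
        exists (s : seq B) (c : B -> Qs S),
          (forall k, whomog (d - g k) (c k)) /\ m = \sum_(k <- s) c k *: b k].

Definition gshift (S : {set V}) (a : int) (M : gmod S) : gmod S :=
  @GMod S M (fun d (m : M) => gm_deg (d - a) m).

Record gfact (S : {set V}) := GFact {
  G0 : gmod S;
  G1 : gmod S;
  dif0 : {linear G0 -> G1};
  dif1 : {linear G1 -> G0} }.

Definition is_mf (S : {set V}) (w : Qs S) (M : gfact S) : Prop :=
  [/\ exists d, whomog d w,
      free_graded (G0 M),
      free_graded (G1 M),
      forall m, dif1 M (dif0 M m) = w *: m &
      forall m, dif0 M (dif1 M m) = w *: m].

Definition gf_shift (S : {set V}) (a : int) (M : gfact S) : gfact S :=
  @GFact S (gshift a (G0 M)) (gshift a (G1 M)) (dif0 M) (dif1 M).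

Definition gf_flip (S : {set V}) (M : gfact S) : gfact S :=
  @GFact S (G1 M) (G0 M) (\- (dif1 M)) (\- (dif0 M)).

Record gf_hom (S : {set V}) (M N : gfact S) := GFHom {
  hom0 : {linear G0 M -> G0 N};
  hom1 : {linear G1 M -> G1 N};
  hom0_deg : forall d m, gm_deg d m -> gm_deg d (hom0 m);
  hom1_deg : forall d m, gm_deg d m -> gm_deg d (hom1 m);
  hom0_dif : forall m, dif0 N (hom0 m) = hom1 (dif0 M m);
  hom1_dif : forall m, dif1 N (hom1 m) = hom0 (dif1 M m) }.

(* The pair (u0, u1) is null-homotopic. *)
Definition null_homotopic (S : {set V}) (M N : gfact S)
    (u0 : G0 M -> G0 N) (u1 : G1 M -> G1 N) : Prop :=
  exists (h0 : {linear G0 M -> G1 N}) (h1 : {linear G1 M -> G0 N}),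
    (forall m, u0 m = h1 (dif0 M m) + dif1 N (h0 m)) /\
    (forall m, u1 m = h0 (dif1 M m) + dif0 N (h1 m)).

(* M and N are isomorphic objects of HMF^gr_{Q[S], w}. *)
Definition hmf_iso (S : {set V}) (w : Qs S) (M N : gfact S) : Prop :=
  [/\ is_mf w M, is_mf w N &
      exists (f : gf_hom M N) (g : gf_hom N M),
        null_homotopic (fun m => hom0 g (hom0 f m) - m)
                       (fun m => hom1 g (hom1 f m) - m) /\
        null_homotopic (fun m => hom0 f (hom0 g m) - m)
                       (fun m => hom1 f (hom1 g m) - m)].

(* Factorizations of finite rank over Q[S] with chosen homogeneous bases, given
   by degrees and matrices: the coefficient of the basis element j in the image
   of the basis element i is [D0 j i], resp. [D1 j i]. *)
Record ffact (S : {set V}) := FFact {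
  I0 : finType;
  I1 : finType;
  g0 : I0 -> int;
  g1 : I1 -> int;
  D0 : I1 -> I0 -> Qs S;
  D1 : I0 -> I1 -> Qs S }.

Definition ff_map (S T : {set V}) (f : Qs S -> Qs T) (M : ffact S) : ffact T :=
  @FFact T (I0 M) (I1 M) (@g0 S M) (@g1 S M)
    (fun j i => f (D0 j i)) (fun j i => f (D1 j i)).

Definition ff_shift (S : {set V}) (a : int) (M : ffact S) : ffact S :=
  @FFact S (I0 M) (I1 M) (fun i => g0 i + a) (fun i => g1 i + a)
    (@D0 S M) (@D1 S M).

(* The tensor product over a common ring Q[S]. *)
Definition tens (S : {set V}) (M N : ffact S) : ffact S :=
  let T0 := (I0 M * I0 N + I1 M * I1 N)%type in
  let T1 := (I1 M * I0 N + I0 M * I1 N)%type in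
  @FFact S T0 T1
    (fun t => match t with
      | inl (a, b) => g0 a + g0 b
      | inr (a, b) => g1 a + g1 b end)
    (fun t => match t with
      | inl (a, b) => g1 a + g0 b
      | inr (a, b) => g0 a + g1 b end)
    (fun t1 t0 => match t1, t0 with
      | inl (a', b'), inl (a, b) => (b' == b)%:R * D0 a' a
      | inl (a', b'), inr (a, b) => - ((a' == a)%:R * D1 b' b)
      | inr (a', b'), inl (a, b) => (a' == a)%:R * D0 b' b
      | inr (a', b'), inr (a, b) => (b' == b)%:R * D1 a' a end)
    (fun t0 t1 => match t0, t1 with
      | inl (a', b'), inl (a, b) => (b' == b)%:R * D1 a' a
      | inl (a', b'), inr (a, b) => (a' == a)%:R * D1 b' b
      | inr (a', b'), inl (a, b) => - ((a' == a)%:R * D0 b' b)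
      | inr (a', b'), inr (a, b) => (b' == b)%:R * D0 a' a end).

(* For free modules over Q[S] and Q[T], the tensor product over the ring
   Q[S :&: T] in the common variables is free over Q[S :|: T], on the pairs of
   basis elements. *)
Definition boxtimes (S T : {set V}) (M : ffact S) (N : ffact T) :
    ffact (S :|: T) :=
  tens (ff_map (emb (S :|: T)) M) (ff_map (emb (S :|: T)) N).

(* (Q[S], 0, 0, 0), the unit of the tensor product over Q[S]. *)
Definition ff_unit (S : {set V}) : ffact S :=
  @FFact S unit void (fun _ => 0) (fun _ => 0) (fun _ _ => 0) (fun _ _ => 0).

(* K(a; b)_{Q[S]}, the degrees da and db of the entries being given since the
   entries may vanish; da - db is even in all uses. *)
Definition koszul (S : {set V}) (a b : Qs S) (da db : int) : ffact S :=
  @FFact S unit unit (fun _ => 0) (fun _ => ((db - da) %/ 2)%Z)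
    (fun _ _ => a) (fun _ _ => b).

(* The free module Q[T]^I with scalars restricted to Q[S], for S \subset T. *)
Definition restr_free (S T : {set V}) (I : finType) := {ffun I -> Qs T}.
HB.instance Definition _ S T I :=
  GRing.Zmodule.copy (restr_free S T I) {ffun I -> Qs T}.

Section Restriction.
Variables (S T : {set V}).

Definition restr_scale (I : finType) (r : Qs S) (v : restr_free S T I) :
  restr_free S T I := [ffun i => emb T r * v i].

Fact restr_scaleA I (a b : Qs S) (v : restr_free S T I) :
  restr_scale a (restr_scale b v) = restr_scale (a * b) v.
Proof. by apply/ffunP => i; rewrite !ffunE rmorphM mulrA. Qed.
Fact restr_scale1 I : left_id 1 (@restr_scale I).
Proof. by move=> v; apply/ffunP => i; rewrite !ffunE rmorph1 mul1r. Qed.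
Fact restr_scaleDr I : right_distributive (@restr_scale I) +%R.
Proof. by move=> a u v; apply/ffunP => i; rewrite !ffunE mulrDr. Qed.
Fact restr_scaleDl I (v : restr_free S T I) :
  {morph (@restr_scale I)^~ v : a b / a + b}.
Proof. by move=> a b; apply/ffunP => i; rewrite !ffunE rmorphD mulrDl. Qed.
HB.instance Definition _ I := GRing.Zmodule_isLmodule.Build (Qs S)
  (restr_free S T I) (@restr_scaleA I) (@restr_scale1 I) (@restr_scaleDr I)
  (@restr_scaleDl I).

Definition restr_gmod (I : finType) (g : I -> int) : gmod S :=
  @GMod S (restr_free S T I) (fun d v => forall i, whomog (d - g i) (v i)).

Definition mxact (I J : finType) (D : J -> I -> Qs T) (v : restr_free S T I) :
  restr_free S T J := [ffun j => \sum_i D j i * v i].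

Fact mxact_linear (I J : finType) (D : J -> I -> Qs T) : linear (mxact D).
Proof.
move=> a u v; apply/ffunP => j; rewrite !ffunE mulr_sumr -big_split /=.
by apply: eq_bigr => i _; rewrite !ffunE mulrDr mulrCA.
Qed.
HB.instance Definition _ (I J : finType) (D : J -> I -> Qs T) :=
  GRing.isLinear.Build (Qs S) (restr_free S T I) (restr_free S T J) _
    (mxact D) (mxact_linear D).

End Restriction.

(* A factorization over Q[T] regarded as a factorization over Q[S], for
   S \subset T. *)
Definition restr (S T : {set V}) (M : ffact T) : gfact S :=
  @GFact S (restr_gmod S T (@g0 T M)) (restr_gmod S T (@g1 T M))
    (mxact (@D0 T M)) (mxact (@D1 T M)).

Section Ideal.
Variables (T : {set V}) (r : nat) (g : 'I_r -> Qs T).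

(* The ideal of Q[T] generated by the g j. *)
Definition gen_ideal : {pred Qs T} := fun p =>
  `[< exists c : 'I_r -> Qs T, p = \sum_j c j * g j >].

Fact gen_ideal_zmod : zmod_closed gen_ideal.
Proof.
split.
  by apply/asboolP; exists (fun=> 0); rewrite big1 // => j _; rewrite mul0r.
move=> _ _ /asboolP[c ->] /asboolP[c' ->]; apply/asboolP.
exists (fun j => c j - c' j); rewrite -sumrB.
by apply: eq_bigr => j _; rewrite mulrBl.
Qed.
HB.instance Definition _ :=
  GRing.isZmodClosed.Build (Qs T) gen_ideal gen_ideal_zmod.

Lemma gen_idealM a p : p \in gen_ideal -> a * p \in gen_ideal.
Proof.
move=> /asboolP[c ->]; apply/asboolP; exists (fun j => a * c j).
by rewrite mulr_sumr; apply: eq_bigr => j _; rewrite mulrA.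
Qed.
End Ideal.

(* Q[T] / (g j)_j as a module over Q[S], for S \subset T. *)
Definition quo_mod (S T : {set V}) (r : nat) (g : 'I_r -> Qs T) :=
  Quotient.quot (gen_ideal g).
HB.instance Definition _ S T r g :=
  GRing.Zmodule.copy (@quo_mod S T r g) (Quotient.quot (gen_ideal g)).

Section QuotientModule.
Variables (S T : {set V}) (r : nat) (g : 'I_r -> Qs T).
Local Notation J := (quo_mod S g).

Definition quo_pi (p : Qs T) : J := \pi_(Quotient.quot (gen_ideal g)) p.

Definition quo_scale (a : Qs S) (x : J) : J :=
  quo_pi (emb T a * repr (x : Quotient.quot (gen_ideal g))).

Fact quo_piP (x : J) : exists p, x = quo_pi p.
Proof.
by exists (repr (x : Quotient.quot (gen_ideal g))); rewrite /quo_pi reprK.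
Qed.

Fact quo_piD p q : quo_pi (p + q) = quo_pi p + quo_pi q.
Proof. exact: Quotient.pi_add. Qed.

Fact quo_scale_pi a p : quo_scale a (quo_pi p) = quo_pi (emb T a * p).
Proof.
apply/eqP; rewrite /quo_scale /quo_pi -Quotient.idealrBE -mulrBr.
apply: gen_idealM; rewrite Quotient.idealrBE; apply/eqP.
by rewrite reprK.
Qed.

Fact quo_scaleA a b (x : J) : quo_scale a (quo_scale b x) = quo_scale (a * b) x.
Proof.
by have [p ->] := quo_piP x; rewrite !quo_scale_pi rmorphM mulrA.
Qed.
Fact quo_scale1 : left_id 1 quo_scale.
Proof.
by move=> x; have [p ->] := quo_piP x; rewrite quo_scale_pi rmorph1 mul1r.
Qed.
Fact quo_scaleDr : right_distributive quo_scale +%R.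
Proof.
move=> a x y; have [[p ->] [q ->]] := (quo_piP x, quo_piP y).
by rewrite -quo_piD !quo_scale_pi mulrDr quo_piD.
Qed.
Fact quo_scaleDl (x : J) : {morph quo_scale^~ x : a b / a + b}.
Proof.
move=> a b; have [p ->] := quo_piP x.
by rewrite !quo_scale_pi rmorphD mulrDl quo_piD.
Qed.
HB.instance Definition _ := GRing.Zmodule_isLmodule.Build (Qs S) J
  quo_scaleA quo_scale1 quo_scaleDr quo_scaleDl.

Definition quo_gmod : gmod S :=
  @GMod S J (fun d x => exists2 p : Qs T, whomog d p & x = quo_pi p).
End QuotientModule.

(* (M, 0, 0, 0) *)
Definition gf_even (S : {set V}) (M : gmod S) : gfact S :=
  @GFact S M (restr_gmod S S (fun i : void => 0)) \0 \0.

End NamedVariables.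

Notation emb := (psubst id).

(* The polynomial F_i, with F_i(e_1, ..., e_i) = t_1^(n+1) + ... + t_i^(n+1);
   the index j : 'I_i stands for the argument number j + 1. *)
Section PowerSumPolynomial.
Variables (n i : nat).

Definition psum : {mpoly rat[i]} := \sum_(j < i) 'X_j ^+ n.+1.

Lemma psum_sym : psum \is symmetric.
Proof.
apply/issymP => s; rewrite /psum rmorph_sum /=.
rewrite [RHS](reindex_inj (@perm_inj _ s)) /=; apply: eq_bigr => j _.
rewrite rmorphXn /= msymX; congr ('X_[_] ^+ _).
by apply/mnmP => k; rewrite mnmE !mnm1E -(inj_eq (@perm_inj _ s)) permKV.
Qed.

Definition Fpoly : {mpoly rat[i]} := sval (sym_fundamental psum_sym).

Lemma FpolyP : Fpoly \mPo [tuple mesym i rat j.+1 | j < i] = psum.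
Proof. by case: (svalP (sym_fundamental psum_sym)). Qed.

Lemma Fpoly_uniq (G : {mpoly rat[i]}) :
  G \mPo [tuple mesym i rat j.+1 | j < i] = psum -> G = Fpoly.
Proof. by move=> GP; apply: msym_fundamental_un; rewrite GP FpolyP. Qed.
End PowerSumPolynomial.

Section Evaluation.
Variables (V : finType) (r : nat).
Local Notation A := (amb V).

Definition peval (G : {mpoly rat[r]}) (w : 'I_r -> A) : A :=
  mmap (@mpolyC _ rat) w G.

Definition upd (w : 'I_r -> A) (j : 'I_r) (a : A) : 'I_r -> A :=
  fun l => if l == j then a else w l.

(* (G(w with w_j := a) - G(w with w_j := b)) / (a - b), the quotient being the
   one of polynomials in indeterminates w, a, b (so it makes sense for a = b). *)
Definition ddiff (G : {mpoly rat[r]}) (j : 'I_r) (w : 'I_r -> A) (a b : A) : A :=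
  \sum_(m <- msupp G) G@_m *:
    ((\prod_(l < r | l != j) w l ^+ m l) *
     (\sum_(k < m j) a ^+ ((m j).-1 - k)%N * b ^+ k)).

Lemma ddiffP (G : {mpoly rat[r]}) (j : 'I_r) (w : 'I_r -> A) (a b : A) :
  (a - b) * ddiff G j w a b = peval G (upd w j a) - peval G (upd w j b).
Proof.
rewrite /peval /mmap -sumrB mulr_sumr; apply: eq_bigr => m _.
rewrite -mulrBr mul_mpolyC -scalerAr; congr (_ *: _).
rewrite mulrCA -subrXX /mmap1 !(bigD1 j (P := predT)) //= /upd eqxx.
rewrite mulrC mulrBl; congr (_ * _ - _ * _); apply: eq_bigr => l /negbTE ->//.
Qed.
End Evaluation.

Section Diagrams.
Variables (n : nat) (E : finType).

(* The variable number j + 1 of the sequence labelled e is (e, j); all colors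
   are at most n. *)
Definition nvar : finType := (E * 'I_n)%type.
Definition nwt (v : nvar) : nat := (2 * v.2.+1)%N.
Local Notation A := (amb nvar).

Definition xv (e : E) (j : nat) : A :=
  if insub j is Some k then 'X_(enum_rank ((e, k) : nvar)) else 0.

Definition evars (d : E * nat) : {set nvar} :=
  [set v : nvar | (v.1 == d.1) && (v.2 < d.2)%N].
Definition lvars (s : seq (E * nat)) : {set nvar} := \bigcup_(d <- s) evars d.

(* F_c evaluated at the sequence of c variables labelled e. *)
Definition Fat (c : nat) (e : E) : A := peval (Fpoly n c) (fun j => xv e j).

(* The tensor product over j = 1, ..., r of
     K((F_r(v_1, .., v_(j-1), u_j, u_(j+1), .., u_r)
        - F_r(v_1, .., v_(j-1), v_j, u_(j+1), .., u_r)) / (u_j - v_j);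
       u_j - v_j)_{Q[S]}
   where u_j and v_j have degree 2j. *)
Definition telescope (S : {set nvar}) (r : nat) (u v : nat -> A) : ffact S :=
  foldr (@tens nvar S) (ff_unit S)
    [seq koszul
      (inQ S (ddiff (Fpoly n r) j
                (fun l : 'I_r => if (l < j)%N then v l else u l) (u j) (v j)))
      (inQ S (u j - v j))
      ((2 * n.+1)%N%:Z - (2 * j.+1)%N%:Z) (2 * j.+1)%N%:Z
    | j : 'I_r <- enum 'I_r].

(* 1 + x_1 + ... + x_p, by degree (halved). *)
Definition xs (p : nat) (x : E) (a : nat) : A :=
  if a is a'.+1 then (if (a' < p)%N then xv x a' else 0) else 1.

(* e_(j+1)(x, y). *)
Definition ev (p q : nat) (x y : E) (j : nat) : A :=
  \sum_(a < j.+2) xs p x a * xs q y (j.+1 - a)%N.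

(* [Line i x y] is L_i(x; y), [Merge p q x y z] is M_{p,q}(x, y; z) and
   [Split p q x y z] is S_{p,q}(x, y; z). *)
Inductive piece : Type :=
| Line (i : nat) (x y : E)
| Merge (p q : nat) (x y z : E)
| Split (p q : nat) (x y z : E).

(* Outgoing and incoming ends, with their colors. *)
Definition pouts (P : piece) : seq (E * nat) :=
  match P with
  | Line i x _ => [:: (x, i)]
  | Merge p q _ _ z => [:: (z, (p + q)%N)]
  | Split p q x y _ => [:: (x, p); (y, q)]
  end.
Definition pins (P : piece) : seq (E * nat) :=
  match P with
  | Line i _ y => [:: (y, i)]
  | Merge p q x y _ => [:: (x, p); (y, q)]
  | Split p q _ _ z => [:: (z, (p + q)%N)]
  end.

Definition wf_piece (P : piece) : bool :=
  match P with
  | Line i _ _ => 1 <= i <= n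
  | Merge p q _ _ _ | Split p q _ _ _ =>
      [&& 1 <= p <= n.-1, 1 <= q <= n.-1 & p + q <= n]
  end%N.

Definition pvars (P : piece) : {set nvar} := lvars (pouts P ++ pins P).

Definition pfact (P : piece) : ffact (pvars P) :=
  let S := pvars P in
  match P with
  | Line i x y => telescope S i (xv x) (xv y)
  | Merge p q x y z => telescope S (p + q) (xv z) (ev p q x y)
  | Split p q x y z =>
      ff_shift (- (p * q)%N%:Z) (telescope S (p + q) (ev p q x y) (xv z))
  end.

(* A diagram is given by its essential pieces, with labelled ends: an outgoing
   end and an incoming end are glued together when they have the same label. *)
Definition diagram := seq piece.
Definition outs (G : diagram) : seq (E * nat) := flatten [seq pouts P | P <- G].
Definition ins (G : diagram) : seq (E * nat) := flatten [seq pins P | P <- G].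
Definition labels (G : diagram) : seq E := [seq d.1 | d <- outs G ++ ins G].

Definition valid (G : diagram) : bool :=
  [&& all wf_piece G,
      uniq [seq d.1 | d <- outs G],
      uniq [seq d.1 | d <- ins G] &
      all (fun d => all (fun d' => (d.1 == d'.1) ==> (d.2 == d'.2)) (ins G))
          (outs G)].

(* Boundary ends pointing out of, resp. into, the diagram. *)
Definition bouts (G : diagram) : seq (E * nat) :=
  [seq d <- outs G | d.1 \notin [seq d'.1 | d' <- ins G]].
Definition bins (G : diagram) : seq (E * nat) :=
  [seq d <- ins G | d.1 \notin [seq d'.1 | d' <- outs G]].

Definition potential (G : diagram) : A :=
  \sum_(d <- bouts G) Fat d.2 d.1 - \sum_(d <- bins G) Fat d.2 d.1.

(* The variables of the boundary ends other than e. *)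
Definition other_vars (G : diagram) (e : E) : {set nvar} :=
  lvars [seq d <- bouts G ++ bins G | d.1 != e].

Fixpoint dvars (G : diagram) : {set nvar} :=
  if G is P :: G' then pvars P :|: dvars G' else set0.

(* C'(G), over the ring in all the variables of G. *)
Fixpoint Cfact (G : diagram) : ffact (dvars G) :=
  match G with
  | [::] => ff_unit set0
  | P :: G' => boxtimes (pfact P) (Cfact G')
  end.

(* Replaces the label e by x. *)
Definition relabel (e x : E) (G : diagram) : diagram :=
  let f l := if l == e then x else l in
  [seq match P with
       | Line i a b => Line i (f a) (f b)
       | Merge p q a b c => Merge p q (f a) (f b) (f c)
       | Split p q a b c => Split p q (f a) (f b) (f c)
       end | P <- G].

(* x can be used as a label for the end e of G. *)
Definition available (G : diagram) (e x : E) : bool :=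
  (x == e) || (x \notin labels G).

Definition line (i : nat) (x y : E) : ffact (pvars (Line i x y)) :=
  pfact (Line i x y).

(* L_i(x; y) with the sequence labelled y replaced by the one labelled x. *)
Definition circle (i : nat) (x y : E) : ffact (evars (x, i)) :=
  ff_map (psubst (fun v : nvar => if v.1 == y then (x, v.2) else v)
                 (evars (x, i)))
         (line i x y).

(* J_(F_i), in the variables of the sequence labelled x. *)
Definition jacobi_algebra (i : nat) (x : E) : gmod set0 :=
  @quo_gmod nvar nwt set0 (evars (x, i)) i
    (fun j => inQ (evars (x, i)) (peval (Fpoly n i)^`M(j) (fun l => xv x l))).

End Diagrams.

(* Main.v *)
(** A Koszul factor K(a; b) whose entry b is a nonzerodivisor can be removed:
    projecting K(a; b) (x) N onto N / b is a surjection of factorizations whose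
    kernel is contractible, so it is a homotopy equivalence by homological
    perturbation as soon as it has a graded linear section.  In C'(G) (x) L_i the
    second entries are x_j - y_j, and removing the Koszul factors one by one
    substitutes the x_j for the y_j.  For the circle the second entries vanish
    and the first ones are the partial derivatives of F_i; the same argument with
    the roles of the entries exchanged, whence a shift and a flip per factor,
    leaves the Jacobi algebra, provided these derivatives form a regular sequence.
    Writing E = 1 + x_1 z + ... + x_i z^i, F_i is up to sign the coefficient of
    z^(n+1) in z E' / E, so dF_i / dx_j is up to a constant the coefficient
    c_(n+1-j) of 1 / E.  The c_k satisfy a linear recurrence with coefficients
    the - x_j, from which regularity follows by induction. *)
Require Import Defs.
From HB Require Import structures.
From mathcomp Require Import all_boot all_order all_algebra.
From mathcomp Require Import ring_quotient.
From mathcomp Require Import mpoly boolp.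
From mathcomp Require Import ring zify.

Set Implicit Arguments.
Unset Strict Implicit.
Unset Printing Implicit Defensive.

Import GRing.Theory Num.Theory.
Local Open Scope ring_scope.

(** The obstacle is that the factorizations met on the way have infinite rank over the boundary ring
    Q[S], while their entries lie in quotients of a larger ring Q[T]. So finite matrices over Q[T]
    are kept, and only the quotient through which they act changes: [gq Q N] is N tensored with
    Q[T]/I and seen over Q[S], where [Q] records the projection together with a graded Q[S]-linear
    section. The section turns division by b into a linear map, and this division is the contraction
    of the kernel. For a gluing, I is generated by differences of variables, so projection and
    section are a renaming and an inclusion. For the circle the base ring is the field Q, and a
    section comes from a basis of monomials. Freeness over Q[S] is checked only at the two ends of
    each chain of equivalences.

    All differentials have degree n+1, half the degree of the potentials. Removing the factor number
    j of the circle by its first entry, of degree 2(n+1-j), shifts by 2j-(n+1), and these shifts add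
    up to i^2 - in. *)

Section ZmoduleReflection.

(** Equations between chain maps and homotopies live in modules, where only the additive structure
    can be normalized: the value of an expression is determined by its integer coefficients on a
    list of atoms. *)
Inductive zexp := ZVar of nat | ZZero | ZAdd of zexp & zexp | ZOpp of zexp.

Fixpoint zeval (M : zmodType) (env : seq M) (e : zexp) : M :=
  match e with
  | ZVar k => nth 0 env k
  | ZZero => 0
  | ZAdd a b => zeval env a + zeval env b
  | ZOpp a => - zeval env a
  end.

Fixpoint zcoef (e : zexp) (k : nat) : int :=
  match e with
  | ZVar j => if j == k then 1 else 0
  | ZZero => 0
  | ZAdd a b => zcoef a k + zcoef b k
  | ZOpp a => - zcoef a k
  end.

Lemma zevalE (M : zmodType) (env : seq M) e :
  zeval env e = \sum_(k < size env) nth 0 env k *~ zcoef e k.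
Proof.
elim: e => [j||a IHa b IHb|a IHa].
- rewrite /=; have [hj|hj] := ltnP j (size env); last first.
    rewrite nth_default // big1 // => k _; case: eqP => [E|]; last by rewrite mulr0z.
    by move: (ltn_ord k); rewrite -E ltnNge hj.
  rewrite (bigD1 (Ordinal hj)) //= eqxx mulr1z big1 ?addr0 // => k hk.
  by case: eqP => [E|]; [case/eqP: hk; apply: val_inj | rewrite mulr0z].
- by rewrite big1 // => k _; rewrite mulr0z.
- by rewrite [LHS]/= IHa IHb -big_split; apply: eq_bigr => k _; rewrite /= mulrzDr.
- by rewrite [LHS]/= IHa -sumrN; apply: eq_bigr => k _; rewrite mulrNz.
Qed.

Lemma zeval_eq (M : zmodType) (env : seq M) e1 e2 :
  all (fun k => zcoef e1 k == zcoef e2 k) (iota 0 (size env)) ->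
  zeval env e1 = zeval env e2.
Proof.
move=> /allP h; rewrite !zevalE; apply: eq_bigr => k _.
by congr (_ *~ _); apply/eqP/h; rewrite mem_iota add0n ltn_ord.
Qed.
End ZmoduleReflection.

Ltac zindex x env :=
  lazymatch env with
  | cons ?y ?t => match goal with
      | _ => let _ := match goal with _ => unify x y end in constr:(0%N)
      | _ => let k := zindex x t in constr:(S k)
      end
  end.
Ltac zatoms t env :=
  lazymatch t with
  | ?a + ?b => let env := zatoms a env in zatoms b env
  | - ?a => zatoms a env
  | 0 => env
  | _ => match goal with
         | _ => let k := zindex t env in env
         | _ => constr:(cons t env)
         end
  end.
Ltac zreify t env :=
  lazymatch t with
  | ?a + ?b => let a := zreify a env in let b := zreify b env in constr:(ZAdd a b)
  | - ?a => let a := zreify a env in constr:(ZOpp a)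
  | 0 => constr:(ZZero)
  | _ => let k := zindex t env in constr:(ZVar k)
  end.
(* Decides identities of abelian groups. *)
Ltac zmodule :=
  lazymatch goal with
  | |- @eq ?T ?a ?b =>
    let env := zatoms a (@nil T) in let env := zatoms b env in
    let ea := zreify a env in let eb := zreify b env in
    exact: (@zeval_eq _ env ea eb isT)
  end.

(** Lets a goal follow from hypotheses by a linear combination: once these are added up to one
    equation [a = b], what remains is a formal identity for [zmodule]. *)
Lemma zsub_eq (M : zmodType) (a b x y : M) : a = b -> x - y = a - b -> x = y.
Proof. by move=> -> /eqP; rewrite subrr subr_eq0 => /eqP. Qed.

(** * Homotopy equivalences and the perturbation lemma *)

Section HomotopyEquivalence.
Variables (V : finType) (S : {set V}).
Implicit Types M N P : gfact S.

(** This is the last clause of [hmf_iso]: without [is_mf], equivalences can be chained through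
    quotients whose freeness is never examined. *)
Definition heq M N : Prop :=
  exists (f : gf_hom M N) (g : gf_hom N M),
    null_homotopic (fun m => hom0 g (hom0 f m) - m)
                   (fun m => hom1 g (hom1 f m) - m) /\
    null_homotopic (fun m => hom0 f (hom0 g m) - m)
                   (fun m => hom1 f (hom1 g m) - m).

Lemma heq_hmf_iso wt w M N :
  is_mf wt w M -> is_mf wt w N -> heq M N -> hmf_iso wt w M N.
Proof. by move=> hM hN hMN; split. Qed.

Lemma heq_refl M : heq M M.
Proof.
have h : forall m, dif0 M (idfun m) = idfun (dif0 M m) by [].
have h' : forall m, dif1 M (idfun m) = idfun (dif1 M m) by [].
exists (@GFHom _ _ M M idfun idfun (fun _ _ => id) (fun _ _ => id) h h').
exists (@GFHom _ _ M M idfun idfun (fun _ _ => id) (fun _ _ => id) h h').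
by split; exists \0, \0; split=> m /=; rewrite subrr raddf0 addr0.
Qed.

Lemma heq_sym M N : heq M N -> heq N M.
Proof. by case=> f [g [h1 h2]]; exists g, f. Qed.

Definition gf_comp M N P (g : gf_hom N P) (f : gf_hom M N) : gf_hom M P.
Proof.
refine (@GFHom _ _ M P (hom0 g \o hom0 f) (hom1 g \o hom1 f) _ _ _ _).
- by move=> d m hm /=; do 2 apply: hom0_deg.
- by move=> d m hm /=; do 2 apply: hom1_deg.
- by move=> m /=; rewrite !hom0_dif.
- by move=> m /=; rewrite !hom1_dif.
Defined.

Lemma null_homotopic_comp M N P (f : gf_hom M N) (g : gf_hom N M)
    (f' : gf_hom N P) (g' : gf_hom P N) :
  null_homotopic (fun m => hom0 g (hom0 f m) - m)
                 (fun m => hom1 g (hom1 f m) - m) ->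
  null_homotopic (fun m => hom0 g' (hom0 f' m) - m)
                 (fun m => hom1 g' (hom1 f' m) - m) ->
  null_homotopic (fun m => hom0 (gf_comp g g') (hom0 (gf_comp f' f) m) - m)
                 (fun m => hom1 (gf_comp g g') (hom1 (gf_comp f' f) m) - m).
Proof.
move=> [h0 [h1 [e0 e1]]] [k0 [k1 [e0' e1']]].
(* From g g' f' f - 1 = g (g' f' - 1) f + (g f - 1): the second homotopy is conjugated by the first
   pair of maps. *)
exists (h0 \+ (hom1 g \o (k0 \o hom0 f))), (h1 \+ (hom0 g \o (k1 \o hom1 f))).
split=> m /=.
- have := congr1 (hom0 g) (e0' (hom0 f m)).
  rewrite !raddfD raddfN /= hom0_dif -hom1_dif => E2.
  apply: (zsub_eq (congr2 +%R (e0 m) E2)); zmodule.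
- have := congr1 (hom1 g) (e1' (hom1 f m)).
  rewrite !raddfD raddfN /= hom1_dif -hom0_dif => E2.
  apply: (zsub_eq (congr2 +%R (e1 m) E2)); zmodule.
Qed.

Lemma heq_trans N M P : heq M N -> heq N P -> heq M P.
Proof.
move=> [f [g [h1 h2]]] [f' [g' [h1' h2']]].
exists (gf_comp f' f), (gf_comp g g').
by split; apply: null_homotopic_comp.
Qed.

Lemma heq_flip M N : heq M N -> heq (gf_flip M) (gf_flip N).
Proof.
have F (A B : gfact S) (f : gf_hom A B) : exists f' : gf_hom (gf_flip A) (gf_flip B),
    (hom0 f' = hom1 f) /\ (hom1 f' = hom0 f).
  unshelve eexists.
    refine (@GFHom _ _ (gf_flip A) (gf_flip B) (hom1 f) (hom0 f) _ _ _ _).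
    - by move=> d m hm; apply: (@hom1_deg _ _ _ _ f).
    - by move=> d m hm; apply: (@hom0_deg _ _ _ _ f).
    - by move=> m /=; rewrite raddfN hom1_dif.
    - by move=> m /=; rewrite raddfN hom0_dif.
  by [].
have H (A B : gfact S) (f : gf_hom A B) (g : gf_hom B A)
    (f' : gf_hom (gf_flip A) (gf_flip B)) (g' : gf_hom (gf_flip B) (gf_flip A)) :
    (hom0 f' = hom1 f) /\ (hom1 f' = hom0 f) ->
    (hom0 g' = hom1 g) /\ (hom1 g' = hom0 g) ->
    null_homotopic (fun m => hom0 g (hom0 f m) - m)
                   (fun m => hom1 g (hom1 f m) - m) ->
    null_homotopic (fun m => hom0 g' (hom0 f' m) - m)
                   (fun m => hom1 g' (hom1 f' m) - m).
  move=> [-> ->] [-> ->] [h0 [h1 [e0 e1]]].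
  (* The flip changes the sign of both differentials, so the homotopies change sign as well. *)
  exists (\- h1), (\- h0); split=> m /=; rewrite !raddfN !opprK;
    [exact: e1 | exact: e0].
move=> [f [g [hf hg]]].
have [f' ef] := F _ _ f; have [g' eg] := F _ _ g.
by exists f', g'; split; [apply: (H _ _ f g) | apply: (H _ _ g f)].
Qed.

Lemma heq_shift a M N : heq M N -> heq (gf_shift a M) (gf_shift a N).
Proof.
have F (A B : gfact S) (f : gf_hom A B) : exists f' : gf_hom (gf_shift a A) (gf_shift a B),
    (hom0 f' = hom0 f) /\ (hom1 f' = hom1 f).
  unshelve eexists.
    refine (@GFHom _ _ (gf_shift a A) (gf_shift a B) (hom0 f) (hom1 f) _ _ _ _).
    - by move=> d m hm; apply: (@hom0_deg _ _ _ _ f).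
    - by move=> d m hm; apply: (@hom1_deg _ _ _ _ f).
    - by move=> m /=; rewrite hom0_dif.
    - by move=> m /=; rewrite hom1_dif.
  by [].
move=> [f [g [hf hg]]].
have [f' [ef0 ef1]] := F _ _ f; have [g' [eg0 eg1]] := F _ _ g.
by exists f', g'; split; rewrite ef0 ef1 eg0 eg1.
Qed.

Lemma heq_iso M N (f0 : {linear G0 M -> G0 N}) (f1 : {linear G1 M -> G1 N})
    (g0 : {linear G0 N -> G0 M}) (g1 : {linear G1 N -> G1 M}) :
  cancel f0 g0 -> cancel g0 f0 -> cancel f1 g1 -> cancel g1 f1 ->
  (forall d m, gm_deg d m -> gm_deg d (f0 m)) ->
  (forall d m, gm_deg d m -> gm_deg d (f1 m)) ->
  (forall d m, gm_deg d m -> gm_deg d (g0 m)) ->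
  (forall d m, gm_deg d m -> gm_deg d (g1 m)) ->
  (forall m, dif0 N (f0 m) = f1 (dif0 M m)) ->
  (forall m, dif1 N (f1 m) = f0 (dif1 M m)) -> heq M N.
Proof.
move=> c0 c0' c1 c1' hf0 hf1 hg0 hg1 d0 d1.
have d0' m : dif0 M (g0 m) = g1 (dif0 N m).
  by rewrite -[in RHS](c0' m) d0 c1.
have d1' m : dif1 M (g1 m) = g0 (dif1 N m).
  by rewrite -[in RHS](c1' m) d1 c0.
exists (GFHom hf0 hf1 d0 d1), (GFHom hg0 hg1 d0' d1').
by split; exists \0, \0; split=> m /=;
  rewrite ?c0 ?c0' ?c1 ?c1' subrr raddf0 addr0.
Qed.

(* Homological perturbation: the graded section s of f is corrected to the
   chain map s - k (d s - s d). *)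
Lemma heq_perturb w c M N (f : gf_hom M N)
    (s0 : {linear G0 N -> G0 M}) (s1 : {linear G1 N -> G1 M})
    (k0 : {linear G0 M -> G1 M}) (k1 : {linear G1 M -> G0 M}) :
  (forall m, dif1 M (dif0 M m) = w *: m) ->
  (forall m, dif0 M (dif1 M m) = w *: m) ->
  (forall d m m', @gm_deg _ _ (G0 M) d m -> gm_deg d m' -> gm_deg d (m - m')) ->
  (forall d m m', @gm_deg _ _ (G1 M) d m -> gm_deg d m' -> gm_deg d (m - m')) ->
  (forall d m, gm_deg d m -> gm_deg (d + c) (dif0 M m)) ->
  (forall d m, gm_deg d m -> gm_deg (d + c) (dif1 M m)) ->
  (forall d m, gm_deg d m -> gm_deg (d + c) (dif0 N m)) ->
  (forall d m, gm_deg d m -> gm_deg (d + c) (dif1 N m)) ->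
  (forall d m, gm_deg (d + c) m -> gm_deg d (k0 m)) ->
  (forall d m, gm_deg (d + c) m -> gm_deg d (k1 m)) ->
  (forall d m, gm_deg d m -> gm_deg d (s0 m)) ->
  (forall d m, gm_deg d m -> gm_deg d (s1 m)) ->
  cancel s0 (hom0 f) -> cancel s1 (hom1 f) ->
  (forall m, hom1 f (k0 m) = 0) -> (forall m, hom0 f (k1 m) = 0) ->
  (forall m, k0 (s0 m) = 0) -> (forall m, k1 (s1 m) = 0) ->
  (forall m, hom0 f m = 0 -> dif1 M (k0 m) + k1 (dif0 M m) = m) ->
  (forall m, hom1 f m = 0 -> dif0 M (k1 m) + k0 (dif1 M m) = m) ->
  heq M N.
Proof.
move=> w0 w1 B0 B1 dM0 dM1 dN0 dN1 dk0 dk1 ds0 ds1 c0 c1 fk0 fk1 ks0 ks1 e0 e1.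
(* [N] inherits the potential of [M] because [f] has the section [s0]. *)
have w0N m : dif1 N (dif0 N m) = w *: m.
  by rewrite -{1}(c0 m) hom0_dif hom1_dif w0 linearZ c0.
have w1N m : dif0 N (dif1 N m) = w *: m.
  by rewrite -{1}(c1 m) hom1_dif hom0_dif w1 linearZ c1.
pose g0 := s0 \- (k1 \o ((dif0 M \o s0) \- (s1 \o dif0 N))).
pose g1 := s1 \- (k0 \o ((dif1 M \o s1) \- (s0 \o dif1 N))).
(* The defect d s - s d takes its values in the kernel of [f], where d k + k d is the identity; this
   is what makes the corrected section commute with the differentials. *)
have K0 m : hom1 f (dif0 M (s0 m) - s1 (dif0 N m)) = 0.
  by rewrite raddfB /= -hom0_dif c0 c1 subrr.
have K1 m : hom0 f (dif1 M (s1 m) - s0 (dif1 N m)) = 0.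
  by rewrite raddfB /= -hom1_dif c1 c0 subrr.
have hg0 d m : gm_deg d m -> gm_deg d (g0 m).
  move=> hm; apply: B0; first exact: ds0.
  by apply: dk1; apply: B1; [apply/dM0/ds0 | apply/ds1/dN0].
have hg1 d m : gm_deg d m -> gm_deg d (g1 m).
  move=> hm; apply: B1; first exact: ds1.
  by apply: dk0; apply: B0; [apply/dM1/ds1 | apply/ds0/dN1].
have cg0 m : dif0 M (g0 m) = g1 (dif0 N m).
  have := e1 _ (K0 m); rewrite /g0 /g1 /= w0N !raddfB /= w0.
  rewrite ![s0 (w *: _)]linearZ /= => E.
  apply: (zsub_eq (esym E)); zmodule.
have cg1 m : dif1 M (g1 m) = g0 (dif1 N m).
  have := e0 _ (K1 m); rewrite /g0 /g1 /= w1N !raddfB /= w1.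
  rewrite ![s1 (w *: _)]linearZ /= => E.
  apply: (zsub_eq (esym E)); zmodule.
exists f, (GFHom hg0 hg1 cg0 cg1); split.
(* The contraction identity at [m - s (f m)], together with k s = 0, says that - k is a homotopy
   between g f and the identity. In the other direction f g is the identity exactly, since f k =
   0. *)
- exists (\- k0), (\- k1); split=> m /=.
  + have : hom0 f (m - s0 (hom0 f m)) = 0 by rewrite raddfB /= c0 subrr.
    move/e0; rewrite /g0 /= !raddfB /= ks0 ks1 => E.
    apply: (zsub_eq E); rewrite ?ks0 ?ks1 !raddf0 !raddfN; zmodule.
  + have : hom1 f (m - s1 (hom1 f m)) = 0 by rewrite raddfB /= c1 subrr.
    move/e1; rewrite /g1 /= !raddfB /= ks0 ks1 => E.
    apply: (zsub_eq E); rewrite ?ks0 ?ks1 !raddf0 !raddfN; zmodule.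
- exists \0, \0; split=> m /=; rewrite raddf0 addr0.
  + by rewrite raddfB /= c0 fk1 subr0 subrr.
  + by rewrite raddfB /= c1 fk0 subr0 subrr.
Qed.
End HomotopyEquivalence.

(** * Weighted homogeneous polynomials *)

Section WeightedPolynomials.
Variables (k : nat) (ww : 'I_k -> nat).
Implicit Types (p q : {mpoly rat[k]}).

Definition pwt (m : 'X_{1..k}) : nat := \sum_i m i * ww i.

Lemma pwtD m1 m2 : pwt (m1 + m2)%MM = (pwt m1 + pwt m2)%N.
Proof.
by rewrite /pwt -big_split; apply: eq_bigr => v _; rewrite mnmDE mulnDl.
Qed.

(** Indexed variables with arbitrary weights serve two purposes: F_r, whose argument number j gets
    weight j, and the ambient ring of named variables. *)
Definition phomog (d : int) p : bool := all (fun m => (pwt m)%:Z == d) (msupp p).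

Lemma phomogP d p : reflect (forall m, p@_m != 0 -> (pwt m)%:Z = d) (phomog d p).
Proof.
apply: (iffP allP) => h m; first by rewrite -mcoeff_msupp => /h/eqP.
by rewrite mcoeff_msupp => /h ->.
Qed.

Lemma phomog0 d : phomog d 0.
Proof. by apply/phomogP => m; rewrite mcoeff0 eqxx. Qed.

Lemma phomogB d p q : phomog d p -> phomog d q -> phomog d (p - q).
Proof.
move=> /phomogP hp /phomogP hq; apply/phomogP => m; rewrite mcoeffB => h.
have [E|] := eqVneq (p@_m) 0; last exact: hp.
by apply: hq; apply: contraNneq h => ->; rewrite E subr0.
Qed.

Lemma phomogN d p : phomog d p -> phomog d (- p).
Proof. by move=> h; rewrite -sub0r; apply: phomogB => //; apply: phomog0. Qed.

Lemma phomogD d p q : phomog d p -> phomog d q -> phomog d (p + q).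
Proof. by move=> hp hq; rewrite -[q]opprK; apply: phomogB => //; apply: phomogN. Qed.

Lemma phomogM d e p q : phomog d p -> phomog e q -> phomog (d + e) (p * q).
Proof.
move=> /allP hp /allP hq; apply/allP => m /msuppM_le.
case/allpairsP => -[m1 m2] /= [/hp/eqP h1 /hq/eqP h2 ->].
by rewrite pwtD PoszD h1 h2.
Qed.

Lemma phomogC c : phomog 0 c%:MP.
Proof.
apply/phomogP => m; rewrite mcoeffC; have [->|_] := eqVneq m 0%MM.
  by rewrite /pwt big1 // => v _; rewrite mnm0E.
by rewrite mulr0 eqxx.
Qed.

Lemma phomogX i : phomog (ww i)%:Z 'X_i.
Proof.
apply/phomogP => m; rewrite mcoeffX.
case: (U_(i)%MM =P m) => [<- _|_]; last by rewrite eqxx.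
rewrite /pwt (bigD1 i) //= mnm1E eqxx mul1n big1 ?addn0 // => v /negbTE hv.
by rewrite mnm1E eq_sym hv mul0n.
Qed.

Lemma phomog_sum d I (r : seq I) (P : pred I) F :
  (forall i, P i -> phomog d (F i)) -> phomog d (\sum_(i <- r | P i) F i).
Proof.
by move=> h; apply: (big_ind (phomog d)) => //;
  [apply: phomog0 | move=> p q; apply: phomogD].
Qed.
End WeightedPolynomials.

Section Homogeneous.
Variables (V : finType) (wt : V -> nat).
Local Notation mon := 'X_{1..#|V|}.
Implicit Types (S T : {set V}).

Lemma whomogP S d (p : Qs S) :
  reflect (forall m : mon, (qval p)@_m != 0 -> (mnmwt wt m)%:Z = d) (whomog wt d p).
Proof.
apply: (iffP allP) => h m; first by rewrite -mcoeff_msupp => /h/eqP.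
by rewrite mcoeff_msupp => /h ->.
Qed.

Lemma mnmwtD (m1 m2 : mon) : mnmwt wt (m1 + m2)%MM = (mnmwt wt m1 + mnmwt wt m2)%N.
Proof.
by rewrite /mnmwt -big_split; apply: eq_bigr => v _; rewrite mnmDE mulnDl.
Qed.

Definition ahomog (d : int) (p : amb V) : bool :=
  all (fun m : mon => (mnmwt wt m)%:Z == d) (msupp p).

Lemma ahomogP d (p : amb V) :
  reflect (forall m : mon, p@_m != 0 -> (mnmwt wt m)%:Z = d) (ahomog d p).
Proof.
apply: (iffP allP) => h m; first by rewrite -mcoeff_msupp => /h/eqP.
by rewrite mcoeff_msupp => /h ->.
Qed.

Lemma ahomogE d p : ahomog d p = phomog (wt \o enum_val) d p.
Proof.
apply: eq_all => m; congr (Posz _ == _); rewrite /pwt (reindex (@enum_rank V)) /=.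
  by apply: eq_bigr => v _; rewrite enum_rankK.
by exists (@enum_val V predT) => v _; rewrite ?enum_rankK ?enum_valK.
Qed.

Lemma ahomog0 d : ahomog d 0.
Proof. by rewrite ahomogE phomog0. Qed.
Lemma ahomogB d p q : ahomog d p -> ahomog d q -> ahomog d (p - q).
Proof. by rewrite !ahomogE; apply: phomogB. Qed.
Lemma ahomogN d p : ahomog d p -> ahomog d (- p).
Proof. by rewrite !ahomogE; apply: phomogN. Qed.
Lemma ahomogD d p q : ahomog d p -> ahomog d q -> ahomog d (p + q).
Proof. by rewrite !ahomogE; apply: phomogD. Qed.
Lemma ahomogM d e p q : ahomog d p -> ahomog e q -> ahomog (d + e) (p * q).
Proof. by rewrite !ahomogE; apply: phomogM. Qed.
Lemma ahomogC c : ahomog 0 c%:MP.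
Proof. by rewrite ahomogE phomogC. Qed.

Lemma ahomogZ d c p : ahomog d p -> ahomog d (c *: p).
Proof. by move=> h; rewrite -mul_mpolyC -[d]add0r ahomogM ?ahomogC. Qed.

Lemma ahomogX v : ahomog (wt v)%:Z 'X_(enum_rank v).
Proof. by rewrite ahomogE -{1}(enum_rankK v) phomogX. Qed.

Lemma ahomog_sum d I (r : seq I) (P : pred I) F :
  (forall i, P i -> ahomog d (F i)) -> ahomog d (\sum_(i <- r | P i) F i).
Proof. by rewrite ahomogE => h; apply: phomog_sum => i /h; rewrite ahomogE. Qed.

Lemma ahomog_prod I (r : seq I) (P : pred I) (d : I -> int) F :
  (forall i, P i -> ahomog (d i) (F i)) ->
  ahomog (\sum_(i <- r | P i) d i) (\prod_(i <- r | P i) F i).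
Proof.
move=> h; apply: (big_ind2 ahomog) => //; first exact: ahomogC.
by move=> *; apply: ahomogM.
Qed.

Lemma ahomogXn d p k : ahomog d p -> ahomog (d *+ k) (p ^+ k).
Proof.
move=> h; elim: k => [|k IH]; first exact: ahomogC.
by rewrite exprS mulrS ahomogM.
Qed.

Lemma whomog0 S d : whomog wt d (0 : Qs S).
Proof. exact: ahomog0. Qed.
Lemma whomogB S d (p q : Qs S) :
  whomog wt d p -> whomog wt d q -> whomog wt d (p - q).
Proof. exact: ahomogB. Qed.
Lemma whomogN S d (p : Qs S) : whomog wt d p -> whomog wt d (- p).
Proof. exact: ahomogN. Qed.
Lemma whomogD S d (p q : Qs S) :
  whomog wt d p -> whomog wt d q -> whomog wt d (p + q).
Proof. exact: ahomogD. Qed.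
Lemma whomogM S d e (p q : Qs S) :
  whomog wt d p -> whomog wt e q -> whomog wt (d + e) (p * q).
Proof. exact: ahomogM. Qed.

Lemma whomog_sum S d (I : finType) (P : pred I) (F : I -> Qs S) :
  (forall i, P i -> whomog wt d (F i)) -> whomog wt d (\sum_(i | P i) F i).
Proof.
by move=> h; apply: (big_ind (whomog wt d)) => //;
  [apply: whomog0 | move=> p q; apply: whomogD].
Qed.

Lemma whomog_delta S (I : eqType) (i j : I) d (p : Qs S) :
  (i = j -> whomog wt d p) -> whomog wt d ((i == j)%:R * p).
Proof.
by case: eqP => [E h|_ _]; rewrite ?mul1r ?mul0r ?whomog0 //; apply: h.
Qed.

Lemma whomog_emb S T d (p : Qs S) :
  S \subset T -> whomog wt d (emb T p) = whomog wt d p.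
Proof. by move=> h; rewrite /whomog emb_val. Qed.

(** Both differentials have degree [c], so a potential has degree 2c; in the applications [c] is
    n+1. *)
Definition fhomog T (c : int) (M : ffact T) : Prop :=
  (forall j i, whomog wt (c + g0 i - g1 j) (D0 (f := M) j i)) /\
  (forall i j, whomog wt (c + g1 j - g0 i) (D1 (f := M) i j)).
End Homogeneous.

(** * Factorizations with coefficients in a split quotient *)

Section Quotients.
Variables (V : finType) (wt : V -> nat) (S T : {set V}).

(* A quotient W of Q[T] by an ideal, with a splitting tau of the projection phi
   over Q[S]. *)
Record qdat := QDat {
  qW : lmodType (Qs S);
  qdeg : int -> qW -> Prop;
  qphi : {additive Qs T -> qW};
  qtau : {additive qW -> Qs T};
  qphiZ : forall r a, qphi (emb T r * a) = r *: qphi a;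
  qtauZ : forall r w, qtau (r *: w) = emb T r * qtau w;
  qtauK : cancel qtau qphi;
  qphiM : forall a b, qphi (a * qtau (qphi b)) = qphi (a * b);
  qphi_deg : forall d a, whomog wt d a -> qdeg d (qphi a);
  qtau_deg : forall d w, qdeg d w -> whomog wt d (qtau w) }.

Variable Q : qdat.
Local Notation W := (qW Q).

Lemma qdegB d (v w : W) : qdeg d v -> qdeg d w -> qdeg d (v - w).
Proof.
move=> /qtau_deg hv /qtau_deg hw; rewrite -[v - w]qtauK raddfB.
by apply/qphi_deg/whomogB.
Qed.
Lemma qdeg0 d : qdeg d (0 : W).
Proof. by rewrite -(raddf0 (qphi Q)); apply/qphi_deg/whomog0. Qed.

Lemma qdegN d (v : W) : qdeg d v -> qdeg d (- v).
Proof. by move=> h; rewrite -sub0r; apply: qdegB => //; apply: qdeg0. Qed.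

Definition gq_mod (I : finType) (g : I -> int) : gmod S :=
  @GMod _ S {ffun I -> W} (fun d v => forall i, qdeg (d - g i) (v i)).

(** W is only a Q[S]-module, so a matrix entry acts by lifting with [qtau], multiplying in Q[T] and
    projecting. The choice of the lift is immaterial by [qphiM], which expresses that the kernel of
    [qphi] is an ideal. *)
Definition gq_act (I J : finType) (D : J -> I -> Qs T) (v : {ffun I -> W}) :
  {ffun J -> W} := [ffun j => qphi Q (\sum_i D j i * qtau Q (v i))].

Fact gq_act_linear (I J : finType) (D : J -> I -> Qs T) : linear (gq_act D).
Proof.
move=> a u v; apply/ffunP => j; rewrite !ffunE -qphiZ -raddfD mulr_sumr /=.
rewrite -big_split /=; congr (qphi Q _); apply: eq_bigr => i _.
by rewrite !ffunE raddfD /= qtauZ mulrDr mulrCA.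
Qed.
HB.instance Definition _ (I J : finType) (D : J -> I -> Qs T) :=
  GRing.isLinear.Build (Qs S) {ffun I -> W} {ffun J -> W} _
    (gq_act D) (gq_act_linear D).

Definition gq (N : ffact T) : gfact S :=
  @GFact _ S (gq_mod (@g0 _ T N)) (gq_mod (@g1 _ T N))
    (gq_act (@D0 _ T N)) (gq_act (@D1 _ T N)).

Lemma gq_act_deg (I J : finType) (g : I -> int) (h : J -> int) c
    (D : J -> I -> Qs T) d (v : {ffun I -> W}) :
  (forall j i, whomog wt (c + g i - h j) (D j i)) ->
  (forall i, qdeg (d - g i) (v i)) ->
  forall j, qdeg (d + c - h j) (gq_act D v j).
Proof.
move=> hD hv j; rewrite ffunE; apply/qphi_deg/whomog_sum => i _.
have -> : d + c - h j = (c + g i - h j) + (d - g i) by ring.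
by apply: whomogM => //; apply: qtau_deg.
Qed.
End Quotients.

(** * Removing one Koszul factor *)

Section Peeling.
Variables (V : finType) (wt : V -> nat) (S T : {set V}) (Q Q' : qdat wt S T).
Variables (b : Qs T) (db : int).
Local Notation W := (qW Q).
Local Notation W' := (qW Q').

Hypothesis kerQ : forall p, qphi Q p = 0 -> qphi Q' p = 0.
Hypothesis kerb : qphi Q' b = 0.
Hypothesis kerQ' : forall p, qphi Q' p = 0 -> exists t, qphi Q p = qphi Q (b * t).
Hypothesis kerQ'_deg : forall d p, whomog wt d p -> qphi Q' p = 0 ->
  exists2 t, whomog wt (d - db) t & qphi Q p = qphi Q (b * t).
Hypothesis nzd : forall t, qphi Q (b * t) = 0 -> qphi Q t = 0.

Let pr (w : W) : W' := qphi Q' (qtau Q w).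
Let se (w : W') : W := qphi Q (qtau Q' w).
Let mulb (w : W) : W := qphi Q (b * qtau Q w).

Let prphi p : pr (qphi Q p) = qphi Q' p.
Proof.
apply/eqP; rewrite -subr_eq0 -raddfB; apply/eqP/kerQ.
by rewrite raddfB /= qtauK subrr.
Qed.
Let pr_act p w : qphi Q' (p * qtau Q w) = qphi Q' (p * qtau Q' (pr w)).
Proof. by rewrite qphiM. Qed.
Let seK : cancel se pr.
Proof. by move=> w; rewrite prphi qtauK. Qed.
Let kerbM t : qphi Q' (b * t) = 0.
Proof. by rewrite mulrC -qphiM kerb raddf0 mulr0 raddf0. Qed.

Fact pr_linear : linear pr.
Proof. by move=> a u v; rewrite /pr raddfD /= qtauZ raddfD /= qphiZ. Qed.
HB.instance Definition _ := GRing.isLinear.Build (Qs S) W W' _ pr pr_linear.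
Fact se_linear : linear se.
Proof. by move=> a u v; rewrite /se raddfD /= qtauZ raddfD /= qphiZ. Qed.
HB.instance Definition _ := GRing.isLinear.Build (Qs S) W' W _ se se_linear.
Fact mulb_linear : linear mulb.
Proof.
by move=> a u v; rewrite /mulb raddfD /= qtauZ mulrDr raddfD /= mulrCA qphiZ.
Qed.
HB.instance Definition _ := GRing.isLinear.Build (Qs S) W W _ mulb mulb_linear.

Let mulb_inj : injective mulb.
Proof.
move=> u v h; have : mulb (u - v) = 0 by rewrite raddfB /= h subrr.
by move/nzd; rewrite qtauK => /eqP; rewrite subr_eq0 => /eqP.
Qed.

(** Division by [b] with remainder: the remainder is the representative chosen by [se]. The quotient
    is unique because [b] is a nonzerodivisor, and uniqueness makes it linear and homogeneous of
    degree [- db]. *)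
Let div_ex w : exists u, mulb u = w - se (pr w).
Proof.
have : qphi Q' (qtau Q (w - se (pr w))) = 0.
  by rewrite -[LHS]/(pr _) raddfB /= seK subrr.
move/kerQ' => [t]; rewrite qtauK => E; exists (qphi Q t).
by rewrite /mulb qphiM -E.
Qed.
Let div w : W := sval (cid (div_ex w)).
Let divP w : mulb (div w) = w - se (pr w).
Proof. exact: svalP (cid (div_ex w)). Qed.
Fact div_linear : linear div.
Proof.
move=> a u v; apply: mulb_inj; rewrite linearP /= !divP linearP /= linearP /=.
by rewrite scalerBr opprD addrACA.
Qed.
HB.instance Definition _ := GRing.isLinear.Build (Qs S) W W _ div div_linear.

Let pr_deg d w : qdeg d w -> qdeg d (pr w).
Proof. by move=> /qtau_deg h; apply: qphi_deg. Qed.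
Let se_deg d w : qdeg d w -> qdeg d (se w).
Proof. by move=> /qtau_deg h; apply: qphi_deg. Qed.
Let div_deg d w : qdeg d w -> qdeg (d - db) (div w).
Proof.
move=> hw.
have h : qdeg d (w - se (pr w)) by apply: qdegB => //; apply/se_deg/pr_deg.
have [|t ht E] := kerQ'_deg (qtau_deg h).
  by rewrite -[LHS]/(pr _) raddfB /= seK subrr.
have -> : div w = qphi Q t.
  by apply: mulb_inj; rewrite divP /mulb qphiM -E qtauK.
exact: qphi_deg.
Qed.
Let div_se w : div (se w) = 0.
Proof. by apply: mulb_inj; rewrite divP seK subrr raddf0. Qed.

(** The basis of [X] consists of a copy of the basis of [N] and of a second copy, shifted and with
    even and odd exchanged. Only the rows of the differentials that land in the first copy are
    prescribed: there they are the differential of [N] and plus or minus [b]. The other rows are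
    controlled by the potential [w] alone, so that the same lemma applies whichever entry of the
    Koszul factor is the regular one. *)
Variables (X N : ffact T) (c : int).
Variables (h0 : I0 X -> I0 N + I1 N) (h0' : I0 N + I1 N -> I0 X).
Variables (h1 : I1 X -> I1 N + I0 N) (h1' : I1 N + I0 N -> I1 X).
Hypotheses (h0K : cancel h0 h0') (h0K' : cancel h0' h0).
Hypotheses (h1K : cancel h1 h1') (h1K' : cancel h1' h1).
Variables (s0 : I0 N -> bool) (s1 : I1 N -> bool).

Local Notation a0 i := (h0' (inl i)).
Local Notation b0 j := (h0' (inr j)).
Local Notation a1 j := (h1' (inl j)).
Local Notation b1 i := (h1' (inr i)).

Hypothesis D0a : forall j i, D0 (a1 j) (a0 i) = D0 j i.
Hypothesis D0b : forall j j',
  D0 (a1 j) (b0 j') = (j == j')%:R * ((-1) ^+ s1 j * b).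
Hypothesis D1a : forall i j, D1 (a0 i) (a1 j) = D1 i j.
Hypothesis D1b : forall i i',
  D1 (a0 i) (b1 i') = (i == i')%:R * ((-1) ^+ s0 i * b).
Hypothesis g0a : forall i, g0 (a0 i) = g0 i.
Hypothesis g0b : forall j, g0 (b0 j) = g1 j + db - c.
Hypothesis g1a : forall j, g1 (a1 j) = g1 j.
Hypothesis g1b : forall i, g1 (b1 i) = g0 i + db - c.
Hypothesis hX : fhomog wt c X.
Hypothesis hN : fhomog wt c N.
Variable w : Qs S.
Hypothesis w0 : forall m, dif1 (gq Q X) (dif0 (gq Q X) m) = w *: m.
Hypothesis w1 : forall m, dif0 (gq Q X) (dif1 (gq Q X) m) = w *: m.

Section Maps.
Variables (I I' J : finType) (h : I -> J + I') (h' : J + I' -> I).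
Definition peel_f (v : {ffun I -> W}) : {ffun J -> W'} :=
  [ffun j => pr (v (h' (inl j)))].
Definition peel_s (v : {ffun J -> W'}) : {ffun I -> W} :=
  [ffun i => match h i with inl j => se (v j) | inr _ => 0 end].
Variable sg : I' -> bool.
Variables (K : finType) (a : I' -> K).
Definition peel_k (v : {ffun K -> W}) : {ffun I -> W} :=
  [ffun i => match h i with
    | inl _ => 0 | inr j => (-1) ^+ sg j *: div (v (a j)) end].

Fact peel_f_linear : linear peel_f.
Proof. by move=> r u v; apply/ffunP => j; rewrite !ffunE linearP. Qed.
HB.instance Definition _ := GRing.isLinear.Build (Qs S)
  {ffun I -> W} {ffun J -> W'} _ peel_f peel_f_linear.
Fact peel_s_linear : linear peel_s.
Proof.
move=> r u v; apply/ffunP => i; rewrite !ffunE; case: (h i) => j.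
  by rewrite !ffunE linearP.
by rewrite scaler0 addr0.
Qed.
HB.instance Definition _ := GRing.isLinear.Build (Qs S)
  {ffun J -> W'} {ffun I -> W} _ peel_s peel_s_linear.
Fact peel_k_linear : linear peel_k.
Proof.
move=> r u v; apply/ffunP => i; rewrite !ffunE; case: (h i) => j.
  by rewrite scaler0 addr0.
by rewrite !ffunE linearP scalerDr !scalerA [_ * r]mulrC.
Qed.
HB.instance Definition _ := GRing.isLinear.Build (Qs S)
  {ffun K -> W} {ffun I -> W} _ peel_k peel_k_linear.
End Maps.

Let reix (I J K : finType) (h : I -> J + K) (h' : J + K -> I) (F : I -> Qs T) :
  cancel h h' -> cancel h' h ->
  \sum_i F i = \sum_j F (h' (inl j)) + \sum_k F (h' (inr k)).
Proof.
by move=> hK hK'; rewrite (reindex h') ?big_sumType //=; exists h => i _.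
Qed.

Let f0 := peel_f h0'.
Let f1 := peel_f h1'.

Let sum_delta (I : finType) (i : I) (F : I -> Qs T) :
  \sum_j (i == j)%:R * F j = F i.
Proof.
rewrite (bigD1 i) //= eqxx mul1r big1 ?addr0 // => j /negbTE.
by rewrite eq_sym => ->; rewrite mul0r.
Qed.

Let dX0a (v : {ffun I0 X -> W}) j : gq_act (@D0 _ T X) v (a1 j) =
  qphi Q (\sum_i D0 j i * qtau Q (v (a0 i))) + (-1) ^+ s1 j *: mulb (v (b0 j)).
Proof.
rewrite ffunE (reix _ h0K h0K') raddfD; congr (_ + _).
  by congr (qphi Q _); apply: eq_bigr => i _; rewrite D0a.
rewrite (eq_bigr (fun j' => (j == j')%:R *
    ((-1) ^+ s1 j * b * qtau Q (v (b0 j'))))); last first.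
  by move=> j' _; rewrite D0b !mulrA.
by rewrite sum_delta; case: (s1 j);
  rewrite ?expr0 ?expr1 ?mul1r ?scale1r // scaleN1r !mulNr mul1r raddfN.
Qed.
Let dX1a (v : {ffun I1 X -> W}) i : gq_act (@D1 _ T X) v (a0 i) =
  qphi Q (\sum_j D1 i j * qtau Q (v (a1 j))) + (-1) ^+ s0 i *: mulb (v (b1 i)).
Proof.
rewrite ffunE (reix _ h1K h1K') raddfD; congr (_ + _).
  by congr (qphi Q _); apply: eq_bigr => j _; rewrite D1a.
rewrite (eq_bigr (fun i' => (i == i')%:R *
    ((-1) ^+ s0 i * b * qtau Q (v (b1 i'))))); last first.
  by move=> j' _; rewrite D1b !mulrA.
by rewrite sum_delta; case: (s0 i);
  rewrite ?expr0 ?expr1 ?mul1r ?scale1r // scaleN1r !mulNr mul1r raddfN.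
Qed.

Let pr_mulb u : pr (mulb u) = 0.
Proof. by rewrite prphi kerbM. Qed.

Let cf0 v : gq_act (@D0 _ T N) (f0 v) = f1 (gq_act (@D0 _ T X) v).
Proof.
apply/ffunP => j; rewrite [RHS]ffunE dX0a linearD /= linearZ /= pr_mulb.
rewrite scaler0 addr0 prphi ffunE !raddf_sum; apply: eq_bigr => i _.
by rewrite ffunE -pr_act.
Qed.
Let cf1 v : gq_act (@D1 _ T N) (f1 v) = f0 (gq_act (@D1 _ T X) v).
Proof.
apply/ffunP => i; rewrite [RHS]ffunE dX1a linearD /= linearZ /= pr_mulb.
rewrite scaler0 addr0 prphi ffunE !raddf_sum; apply: eq_bigr => j _.
by rewrite ffunE -pr_act.
Qed.

Let signK (r : bool) (u : W) : (-1) ^+ r *: ((-1) ^+ r *: u) = u.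
Proof. by rewrite scalerA -signr_addb addbb scale1r. Qed.

(* On ker f the maps dk + kd and id agree on the components of N by the form of
   the upper rows of the differentials, and on the other ones because d d = w
   and b is a nonzerodivisor. *)
Let contr (IX0 IX1 IN0 IN1 : finType) (d0 : {linear {ffun IX0 -> W} -> {ffun IX1 -> W}})
    (d1 : {linear {ffun IX1 -> W} -> {ffun IX0 -> W}})
    (hh0 : IX0 -> IN0 + IN1) (hh0' : IN0 + IN1 -> IX0)
    (hh1 : IX1 -> IN1 + IN0) (hh1' : IN1 + IN0 -> IX1)
    (t0 : IN0 -> bool) (t1 : IN1 -> bool)
    (E0 : IN1 -> IN0 -> Qs T) (E1 : IN0 -> IN1 -> Qs T) :
  cancel hh0 hh0' -> cancel hh0' hh0 -> cancel hh1' hh1 ->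
  (forall v j, d0 v (hh1' (inl j)) =
     qphi Q (\sum_i E0 j i * qtau Q (v (hh0' (inl i)))) +
     (-1) ^+ t1 j *: mulb (v (hh0' (inr j)))) ->
  (forall v i, d1 v (hh0' (inl i)) =
     qphi Q (\sum_j E1 i j * qtau Q (v (hh1' (inl j)))) +
     (-1) ^+ t0 i *: mulb (v (hh1' (inr i)))) ->
  (forall v, d0 (d1 v) = w *: v) ->
  (forall v, peel_f hh0' v = 0 -> peel_f hh1' (d0 v) = 0) ->
  forall v, peel_f hh0' v = 0 ->
    d1 (peel_k hh1 t0 (fun i => hh0' (inl i)) v) +
    peel_k hh0 t1 (fun j => hh1' (inl j)) (d0 v) = v.
Proof.
move=> cK0 cK0' cK1' hd0 hd1 hw hker v hv.
set k0 := peel_k hh1 _ _; set k1 := peel_k hh0 _ _.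
have k0a u j : k0 u (hh1' (inl j)) = 0 by rewrite ffunE cK1'.
have k1a u i : k1 u (hh0' (inl i)) = 0 by rewrite ffunE cK0'.
have k0b u i : k0 u (hh1' (inr i)) = (-1) ^+ t0 i *: div (u (hh0' (inl i))).
  by rewrite ffunE cK1'.
have k1b u j : k1 u (hh0' (inr j)) = (-1) ^+ t1 j *: div (u (hh1' (inl j))).
  by rewrite ffunE cK0'.
have va i : pr (v (hh0' (inl i))) = 0 by have := congr1 (fun g : {ffun _ -> W'} => g i) hv; rewrite !ffunE.
have dva j : pr (d0 v (hh1' (inl j))) = 0.
  by have := congr1 (fun g : {ffun _ -> W'} => g j) (hker _ hv); rewrite !ffunE.
have za i : (d1 (k0 v) + k1 (d0 v)) (hh0' (inl i)) = v (hh0' (inl i)).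
  rewrite ffunE k1a addr0 hd1 big1 ?raddf0 ?add0r; last first.
    by move=> j _; rewrite k0a raddf0 mulr0.
  by rewrite k0b linearZ /= signK divP va raddf0 subr0.
set z := d1 (k0 v) + k1 (d0 v) - v.
have za0 i : z (hh0' (inl i)) = 0.
  by rewrite /z [LHS]ffunE za ffunE subrr.
(* Multiplication by [b] is injective, and plus or minus b z_j is a row of [d0 z]. In that row d0 d1
   (k0 v) = w (k0 v) vanishes, since [k0 v] has no component in the first copy, and [k1] inverts the
   row on [d0 v]. *)
have zb0 j : z (hh0' (inr j)) = 0.
  apply: mulb_inj; rewrite raddf0 -[LHS](signK (t1 j)).
  have -> : (-1) ^+ t1 j *: mulb (z (hh0' (inr j))) = d0 z (hh1' (inl j)).
    rewrite hd0 big1 ?raddf0 ?add0r // => i _.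
    by rewrite za0 raddf0 mulr0.
  rewrite /z raddfB raddfD /= hw !ffunE cK1' /= scaler0 add0r hd0 k1b linearZ /=.
  rewrite signK divP dva raddf0 subr0 big1 ?raddf0 ?add0r ?subrr ?scaler0 //.
  by move=> i _; rewrite k1a raddf0 mulr0.
apply/eqP; rewrite -subr_eq0 -/z; apply/eqP/ffunP => i; rewrite -(cK0 i).
by case: (hh0 i) => j; rewrite [RHS]ffunE; [apply: za0 | apply: zb0].
Qed.

(** An instance of [heq_perturb]: the projection keeps the first copy and reduces it modulo [b], the
    section lifts by [se], and the contraction moves the first copy to the second one through
    division by [b]. *)
Lemma peel : heq (gq Q X) (gq Q' N).
Proof.
pose k0 := peel_k h1 s0 (fun i => a0 i).
pose k1 := peel_k h0 s1 (fun j => a1 j).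
have fd0 d (v : G0 (gq Q X)) : gm_deg d v -> gm_deg d (f0 v : G0 (gq Q' N)).
  by move=> hv i; rewrite ffunE -g0a; apply: pr_deg.
have fd1 d (v : G1 (gq Q X)) : gm_deg d v -> gm_deg d (f1 v : G1 (gq Q' N)).
  by move=> hv i; rewrite ffunE -g1a; apply: pr_deg.
pose f := @GFHom _ _ (gq Q X) (gq Q' N) f0 f1 fd0 fd1 cf0 cf1.
apply: (@heq_perturb _ _ w c _ _ f (peel_s h0) (peel_s h1) k0 k1) => //.
- by move=> d m m' hm hm' i; rewrite !ffunE; apply: qdegB.
- by move=> d m m' hm hm' i; rewrite !ffunE; apply: qdegB.
- by move=> d m hm; apply: gq_act_deg hm; case: hX.
- by move=> d m hm; apply: gq_act_deg hm; case: hX.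
- by move=> d m hm; apply: gq_act_deg hm; case: hN.
- by move=> d m hm; apply: gq_act_deg hm; case: hN.
- move=> d m hm i; rewrite ffunE -(h1K i); case: (h1 i) => j; rewrite h1K'.
    exact: qdeg0.
  rewrite g1b; have -> : d - (g0 j + db - c) = (d + c - g0 j) - db by ring.
  have := div_deg (hm (a0 j)); rewrite g0a.
  by case: (s0 j); rewrite ?scale1r // scaleN1r; apply: qdegN.
- move=> d m hm i; rewrite ffunE -(h0K i); case: (h0 i) => j; rewrite h0K'.
    exact: qdeg0.
  rewrite g0b; have -> : d - (g1 j + db - c) = (d + c - g1 j) - db by ring.
  have := div_deg (hm (a1 j)); rewrite g1a.
  by case: (s1 j); rewrite ?scale1r // scaleN1r; apply: qdegN.
- move=> d m hm i; rewrite ffunE -(h0K i); case: (h0 i) => j; rewrite h0K'.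
    by rewrite g0a; apply: se_deg.
  exact: qdeg0.
- move=> d m hm i; rewrite ffunE -(h1K i); case: (h1 i) => j; rewrite h1K'.
    by rewrite g1a; apply: se_deg.
  exact: qdeg0.
- by move=> m; apply/ffunP => i; rewrite !ffunE h0K' seK.
- by move=> m; apply/ffunP => i; rewrite !ffunE h1K' seK.
- by move=> m; apply/ffunP => i; rewrite !ffunE h1K' raddf0.
- by move=> m; apply/ffunP => i; rewrite !ffunE h0K' raddf0.
- move=> m; apply/ffunP => i; rewrite !ffunE; case: (h1 i) => // j.
  by rewrite ffunE h0K' div_se scaler0.
- move=> m; apply/ffunP => i; rewrite !ffunE; case: (h0 i) => // j.
  by rewrite ffunE h1K' div_se scaler0.
- apply: (contr h0K h0K' h1K' dX0a dX1a w1) => v hv.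
  by rewrite -[LHS]cf0 -[X in gq_act _ X]/(peel_f h0' v) hv raddf0.
- apply: (contr h1K h1K' h0K' dX1a dX0a w0) => v hv.
  by rewrite -[LHS]cf1 -[X in gq_act _ X]/(peel_f h1' v) hv raddf0.
Qed.
End Peeling.

(** * Potentials and degrees of factorizations given by matrices *)

Section FiniteFactorizations.
Variables (V : finType).
Implicit Types (S T : {set V}).

Lemma sum_delta (R : pzRingType) (I : finType) (i : I) (F : I -> R) :
  \sum_j (i == j)%:R * F j = F i.
Proof.
rewrite (bigD1 i) //= eqxx mul1r big1 ?addr0 // => j /negbTE.
by rewrite eq_sym => ->; rewrite mul0r.
Qed.

Section DeltaSums.
Variables (R : comPzRingType) (A B : finType) (F : A * B -> R).

Let sum_pair : \sum_p F p = \sum_x \sum_y F (x, y).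
Proof. by rewrite pair_bigA; apply: eq_bigr => -[]. Qed.

(** The entries of d d in a tensor product have four shapes: both differentials act on the same
    factor (this lemma and [sum_delta_fst]), or one acts on each factor ([sum_delta_cross],
    [sum_delta_cross']), and then the sum collapses to a single product. *)
Lemma sum_delta_snd (b b' : B) (f g : A -> R) :
  (forall x y, F (x, y) = (b == y)%:R * f x * ((y == b')%:R * g x)) ->
  \sum_p F p = (b == b')%:R * \sum_x f x * g x.
Proof.
move=> h; rewrite sum_pair mulr_sumr; apply: eq_bigr => x _.
rewrite (eq_bigr (fun y => (b == y)%:R * (f x * ((y == b')%:R * g x)))).
  by rewrite sum_delta mulrCA.
by move=> y _; rewrite h !mulrA.
Qed.

Lemma sum_delta_fst (a a' : A) (f g : B -> R) :
  (forall x y, F (x, y) = (a == x)%:R * f y * ((x == a')%:R * g y)) ->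
  \sum_p F p = (a == a')%:R * \sum_y f y * g y.
Proof.
move=> h; rewrite sum_pair exchange_big mulr_sumr; apply: eq_bigr => y _.
rewrite (eq_bigr (fun x => (a == x)%:R * (f y * ((x == a')%:R * g y)))).
  by rewrite sum_delta mulrCA.
by move=> x _; rewrite h !mulrA.
Qed.

Lemma sum_delta_cross (a' : A) (b : B) (f : A -> R) (g : B -> R) :
  (forall x y, F (x, y) = (b == y)%:R * f x * ((x == a')%:R * g y)) ->
  \sum_p F p = f a' * g b.
Proof.
move=> h; rewrite sum_pair -[RHS](sum_delta a' (fun x => f x * g b)).
apply: eq_bigr => x _; rewrite -[RHS](sum_delta b (fun y => (a' == x)%:R * (f x * g y))).
by apply: eq_bigr => y _; rewrite h eq_sym; rewrite [x == _]eq_sym; ring.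
Qed.

Lemma sum_delta_cross' (a : A) (b' : B) (f : B -> R) (g : A -> R) :
  (forall x y, F (x, y) = (a == x)%:R * f y * ((y == b')%:R * g x)) ->
  \sum_p F p = f b' * g a.
Proof.
move=> h; rewrite sum_pair -[RHS](sum_delta a (fun x => f b' * g x)).
apply: eq_bigr => x _; rewrite -[RHS](sum_delta b' (fun y => (a == x)%:R * (f y * g x))).
by apply: eq_bigr => y _; rewrite h [y == _]eq_sym; ring.
Qed.
End DeltaSums.

(** Stated over Q[T], because the potential of a single piece of a diagram generally involves glued
    variables and does not lie in Q[S]. *)
Definition mfpot T (M : ffact T) (w : Qs T) : Prop :=
  (forall i i', \sum_j D1 (f := M) i j * D0 j i' = (i == i')%:R * w) /\
  (forall j j', \sum_i D0 (f := M) j i * D1 i j' = (j == j')%:R * w).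

(** The diagonal blocks add the two potentials; in the other blocks the two mixed products cancel
    because of the signs in [tens]. *)
Lemma mfpot_tens T (M N : ffact T) v w :
  mfpot M v -> mfpot N w -> mfpot (tens M N) (v + w).
Proof.
have pairE (A B : finType) (x y : A * B) :
    ((x == y)%:R : Qs T) = (x.1 == y.1)%:R * (x.2 == y.2)%:R.
  by rewrite -natrM mulnb.
move=> [m0 m1] [n0 n1]; split.
- move=> [[a b]|[a b]] [[a' b']|[a' b']]; rewrite big_sumType /=.
  + rewrite (sum_delta_snd (b := b) (b' := b') (f := D1 a) (g := fun x => D0 x a')) //.
    rewrite (sum_delta_fst (a := a) (a' := a') (f := D1 b) (g := fun x => D0 x b')) //.
    by rewrite m0 n0 [inl _ == _]/(_ == _) /= pairE /=; ring.
  + rewrite (sum_delta_cross (b := b) (a' := a') (f := D1 a) (g := fun y => - D1 y b'));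
      last by move=> x y /=; rewrite ?mulNr !mulrN ?mulNr ?opprK.
    rewrite (sum_delta_cross' (a := a) (b' := b') (f := D1 b) (g := fun x => D1 x a')) //.
    by rewrite mul0r; ring.
  + rewrite (sum_delta_cross' (a := a) (b' := b') (f := fun y => - D0 b y) (g := fun y => D0 y a'));
      last by move=> x y /=; rewrite ?mulNr !mulrN ?mulNr ?opprK.
    rewrite (sum_delta_cross (b := b) (a' := a') (f := D0 a) (g := fun x => D0 x b')) //.
    by rewrite mul0r; ring.
  + rewrite (sum_delta_fst (a := a) (a' := a') (f := fun y => - D0 b y) (g := fun y => - D1 y b'));
      last by move=> x y /=; rewrite ?mulNr !mulrN ?mulNr ?opprK.
    rewrite (sum_delta_snd (b := b) (b' := b') (f := D0 a) (g := fun x => D1 x a')) //.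
    rewrite m1 (eq_bigr (fun x => D0 b x * D1 x b')) => [|x _]; last by rewrite mulrNN.
    by rewrite n1 [inr _ == _]/(_ == _) /= pairE /=; ring.
- move=> [[a b]|[a b]] [[a' b']|[a' b']]; rewrite big_sumType /=.
  + rewrite (sum_delta_snd (b := b) (b' := b') (f := D0 a) (g := fun x => D1 x a')) //.
    rewrite (sum_delta_fst (a := a) (a' := a') (f := fun y => - D1 b y) (g := fun x => - D0 x b'));
      last by move=> x y /=; rewrite ?mulNr !mulrN ?mulNr ?opprK.
    rewrite m1 (eq_bigr (fun x => D1 b x * D0 x b')) => [|x _]; last by rewrite mulrNN.
    by rewrite n0 [inl _ == _]/(_ == _) /= pairE /=; ring.
  + rewrite (sum_delta_cross (b := b) (a' := a') (f := D0 a) (g := fun y => D1 y b')) //.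
    rewrite (sum_delta_cross' (a := a) (b' := b') (f := fun y => - D1 b y) (g := fun x => D0 x a'));
      last by move=> x y /=; rewrite ?mulNr !mulrN ?mulNr ?opprK.
    by rewrite mul0r; ring.
  + rewrite (sum_delta_cross' (a := a) (b' := b') (f := D0 b) (g := fun y => D1 y a')) //.
    rewrite (sum_delta_cross (b := b) (a' := a') (f := D1 a) (g := fun x => - D0 x b'));
      last by move=> x y /=; rewrite ?mulNr !mulrN ?mulNr ?opprK.
    by rewrite mul0r; ring.
  + rewrite (sum_delta_fst (a := a) (a' := a') (f := D0 b) (g := fun y => D1 y b')) //.
    rewrite (sum_delta_snd (b := b) (b' := b') (f := D1 a) (g := fun x => D0 x a')) //.
    by rewrite m0 n1 [inr _ == _]/(_ == _) /= pairE /=; ring.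
Qed.

Lemma mfpot_koszul T (a b : Qs T) da db : mfpot (koszul a b da db) (a * b).
Proof.
split=> -[] []; rewrite (bigD1 (tt : unit)) //= big1 ?addr0 ?mul1r //; try by case.
by rewrite mulrC.
Qed.

Lemma mfpot_unit T : mfpot (ff_unit T) 0.
Proof.
split; last by case.
by move=> i j; rewrite mulr0 big1 // => -[].
Qed.

Lemma mfpot_shift T a (M : ffact T) w : mfpot M w -> mfpot (ff_shift a M) w.
Proof. by []. Qed.

Definition kfold T (J : Type) (a b : J -> Qs T) (da db : J -> int) (s : seq J) :
    ffact T :=
  foldr (@tens V T) (ff_unit T) [seq koszul (a j) (b j) (da j) (db j) | j <- s].

Lemma mfpot_kfold T J a b da db (s : seq J) :
  mfpot (@kfold T J a b da db s) (\sum_(j <- s) a j * b j).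
Proof.
elim: s => [|j s IH]; first by rewrite big_nil; apply: mfpot_unit.
by rewrite big_cons; apply: mfpot_tens => //; apply: mfpot_koszul.
Qed.

Lemma ff_map_tens S T (f : {rmorphism Qs S -> Qs T}) (M N : ffact S) :
  ff_map f (tens M N) = tens (ff_map f M) (ff_map f N).
Proof.
rewrite /ff_map /tens /=; f_equal; apply/funext => t; apply/funext => t';
by case: t t' => -[? ?] [[? ?]|[? ?]]; rewrite ?rmorphN rmorphM rmorph_nat.
Qed.

Lemma ff_map_unit S T (f : {rmorphism Qs S -> Qs T}) :
  ff_map f (ff_unit S) = ff_unit T.
Proof.
by rewrite /ff_map /ff_unit /=; f_equal; apply/funext => t; apply/funext => t';
  rewrite rmorph0.
Qed.

Lemma ff_map_kfold S T (f : {rmorphism Qs S -> Qs T}) J a b da db (s : seq J) :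
  ff_map f (@kfold S J a b da db s) = kfold (f \o a) (f \o b) da db s.
Proof.
elim: s => [|j s IH]; first exact: ff_map_unit.
by rewrite /kfold /= ff_map_tens; congr tens; apply: IH.
Qed.

Lemma ff_map_id T (f : Qs T -> Qs T) (M : ffact T) : f =1 id -> ff_map f M = M.
Proof. by move=> /funext ->; case: M. Qed.

Section Degrees.
Variable wt : V -> nat.

Lemma fhomog_tens T c (M N : ffact T) :
  fhomog wt c M -> fhomog wt c N -> fhomog wt c (tens M N).
Proof.
have E d d' (p : Qs T) : d' = d -> whomog wt d p -> whomog wt d' p by move=> ->.
move=> [m0 m1] [n0 n1]; split=> -[[x y]|[x y]] [[x' y']|[x' y']] /=;
  try apply: whomogN; apply: whomog_delta => ?; subst;
  first [apply: E (m0 _ _) | apply: E (m1 _ _) | apply: E (n0 _ _) | apply: E (n1 _ _)];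
  ring.
Qed.

Lemma fhomog_koszul T c (a b : Qs T) da db : da + db = c + c ->
  whomog wt da a -> whomog wt db b -> fhomog wt c (koszul a b da db).
Proof.
move=> h ha hb; have E : ((db - da) %/ 2)%Z = c - da.
  have -> : db - da = (c - da) * 2 by lia.
  by rewrite mulzK.
split=> -[] [] /=; rewrite E.
- by have -> : c + 0 - (c - da) = da by ring.
- by have -> : c + (c - da) - 0 = db by lia.
Qed.

Lemma fhomog_unit T c : fhomog wt c (ff_unit T).
Proof. by split=> -[]. Qed.

Lemma fhomog_shift T c a (M : ffact T) :
  fhomog wt c M -> fhomog wt c (ff_shift a M).
Proof.
have E d d' (p : Qs T) : d' = d -> whomog wt d p -> whomog wt d' p by move=> ->.
by move=> [h0 h1]; split=> i j /=; [apply: E (h0 _ _) | apply: E (h1 _ _)]; ring.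
Qed.

Lemma fhomog_kfold T c J a b da db (s : seq J) :
  (forall j, da j + db j = c + c) ->
  (forall j, whomog wt (da j) (a j)) -> (forall j, whomog wt (db j) (b j)) ->
  fhomog wt c (@kfold T J a b da db s).
Proof.
move=> h ha hb; elim: s => [|j s IH]; first exact: fhomog_unit.
by apply: fhomog_tens => //; apply: fhomog_koszul.
Qed.

Lemma gq_act_comp S T (Q : qdat wt S T) (I J K : finType)
    (D : J -> I -> Qs T) (D' : K -> J -> Qs T) v :
  gq_act D' (gq_act (Q := Q) D v) = gq_act (fun k i => \sum_j D' k j * D j i) v.
Proof.
apply/ffunP => k; rewrite !ffunE.
transitivity (qphi Q (\sum_j D' k j * (\sum_i D j i * qtau Q (v i)))).
  by rewrite !raddf_sum; apply: eq_bigr => j _; rewrite ffunE qphiM.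
congr (qphi Q _); under eq_bigr do rewrite mulr_sumr.
rewrite exchange_big; apply: eq_bigr => i _; rewrite mulr_suml.
by apply: eq_bigr => j _; rewrite mulrA.
Qed.

(** It is enough that the potential of [N] agrees with an element of Q[S] modulo the ideal of [Q].
    Once some Koszul factors have been removed, the potential of the rest comes from Q[S] only in
    the quotient. *)
Lemma gq_pot S T (Q : qdat wt S T) (N : ffact T) v (w : Qs S) :
  mfpot N v -> qphi Q v = qphi Q (emb T w) ->
  (forall m, dif1 (gq Q N) (dif0 (gq Q N) m) = w *: m) /\
  (forall m, dif0 (gq Q N) (dif1 (gq Q N) m) = w *: m).
Proof.
move=> [n0 n1] hv.
have H (I : finType) (D : I -> I -> Qs T) (m : {ffun I -> qW Q}) :
    (forall i i', D i i' = (i == i')%:R * v) -> gq_act D m = w *: m.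
  move=> hD; apply/ffunP => i; rewrite !ffunE.
  under eq_bigr do rewrite hD -mulrA.
  rewrite sum_delta mulrC -qphiM hv qphiM mulrC qphiZ.
  by rewrite qtauK.
by split=> m /=; rewrite gq_act_comp; apply: H => i i'; rewrite ?n0 ?n1.
Qed.
End Degrees.
End FiniteFactorizations.

(** * Steps of a chain of quotients *)

Section Steps.
Variables (V : finType) (wt : V -> nat) (S T : {set V}).
Implicit Types Q : qdat wt S T.

(* The ideal of Q' is the one of Q plus (b), and b is a nonzerodivisor modulo
   the ideal of Q. *)
Record qstep Q Q' (b : Qs T) (db : int) : Prop := QStep {
  qstep_deg : whomog wt db b;
  qstep_le : forall p, qphi Q p = 0 -> qphi Q' p = 0;
  qstep_gen : qphi Q' b = 0;
  qstep_ker : forall p, qphi Q' p = 0 -> exists t, qphi Q p = qphi Q (b * t);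
  qstep_ker_deg : forall d p, whomog wt d p -> qphi Q' p = 0 ->
    exists2 t, whomog wt (d - db) t & qphi Q p = qphi Q (b * t);
  qstep_nzd : forall t, qphi Q (b * t) = 0 -> qphi Q t = 0 }.

Lemma qstep_mul0 Q Q' b db t : qstep Q Q' b db -> qphi Q' (t * b) = 0.
Proof. by move=> st; rewrite -qphiM (qstep_gen st) raddf0 mulr0 raddf0. Qed.

Lemma qstep_eq Q Q' b db p q : qstep Q Q' b db ->
  qphi Q p = qphi Q q -> qphi Q' p = qphi Q' q.
Proof.
move=> st /eqP; rewrite -subr_eq0 -raddfB => /eqP/(qstep_le st).
by rewrite raddfB => /eqP; rewrite subr_eq0 => /eqP.
Qed.

Section Reindex.
Variables (Q : qdat wt S T) (I J : finType) (e : J -> I).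
Definition gq_re (v : {ffun I -> qW Q}) : {ffun J -> qW Q} := [ffun j => v (e j)].
Fact gq_re_linear : linear gq_re.
Proof. by move=> a u v; apply/ffunP => j; rewrite !ffunE. Qed.
HB.instance Definition _ := GRing.isLinear.Build (Qs S)
  {ffun I -> qW Q} {ffun J -> qW Q} _ gq_re gq_re_linear.
End Reindex.

Lemma heq_reindex Q (M N : ffact T) (e0 : I0 M -> I0 N) (e0' : I0 N -> I0 M)
    (e1 : I1 M -> I1 N) (e1' : I1 N -> I1 M) :
  cancel e0 e0' -> cancel e0' e0 -> cancel e1 e1' -> cancel e1' e1 ->
  (forall i, g0 (e0 i) = g0 i) -> (forall i, g1 (e1 i) = g1 i) ->
  (forall j i, D0 (e1 j) (e0 i) = D0 j i) ->
  (forall i j, D1 (e0 i) (e1 j) = D1 i j) ->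
  heq (gq Q M) (gq Q N).
Proof.
move=> c0 c0' c1 c1' hg0 hg1 hD0 hD1.
apply: (@heq_iso _ _ (gq Q M) (gq Q N) (gq_re e0') (gq_re e1')
  (gq_re e0) (gq_re e1)).
- by move=> v; apply/ffunP => i; rewrite !ffunE c0.
- by move=> v; apply/ffunP => i; rewrite !ffunE c0'.
- by move=> v; apply/ffunP => i; rewrite !ffunE c1.
- by move=> v; apply/ffunP => i; rewrite !ffunE c1'.
- by move=> d m hm i; rewrite ffunE -(c0' i) c0 hg0.
- by move=> d m hm i; rewrite ffunE -(c1' i) c1 hg1.
- by move=> d m hm i; rewrite ffunE -hg0.
- by move=> d m hm i; rewrite ffunE -hg1.
- move=> m; apply/ffunP => j; rewrite !ffunE (reindex e0) /=; last first.
    by exists e0' => i _.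
  congr (qphi Q _); apply: eq_bigr => i _.
  by rewrite ffunE c0 -[in LHS](c1' j) hD0.
- move=> m; apply/ffunP => j; rewrite !ffunE (reindex e1) /=; last first.
    by exists e1' => i _.
  congr (qphi Q _); apply: eq_bigr => i _.
  by rewrite ffunE c1 -[in LHS](c0' j) hD1.
Qed.

Lemma heq_tens_unit Q (M : ffact T) :
  heq (gq Q (tens M (ff_unit T))) (gq Q M).
Proof.
pose e0 (t : I0 (tens M (ff_unit T))) : I0 M :=
  match t with inl p => p.1 | inr p => match p.2 with end end.
pose e0' (i : I0 M) : I0 (tens M (ff_unit T)) := inl (i, tt).
pose e1 (t : I1 (tens M (ff_unit T))) : I1 M :=
  match t with inl p => p.1 | inr p => match p.2 with end end.
pose e1' (i : I1 M) : I1 (tens M (ff_unit T)) := inl (i, tt).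
apply: (@heq_reindex _ _ _ e0 e0' e1 e1') => //.
- by move=> [[i []]|[i []]].
- by move=> [[i []]|[i []]].
- by move=> [[i []]|[i []]] /=; rewrite addr0.
- by move=> [[i []]|[i []]] /=; rewrite addr0.
- by move=> [[i []]|[i []]] [[j []]|[j []]] /=; rewrite mul1r.
- by move=> [[i []]|[i []]] [[j []]|[j []]] /=; rewrite mul1r.
Qed.

Lemma koszul_shift (da db c : int) : da + db = c + c ->
  ((db - da) %/ 2)%Z = db - c.
Proof.
move=> h; have -> : db - da = (db - c) * 2 by lia.
by rewrite mulzK.
Qed.

Let ilE (A B : finType) (x y : A) : (inl x == inl y :> A + B) = (x == y).
Proof. by []. Qed.
Let irE (A B : finType) (x y : B) : (inr x == inr y :> A + B) = (x == y).
Proof. by []. Qed.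
Let pE (A B : finType) (x y : A * B) :
  ((x == y)%:R : Qs T) = (x.1 == y.1)%:R * (x.2 == y.2)%:R.
Proof. by rewrite -natrM mulnb. Qed.

Lemma peel_tens Q Q' (a b : Qs T) da db c w (C L : ffact T) :
  qstep Q Q' b db -> da + db = c + c -> whomog wt da a ->
  fhomog wt c C -> fhomog wt c L ->
  (forall m, dif1 (gq Q (tens C (tens (koszul a b da db) L))) (dif0 (gq Q _) m)
     = w *: m) ->
  (forall m, dif0 (gq Q (tens C (tens (koszul a b da db) L))) (dif1 (gq Q _) m)
     = w *: m) ->
  heq (gq Q (tens C (tens (koszul a b da db) L))) (gq Q' (tens C L)).
Proof.
set K := koszul a b da db; set X := tens C _; set N := tens C L.
move=> [hb h1 h2 h3 h4 h5] hd ha hC hL w0 w1.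
have sK := koszul_shift hd.
(* A basis element belongs to the first copy when its Koszul component is even, since [b] maps the
   odd generator to the even one. *)
pose f0 (t : I0 X) : I0 N + I1 N := match t with
  | inl (x, inl (_, y)) => inl (inl (x, y))
  | inl (x, inr (_, y)) => inr (inr (x, y))
  | inr (x, inl (_, y)) => inr (inl (x, y))
  | inr (x, inr (_, y)) => inl (inr (x, y)) end.
pose f0' (t : I0 N + I1 N) : I0 X := match t with
  | inl (inl (x, y)) => inl (x, inl (tt, y))
  | inr (inr (x, y)) => inl (x, inr (tt, y))
  | inr (inl (x, y)) => inr (x, inl (tt, y))
  | inl (inr (x, y)) => inr (x, inr (tt, y)) end.
pose f1 (t : I1 X) : I1 N + I0 N := match t with
  | inl (x, inl (_, y)) => inl (inl (x, y))
  | inl (x, inr (_, y)) => inr (inr (x, y))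
  | inr (x, inl (_, y)) => inr (inl (x, y))
  | inr (x, inr (_, y)) => inl (inr (x, y)) end.
pose f1' (t : I1 N + I0 N) : I1 X := match t with
  | inl (inl (x, y)) => inl (x, inl (tt, y))
  | inr (inr (x, y)) => inl (x, inr (tt, y))
  | inr (inl (x, y)) => inr (x, inl (tt, y))
  | inl (inr (x, y)) => inr (x, inr (tt, y)) end.
(* The sign of moving the Koszul differential past [C]: it is negative on the odd part of [C]. *)
pose s0 (t : I0 N) := match t with inl _ => false | inr _ => true end.
pose s1 (t : I1 N) := match t with inl _ => true | inr _ => false end.
apply: (@peel _ _ _ _ _ _ b db h1 h2 h3 h4 h5 X N c f0 f0' f1 f1' _ _ _ _
  s0 s1 _ _ _ _ _ _ _ _ _ _ w w0 w1).
- by move=> [[x [[[] y]|[[] y]]]|[x [[[] y]|[[] y]]]].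
- by move=> [[[x y]|[x y]]|[[x y]|[x y]]].
- by move=> [[x [[[] y]|[[] y]]]|[x [[[] y]|[[] y]]]].
- by move=> [[[x y]|[x y]]|[[x y]|[x y]]].
- by move=> [[x y]|[x y]] [[x' y']|[x' y']]; rewrite /= ?mul1r.
- move=> [[x y]|[x y]] [[x' y']|[x' y']] /=.
  1-4: by rewrite ?ilE ?irE ?pE /=; ring.
- by move=> [[x y]|[x y]] [[x' y']|[x' y']]; rewrite /= ?mul1r.
- move=> [[x y]|[x y]] [[x' y']|[x' y']] /=.
  1-4: by rewrite ?ilE ?irE ?pE /=; ring.
- by move=> [[x y]|[x y]] /=; rewrite ?sK; ring.
- by move=> [[x y]|[x y]] /=; rewrite ?sK; ring.
- by move=> [[x y]|[x y]] /=; rewrite ?sK; ring.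
- by move=> [[x y]|[x y]] /=; rewrite ?sK; ring.
- by apply: fhomog_tens => //; apply: fhomog_tens => //; apply: fhomog_koszul.
- exact: fhomog_tens.
Qed.

Definition ff_flip (M : ffact T) : ffact T :=
  @FFact V T (I1 M) (I0 M) (@g1 V T M) (@g0 V T M)
    (fun i j => - D1 i j) (fun j i => - D0 j i).

Lemma fhomog_flip c (M : ffact T) : fhomog wt c M -> fhomog wt c (ff_flip M).
Proof. by move=> [h0 h1]; split=> i j; apply: whomogN; [apply: h1 | apply: h0]. Qed.

Lemma heq_gq_flip Q a (M : ffact T) :
  heq (gq Q (ff_shift a (ff_flip M))) (gf_flip (gf_shift a (gq Q M))).
Proof.
have hd d (I : finType) (g : I -> int) (v : {ffun I -> qW Q}) :
    (forall i, qdeg (d - (g i + a)) (v i)) <-> (forall i, qdeg (d - a - g i) (v i)).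
  by split=> h i; have := h i; rewrite opprD addrA addrAC.
have hD (I J : finType) (D : J -> I -> Qs T) (v : {ffun I -> qW Q}) :
    gq_act (fun j i => - D j i) v = - gq_act D v.
  apply/ffunP => j; rewrite !ffunE -raddfN -sumrN; congr (qphi Q _).
  by apply: eq_bigr => i _; rewrite mulNr.
apply: (@heq_iso _ _ (gq Q (ff_shift a (ff_flip M)))
  (gf_flip (gf_shift a (gq Q M))) idfun idfun idfun idfun) => //.
- by move=> d m /hd.
- by move=> d m /hd.
- by move=> d m hm; apply/hd.
- by move=> d m hm; apply/hd.
- by move=> m; rewrite /= hD.
- by move=> m; rewrite /= hD.
Qed.

Lemma heq_gq_shift Q a (M : ffact T) :
  heq (gq Q (ff_shift a M)) (gf_shift a (gq Q M)).
Proof.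
have hd d (I : finType) (g : I -> int) (v : {ffun I -> qW Q}) :
    (forall i, qdeg (d - (g i + a)) (v i)) <-> (forall i, qdeg (d - a - g i) (v i)).
  by split=> h i; have := h i; rewrite opprD addrA addrAC.
by apply: (@heq_iso _ _ (gq Q (ff_shift a M)) (gf_shift a (gq Q M))
  idfun idfun idfun idfun) => // d m /hd.
Qed.

(* When the first entry a is the regular one, the cokernel sits in the odd
   component of the Koszul factor, hence the flip. *)
Lemma peel_koszul Q Q' (a b : Qs T) da db c w (L : ffact T) :
  qstep Q Q' a da -> da + db = c + c -> whomog wt db b -> fhomog wt c L ->
  (forall m, dif1 (gq Q (tens (koszul a b da db) L)) (dif0 (gq Q _) m) = w *: m) ->
  (forall m, dif0 (gq Q (tens (koszul a b da db) L)) (dif1 (gq Q _) m) = w *: m) ->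
  heq (gq Q (tens (koszul a b da db) L))
      (gf_flip (gf_shift ((db - da) %/ 2)%Z (gq Q' L))).
Proof.
set s := ((db - da) %/ 2)%Z.
set K := koszul a b da db; set X := tens K L.
move=> [ha h1 h2 h3 h4 h5] hd hb hL w0 w1.
have sK := koszul_shift hd.
apply: heq_trans (heq_gq_flip _ _ _).
(* What remains is the odd generator times [L]. That generator carries the shift [s], and passing it
   reverses the sign of the differentials of [L], as [ff_flip] does. *)
set N := ff_shift s (ff_flip L).
pose f0 (t : I0 X) : I0 N + I1 N := match t with
  | inl (_, y) => inr y | inr (_, y) => inl y end.
pose f0' (t : I0 N + I1 N) : I0 X := match t with
  | inr y => inl (tt, y) | inl y => inr (tt, y) end.
pose f1 (t : I1 X) : I1 N + I0 N := match t with
  | inl (_, y) => inl y | inr (_, y) => inr y end.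
pose f1' (t : I1 N + I0 N) : I1 X := match t with
  | inl y => inl (tt, y) | inr y => inr (tt, y) end.
apply: (@peel _ _ _ _ _ _ a da h1 h2 h3 h4 h5 X N c f0 f0' f1 f1' _ _ _ _
  (fun=> false) (fun=> false) _ _ _ _ _ _ _ _ _ _ w w0 w1).
- by move=> [[[] y]|[[] y]].
- by move=> [y|y].
- by move=> [[[] y]|[[] y]].
- by move=> [y|y].
- by move=> j i; rewrite /= mul1r.
- by move=> j i; rewrite /= mul1r.
- by move=> j i; rewrite /= mul1r.
- by move=> j i; rewrite /= mul1r.
- by move=> i; rewrite /= /s; ring.
- by move=> j; rewrite /= /s sK; lia.
- by move=> i; rewrite /= /s; ring.
- by move=> j; rewrite /= /s sK; lia.
- by apply: fhomog_tens => //; apply: fhomog_koszul.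
- by apply: fhomog_shift; apply: fhomog_flip.
Qed.
End Steps.

(** * Homogeneous components *)

Section Components.
Variables (V : finType) (wt : V -> nat).
Local Notation mon := 'X_{1..#|V|}.
Implicit Types (S T : {set V}).

Definition wcomp (d : int) (p : amb V) : amb V :=
  \sum_(m <- msupp p | (mnmwt wt m)%:Z == d) p@_m *: 'X_[m].

Lemma mcoeff_wcomp d p m :
  (wcomp d p)@_m = if (mnmwt wt m)%:Z == d then p@_m else 0.
Proof.
rewrite /wcomp raddf_sum /= big_mkcond.
have [hm|hm] := boolP (m \in msupp p); last first.
  rewrite memN_msupp_eq0 // if_same big_seq big1 // => m' hm'.
  case: ifP => // _; rewrite mcoeffZ mcoeffX; case: eqP => [E|]; last by rewrite mulr0.
  by rewrite -E hm' in hm.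
rewrite (bigD1_seq m) ?msupp_uniq //= big1 ?addr0 => [|m' hm'].
  by case: ifP => // _; rewrite mcoeffZ mcoeffX eqxx mulr1.
by case: ifP => // _; rewrite mcoeffZ mcoeffX (negbTE hm') mulr0.
Qed.

Lemma supportedP S (p : amb V) :
  reflect (forall m : mon, p@_m != 0 ->
    forall k, m k != 0%N -> enum_val k \in S) (supported S p).
Proof.
apply: (iffP allP) => h m.
  by rewrite -mcoeff_msupp => /h/forallP hm k hk; exact: implyP (hm k) hk.
by rewrite mcoeff_msupp => /h hm; apply/forallP => k; apply/implyP/hm.
Qed.

Lemma supported_wcomp S d (p : amb V) : supported S p -> supported S (wcomp d p).
Proof.
move=> /supportedP h; apply/supportedP => m; rewrite mcoeff_wcomp.
by case: ifP => _; [exact: h | rewrite eqxx].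
Qed.

Definition qcomp T d (p : Qs T) : Qs T := QS (supported_wcomp d (valP p)).

Lemma Qs_eqP T (p q : Qs T) : (forall m, (qval p)@_m = (qval q)@_m) -> p = q.
Proof. by move=> h; apply/val_inj/mpolyP. Qed.

Lemma qval_sum T I (r : seq I) (P : pred I) (F : I -> Qs T) :
  qval (\sum_(i <- r | P i) F i) = \sum_(i <- r | P i) qval (F i).
Proof. exact: (big_morph (@qval _ T)). Qed.

Lemma qcompB T d (p q : Qs T) : qcomp d (p - q) = qcomp d p - qcomp d q.
Proof.
apply: Qs_eqP => m; rewrite /= mcoeffB !mcoeff_wcomp mcoeffB.
by case: ifP => //; rewrite subrr.
Qed.
HB.instance Definition _ T d :=
  GRing.isZmodMorphism.Build (Qs T) (Qs T) (@qcomp T d) (@qcompB T d).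

Lemma whomog_qcomp T d (p : Qs T) : whomog wt d (qcomp d p).
Proof.
by apply/whomogP => m; rewrite /= mcoeff_wcomp; case: ifP => [/eqP //|_]; rewrite eqxx.
Qed.

Lemma qcomp_id T d (p : Qs T) : whomog wt d p -> qcomp d p = p.
Proof.
move=> /whomogP h; apply: Qs_eqP => m; rewrite /= mcoeff_wcomp.
by case: eqP => // E; apply/esym/eqP; apply: contraT => /h.
Qed.

Lemma qcomp_eq0 T d (p : Qs T) :
  (forall m, (qval p)@_m != 0 -> (mnmwt wt m)%:Z <> d) -> qcomp d p = 0.
Proof.
move=> h; apply: Qs_eqP => m; rewrite /= mcoeff_wcomp mcoeff0.
by case: eqP => // E; apply/eqP; apply: contraT => /h.
Qed.

Lemma qcompM T d db (b t : Qs T) : whomog wt db b ->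
  qcomp d (b * t) = b * qcomp (d - db) t.
Proof.
move=> hb; have -> : b * t = b * qcomp (d - db) t + b * (t - qcomp (d - db) t).
  by rewrite -mulrDr addrC subrK.
rewrite raddfD /= [qcomp d (b * qcomp _ _)]qcomp_id; last first.
  by have := whomogM hb (whomog_qcomp (d - db) t); rewrite addrC subrK.
rewrite [X in _ + X]qcomp_eq0 ?addr0 // => m.
rewrite -mcoeff_msupp => /msuppM_le/allpairsP[[m1 m2] /= [h1 h2 ->]] E.
move/whomogP: hb => /(_ m1); rewrite -mcoeff_msupp => /(_ h1) e1.
move: h2; rewrite mcoeff_msupp mcoeffB mcoeff_wcomp.
have -> : (mnmwt wt m2)%:Z == d - db.
  by apply/eqP; move: E e1; rewrite mnmwtD; lia.
by rewrite subrr eqxx.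
Qed.

Lemma qcomp_homog T d e (p : Qs T) : whomog wt e p ->
  qcomp d p = if e == d then p else 0.
Proof.
move=> hp; case: eqP => [E|hne]; first by rewrite qcomp_id -?E.
by apply: qcomp_eq0 => m; move/whomogP: hp => h /h ->.
Qed.

Lemma qcomp_sum T (p : Qs T) :
  p = \sum_(e <- undup [seq (mnmwt wt m)%:Z | m <- msupp (qval p)]) qcomp e p.
Proof.
set r := undup _; apply: Qs_eqP => m; rewrite qval_sum raddf_sum /=; under eq_bigr do rewrite mcoeff_wcomp.
have [hm|hm] := boolP (m \in msupp (qval p)); last first.
  by rewrite memN_msupp_eq0 // big1 // => e _; rewrite if_same.
rewrite (bigD1_seq (mnmwt wt m)%:Z) ?undup_uniq //=; last first.
  by rewrite mem_undup; apply/mapP; exists m.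
by rewrite eqxx big1 ?addr0 // => e /negbTE; rewrite eq_sym => ->.
Qed.

Lemma qcomp_additive S T d (L : {additive Qs S -> Qs T}) p :
  (forall e q, whomog wt e q -> whomog wt e (L q)) ->
  qcomp d (L p) = L (qcomp d p).
Proof.
move=> hL; rewrite [in LHS](qcomp_sum p) [in RHS](qcomp_sum p) !raddf_sum.
apply: eq_bigr => e _ /=.
have he := whomog_qcomp e p.
rewrite (qcomp_homog d (hL _ _ he)) (qcomp_homog d he); case: eqP => // _.
by rewrite raddf0.
Qed.

(** Given any cofactor [t], its component of degree [d - db] does as well: [b] is homogeneous and
    the kernel is stable under taking components. *)
Lemma ker_deg S T (Q : qdat wt S T) (phi' : Qs T -> Prop) b db :
  whomog wt db b ->
  (forall d p, qphi Q p = 0 -> qphi Q (qcomp d p) = 0) ->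
  (forall p, phi' p -> exists t, qphi Q p = qphi Q (b * t)) ->
  forall d p, whomog wt d p -> phi' p ->
    exists2 t, whomog wt (d - db) t & qphi Q p = qphi Q (b * t).
Proof.
move=> hb hc hk d p hp /hk[t E]; exists (qcomp (d - db) t).
  exact: whomog_qcomp.
apply/eqP; rewrite -subr_eq0 -raddfB -(qcompM _ _ hb) -{1}(qcomp_id hp) -raddfB.
by apply/eqP/hc; rewrite raddfB /= E subrr.
Qed.
End Components.

(** * Renaming of variables *)

Section Renaming.
Variables (V : finType).
Implicit Types (S T U : {set V}) (s : V -> V).

Lemma rmorph_eq_supported (R : pzRingType) (f g : {rmorphism amb V -> R}) S p :
  (forall c, f c%:MP = g c%:MP) ->
  (forall v, v \in S -> f 'X_(enum_rank v) = g 'X_(enum_rank v)) ->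
  supported S p -> f p = g p.
Proof.
move=> hC hX /supportedP hp; rewrite [p]mpolyE !rmorph_sum /= big_seq [RHS]big_seq.
apply: eq_bigr => m; rewrite mcoeff_msupp => /hp hm.
rewrite -mul_mpolyC !rmorphM hC; congr (_ * _).
rewrite mpolyXE_id !rmorph_prod; apply: eq_bigr => k _; rewrite !rmorphXn.
have [->|/hm hk] := eqVneq (m k) 0%N; first by rewrite !expr0.
by rewrite -[k]enum_valK hX.
Qed.

Lemma substC s T c : subst s T c%:MP = c%:MP.
Proof. by rewrite /subst mmapC. Qed.

Lemma substX s T v : subst s T 'X_(enum_rank v) =
  if s v \in T then 'X_(enum_rank (s v)) else 0.
Proof. by rewrite /subst mmapX mmap1U enum_rankK. Qed.

Lemma eq_subst s s' S T T' p :
  (forall v, v \in S -> s v = s' v) ->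
  (forall v, v \in S -> (s v \in T) = (s v \in T')) ->
  supported S p -> subst s T p = subst s' T' p.
Proof.
move=> h hT; apply: (@rmorph_eq_supported _ (subst s T) (subst s' T')) => [c|v hv].
  by rewrite /= !substC.
by rewrite /= !substX -h // hT.
Qed.

Lemma subst_comp s s' S T U p :
  (forall v, v \in S -> s v \in T) -> supported S p ->
  subst s' U (subst s T p) = subst (s' \o s) U p.
Proof.
move=> h; apply: (@rmorph_eq_supported _ (subst s' U \o subst s T) (subst (s' \o s) U)) => [c|v hv] /=.
  by rewrite !substC.
by rewrite !substX h // substX.
Qed.

Lemma psubst_comp s s' S T U (p : Qs S) :
  (forall v, v \in S -> s v \in T) ->
  psubst s' U (psubst s T p) = psubst (s' \o s) U p.
Proof. by move=> h; apply: val_inj => /=; apply: (subst_comp _ _ h (valP p)). Qed.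

Lemma eq_psubst s s' S T (p : Qs S) :
  (forall v, v \in S -> s v = s' v) -> psubst s T p = psubst s' T p.
Proof. by move=> h; apply: val_inj => /=; apply: (eq_subst h _ (valP p)). Qed.

Lemma psubst_id S (p : Qs S) : emb S p = p.
Proof. by apply: val_inj; apply: subst_id; apply: valP. Qed.

Lemma supportedW S T p : S \subset T -> supported S p -> supported T p.
Proof.
move=> hST /supportedP h; apply/supportedP => m hm k hk.
exact: (subsetP hST) (h m hm k hk).
Qed.

Lemma supportedX S v : v \in S -> supported S 'X_(enum_rank v).
Proof.
move=> hv; apply/supportedP => m; rewrite mcoeffX.
case: (U_(enum_rank v)%MM =P m) => [<- _ k|_]; last by rewrite eqxx.
by rewrite mnm1E; case: (enum_rank v =P k) => // <- _; rewrite enum_rankK.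
Qed.

Lemma supportedC S c : supported S c%:MP.
Proof.
apply/supportedP => m; rewrite mcoeffC; have [-> _ k|_] := eqVneq m 0%MM.
  by rewrite mnm0E.
by rewrite mulr0 eqxx.
Qed.

Variable wt : V -> nat.

Lemma whomog_psubst s S T d (p : Qs S) :
  (forall v, v \in S -> wt (s v) = wt v) ->
  whomog wt d p -> whomog wt d (psubst s T p).
Proof.
move=> hs /whomogP hp.
have /supportedP hS := valP p.
rewrite -[whomog _ _ _]/(ahomog wt d (subst s T (qval p))) /subst /mmap.
rewrite big_seq; apply: ahomog_sum => m; rewrite mcoeff_msupp => hm.
rewrite mul_mpolyC; apply: ahomogZ; rewrite -(hp _ hm) /mnmwt.
have -> : (\sum_v m (enum_rank v) * wt v)%N%:Z = \sum_k (wt (enum_val k))%:Z *+ m k.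
  rewrite (big_morph Posz PoszD (erefl _)) [RHS](reindex (@enum_rank V)) /=; last first.
    by exists (@enum_val V predT) => k _; rewrite ?enum_valK ?enum_rankK.
  by apply: eq_bigr => v _; rewrite enum_rankK -mulr_natr natz mulnC PoszM.
apply: ahomog_prod => k _; have [->|/(hS _ hm) hk] := eqVneq (m k) 0%N.
  exact: ahomogC.
apply: ahomogXn; case: ifP => _; last exact: ahomog0.
by rewrite -hs //; apply: ahomogX.
Qed.
End Renaming.

(** * Quotients that identify variables *)

Section RenamingQuotients.
Variables (V : finType) (wt : V -> nat) (S T : {set V}).
Implicit Types (U : {set V}) (s : V -> V).

(* Q[U] as a module over Q[S], for S \subset U. *)
Definition rmod U := Qs U.
HB.instance Definition _ U := GRing.Zmodule.copy (rmod U) (Qs U).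
Section Rmod.
Variable U : {set V}.
Definition rmod_scale (r : Qs S) (p : rmod U) : rmod U := emb U r * (p : Qs U).
Fact rmod_scaleA a b p : rmod_scale a (rmod_scale b p) = rmod_scale (a * b) p.
Proof. by rewrite /rmod_scale rmorphM mulrA. Qed.
Fact rmod_scale1 : left_id 1 rmod_scale.
Proof. by move=> p; rewrite /rmod_scale rmorph1 mul1r. Qed.
Fact rmod_scaleDr : right_distributive rmod_scale +%R.
Proof. by move=> a p q; rewrite /rmod_scale mulrDr. Qed.
Fact rmod_scaleDl p : {morph rmod_scale^~ p : a b / a + b}.
Proof. by move=> a b; rewrite /rmod_scale rmorphD mulrDl. Qed.
HB.instance Definition _ := GRing.Zmodule_isLmodule.Build (Qs S) (rmod U)
  rmod_scaleA rmod_scale1 rmod_scaleDr rmod_scaleDl.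
End Rmod.

(** [s] retracts the variables of [T] onto those of [U]. The quotient of Q[T] by all v - s(v) is
    then Q[U] itself, with the inclusion as section. *)
Definition renaming_on s U : Prop :=
  [/\ S \subset U, U \subset T, forall v, v \in U -> s v = v,
      forall v, v \in T -> s v \in U & forall v, v \in T -> wt (s v) = wt v].

Variables (s : V -> V) (U : {set V}) (hs : renaming_on s U).

Definition ren_phi : Qs T -> rmod U := psubst s U.
HB.instance Definition _ := GRing.isZmodMorphism.Build (Qs T) (rmod U) ren_phi
  (@psubst_zmod V s T U).
Definition ren_tau : rmod U -> Qs T := emb T.
HB.instance Definition _ := GRing.isZmodMorphism.Build (rmod U) (Qs T) ren_tau
  (@psubst_zmod V id U T).

Fact ren_phiZ r a : ren_phi (emb T r * a) = r *: ren_phi a.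
Proof.
case: hs => hSU hUT hid _ _; rewrite /ren_phi rmorphM /=; congr (_ * _).
rewrite psubst_comp => [|v hv]; last exact/(subsetP hUT)/(subsetP hSU).
by apply: eq_psubst => v hv /=; rewrite hid // (subsetP hSU).
Qed.
Fact ren_tauZ r (w : rmod U) : ren_tau (r *: w) = emb T r * ren_tau w.
Proof.
case: hs => hSU hUT hid _ _; rewrite /ren_tau rmorphM /=; congr (_ * _).
by rewrite psubst_comp => // v; apply: (subsetP hSU).
Qed.
Fact ren_tauK : cancel ren_tau ren_phi.
Proof.
case: hs => hSU hUT hid _ _ w; rewrite /ren_tau /ren_phi psubst_comp => [|v hv].
  by rewrite (@eq_psubst _ _ id) ?psubst_id // => v hv; apply: hid.
exact: (subsetP hUT).
Qed.
Fact ren_phiM a b : ren_phi (a * ren_tau (ren_phi b)) = ren_phi (a * b).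
Proof. by rewrite /ren_phi !rmorphM /=; congr (_ * _); apply: ren_tauK. Qed.
Fact ren_phi_deg d a : whomog wt d a -> whomog wt d (ren_phi a : Qs U).
Proof. by case: hs => _ _ _ _ hw; apply: whomog_psubst. Qed.
Fact ren_tau_deg d (w : rmod U) : whomog wt d (w : Qs U) -> whomog wt d (ren_tau w).
Proof. by apply: whomog_psubst. Qed.

Definition qren : qdat wt S T := @QDat _ wt S T (rmod U)
  (fun d (p : rmod U) => whomog wt d (p : Qs U)) ren_phi ren_tau ren_phiZ
  ren_tauZ ren_tauK ren_phiM ren_phi_deg ren_tau_deg.

Lemma qcomp_psubst d (p : Qs T) : psubst s U (qcomp wt d p) = qcomp wt d (psubst s U p).
Proof.
rewrite qcomp_additive // => e q.
by case: hs => _ _ _ _ hw; apply: whomog_psubst.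
Qed.

Section ToRestr.
Variable I : finType.
Definition to_restr (v : {ffun I -> qW qren}) : restr_free S U I := [ffun i => v i].
Definition of_restr (v : restr_free S U I) : {ffun I -> qW qren} := [ffun i => v i].
Fact to_restr_linear : linear to_restr.
Proof. by move=> a u v; apply/ffunP => i; rewrite !ffunE. Qed.
Fact of_restr_linear : linear of_restr.
Proof. by move=> a u v; apply/ffunP => i; rewrite !ffunE. Qed.
HB.instance Definition _ := GRing.isLinear.Build (Qs S)
  {ffun I -> qW qren} (restr_free S U I) _ to_restr to_restr_linear.
HB.instance Definition _ := GRing.isLinear.Build (Qs S)
  (restr_free S U I) {ffun I -> qW qren} _ of_restr of_restr_linear.
End ToRestr.

(** The way back from quotients to restricted factorizations over a polynomial ring, the form in
    which the result is stated. *)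
Lemma heq_gq_ren (N : ffact T) :
  heq (gq qren N) (restr wt S (ff_map (psubst s U) N)).
Proof.
have D (I J : finType) (D : J -> I -> Qs T) v :
    mxact (fun j i => psubst s U (D j i)) (to_restr v) = to_restr (gq_act (Q := qren) D v).
  apply/ffunP => j; rewrite !ffunE raddf_sum; apply: eq_bigr => i _.
  rewrite ffunE -[RHS]/(psubst s U (_ * _)) rmorphM /=; congr (_ * _).
  exact/esym/ren_tauK.
by apply: (@heq_iso _ _ (gq qren N) (restr wt S (ff_map (psubst s U) N))
  (@to_restr _) (@to_restr _) (@of_restr _) (@of_restr _)) => //= [v|v|v|v|d v hv i|d v hv i|d v hv i|d v hv i];
  rewrite ?ffunE //; try apply: hv; apply/ffunP => i; rewrite !ffunE.
Qed.
End RenamingQuotients.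

Section RenamingStep.
Variables (V : finType) (wt : V -> nat) (S T : {set V}).

(** The polynomials with this property include the constants and the variables, and are closed under
    sums and products. *)
Lemma subst_diff_dvd (x y : V) (r : V -> V) (q : amb V) :
  r y = x -> (forall v, v != y -> r v = v) ->
  exists t, q - subst r setT q = ('X_(enum_rank x) - 'X_(enum_rank y)) * t.
Proof.
move=> ry rv; set X := 'X_(enum_rank x) - _.
pose P q := exists t, q - subst r setT q = X * t.
have P0 : P 0 by exists 0; rewrite rmorph0 subrr mulr0.
have PD p1 p2 : P p1 -> P p2 -> P (p1 + p2).
  by move=> [t1 e1] [t2 e2]; exists (t1 + t2); rewrite rmorphD mulrDr -e1 -e2; ring.
have PM p1 p2 : P p1 -> P p2 -> P (p1 * p2).
  move=> [t1 e1] [t2 e2]; exists (p1 * t2 + t1 * subst r setT p2).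
  transitivity (p1 * (X * t2) + X * t1 * subst r setT p2); last by ring.
  by rewrite rmorphM -e1 -e2; ring.
have PC c : P c%:MP by exists 0; rewrite substC subrr mulr0.
have PX v : P 'X_(enum_rank v).
  rewrite /P substX in_setT; have [->|hv] := eqVneq v y.
    by exists (-1); rewrite ry /X; ring.
  by exists 0; rewrite rv // subrr mulr0.
rewrite -/(P q) [q]mpolyE; apply: (big_ind P) => // m _.
rewrite -mul_mpolyC; apply: (PM) => //; rewrite mpolyXE_id.
have PXn k d : P ('X_k ^+ d).
  elim: d => [|d IH]; first by rewrite expr0; apply: (PC 1).
  by rewrite exprS; apply: (PM) => //; rewrite -[k]enum_valK; apply: PX.
apply: (big_ind P) => [|p1 p2 h1 h2|k _]; [exact: (PC 1) | exact: PM | exact: PXn].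
Qed.

Variables (s s' : V -> V) (U U' : {set V}).
Variables (hs : renaming_on wt S T s U) (hs' : renaming_on wt S T s' U').

(** The kernel of the substitution y := x is generated by x - y, which is a nonzerodivisor because
    Q[U] is a domain. The sign [eps] allows for both orientations of a line. *)
Lemma qstep_ren (x y : V) (b : Qs T) (db : int) (eps : bool) :
  x \in U' -> y \in U -> x != y -> U' \subset U -> U \subset y |: U' ->
  (forall v, v \in T -> s' v = if s v == y then x else s v) ->
  whomog wt db b ->
  qval (psubst s U b) =
    (-1) ^+ eps * ('X_(enum_rank x) - 'X_(enum_rank y)) ->
  qstep (qren hs) (qren hs') b db.
Proof.
move=> hx hy hxy hUU' hU'U hss' hdb hb.
have [_ _ _ hsU _] := hs.
pose r v := if v == y then x else v.
have ry : r y = x by rewrite /r eqxx.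
have rv v : v != y -> r v = v by rewrite /r => /negbTE ->.
have rU v : v \in U -> r v \in U'.
  by move=> /(subsetP hU'U); rewrite /r in_setU1; case: eqP.
have phiE (p : Qs T) : psubst s' U' p = psubst r U' (psubst s U p).
  by rewrite psubst_comp //; apply: eq_psubst => v hv; rewrite /= /r hss'.
have hxU : x \in U by apply: (subsetP hUU').
have hker (p : Qs T) : psubst s' U' p = 0 -> exists t, psubst s U p = psubst s U (b * t).
  rewrite phiE; set q := psubst s U p => /(congr1 (@qval _ _)) /= hq.
  have [t ht] := subst_diff_dvd (qval q) ry rv.
  have E : subst r setT (qval q) = 0.
    rewrite -[RHS]hq; apply: (eq_subst _ _ (valP q)) => // v hv.
    by rewrite in_setT rU.
  rewrite E subr0 in ht.
  have [hSU hUT hid _ _] := hs.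
  exists ((-1) ^+ eps * emb T (inQ U t)); rewrite !rmorphM /= rmorph_sign.
  have -> : psubst s U (emb T (inQ U t)) = inQ U t by apply: (ren_tauK hs).
  apply: val_inj.
  have qM (e : bool) (z : Qs U) : qval ((-1) ^+ e * z) = (-1) ^+ e * qval z.
    by case: e; rewrite ?expr0 ?expr1 ?mul1r ?mulN1r.
  rewrite -[RHS]/(qval (psubst s U b) * qval ((-1) ^+ eps * inQ U t)) qM.
  rewrite -[LHS]/(qval q) -[qval (inQ U t)]/(subst id U t).
  rewrite hb -(subst_id (valP q)) [X in subst _ _ X]ht rmorphM rmorphB /= !substX hxU hy.
  by rewrite mulrACA -expr2 sqrr_sign mul1r.
have bN0 : qval (psubst s U b) != 0.
  rewrite hb mulf_neq0 ?signr_eq0 // subr_eq0; apply/eqP.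
  move/(congr1 (mcoeff U_(enum_rank x))); rewrite !mcoeffX eqxx.
  case: (U_(enum_rank y)%MM =P U_(enum_rank x)%MM) => [E _|_ /eqP]; last first.
    by rewrite oner_eq0.
  have := congr1 (fun m : 'X_{1..#|V|} => m (enum_rank x)) E.
  rewrite !mnm1E eqxx; case: (enum_rank y =P enum_rank x) => // /enum_rank_inj E' _.
  by rewrite E' eqxx in hxy.
split=> //.
- by move=> p /= h; rewrite /ren_phi phiE -[psubst s U p]/(ren_phi s U p) h rmorph0.
- rewrite /= /ren_phi phiE; apply: val_inj; rewrite /= -[subst s U _]/(qval (psubst s U b)) hb.
  rewrite rmorphM rmorphB /= !substX !ry rv //.
  by rewrite hx subrr mulr0.
- apply: ker_deg => // d p h; rewrite /= /ren_phi (qcomp_psubst hs).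
  by rewrite -[psubst s U p]/(ren_phi s U p) h raddf0.
- move=> t h; have : psubst s U b * psubst s U t = 0 by rewrite -rmorphM.
  move/(congr1 (@qval _ _)); rewrite -[LHS]/(qval _ * qval _) => /eqP.
  by rewrite mulf_eq0 (negbTE bN0) => /eqP h'; apply: val_inj.
Qed.
End RenamingStep.

(** * Removing all the Koszul factors of a product *)

Section Chains.
Variables (V : finType) (wt : V -> nat) (S T : {set V}) (c : int).
Variables (J : eqType) (a b : J -> Qs T) (da db : J -> int).
Hypothesis hdeg : forall j, da j + db j = c + c.
Hypothesis ha : forall j, whomog wt (da j) (a j).
Hypothesis hb : forall j, whomog wt (db j) (b j).

(** By induction from the head of the list: the product a_j b_j vanishes in the next quotient, so
    the condition on the potential passes to the shorter product. *)
Lemma peel_kfold (C : ffact T) v (w : Qs S) (x0 : J) (s : seq J)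
    (Qf : nat -> qdat wt S T) :
  fhomog wt c C -> mfpot C v ->
  (forall k, (k < size s)%N ->
     qstep (Qf k) (Qf k.+1) (b (nth x0 s k)) (db (nth x0 s k))) ->
  qphi (Qf 0%N) (v + \sum_(j <- s) a j * b j) = qphi (Qf 0%N) (emb T w) ->
  heq (gq (Qf 0%N) (tens C (kfold a b da db s))) (gq (Qf (size s)) C).
Proof.
move=> hC vC; elim: s Qf => [|j s IH] Qf st hpot; first exact: heq_tens_unit.
have st0 : qstep (Qf 0%N) (Qf 1%N) (b j) (db j) := st 0%N isT.
have [w0 w1] := gq_pot (mfpot_tens vC (mfpot_kfold a b da db (j :: s))) hpot.
apply: heq_trans.
  exact: (peel_tens st0 (hdeg j) (ha j) hC (fhomog_kfold s hdeg ha hb) w0 w1).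
apply: (IH (fun k => Qf k.+1)) => [k hk|]; first exact: (st k.+1).
rewrite -[RHS](qstep_eq st0 hpot) big_cons addrCA [RHS]raddfD /=.
by rewrite (qstep_mul0 _ st0) add0r.
Qed.

Lemma gf_shift_flip e k (M : gfact S) :
  gf_shift e (iter k (@gf_flip V S) M) = iter k (@gf_flip V S) (gf_shift e M).
Proof. by elim: k => //= k <-. Qed.

Lemma heq_iter_flip k (M N : gfact S) :
  heq M N -> heq (iter k (@gf_flip V S) M) (iter k (@gf_flip V S) N).
Proof. by move=> h; elim: k => //= k; apply: heq_flip. Qed.

(** All the potentials are 0 here. Each factor contributes a flip and a shift by (db - da)/2 = db -
    c; flips commute with shifts, so the two can be collected separately. *)
Lemma peel_kfold_flip (x0 : J) (s : seq J) (Qf : nat -> qdat wt S T) :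
  (forall k, (k < size s)%N ->
     qstep (Qf k) (Qf k.+1) (a (nth x0 s k)) (da (nth x0 s k))) ->
  (forall j, b j = 0) ->
  heq (gq (Qf 0%N) (kfold a b da db s))
    (iter (size s) (@gf_flip V S)
       (gq (Qf (size s)) (ff_shift (\sum_(j <- s) (db j - c)) (ff_unit T)))).
Proof.
move=> + b0; elim: s Qf => [|j s IH] Qf st.
  apply: (@heq_reindex _ _ _ _ (Qf 0%N) (ff_unit T) (ff_shift _ (ff_unit T)) id id id id) => //.
  by case=> /=; rewrite big_nil.
have st0 : qstep (Qf 0%N) (Qf 1%N) (a j) (da j) := st 0%N isT.
have hpot : qphi (Qf 0%N) (\sum_(i <- j :: s) a i * b i) =
    qphi (Qf 0%N) (emb T (0 : Qs S)).
  by rewrite rmorph0 big1 // => i _; rewrite b0 mulr0.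
have [w0 w1] := gq_pot (mfpot_kfold a b da db (j :: s)) hpot.
apply: heq_trans.
  exact: (peel_koszul st0 (hdeg j) (hb j) (fhomog_kfold s hdeg ha hb) w0 w1).
rewrite [size _]/= iterS; apply: heq_flip.
apply: heq_trans.
  by apply: heq_shift; apply: (IH (fun k => Qf k.+1)) => k hk; apply: (st k.+1).
rewrite gf_shift_flip; apply: heq_iter_flip.
apply: heq_trans; first by apply: heq_sym; apply: heq_gq_shift.
set M := ff_shift _ (ff_shift _ _); set N := ff_shift _ _.
apply: (@heq_reindex _ _ _ _ _ M N (id : unit -> unit) (id : unit -> unit)
  (id : void -> void) (id : void -> void)) => //.
by case=> /=; rewrite big_cons (koszul_shift (hdeg j)); ring.
Qed.
End Chains.

(** * Graded free modules *)

Section FreeModules.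
Variables (V : finType) (wt : V -> nat).
Local Notation mon := 'X_{1..#|V|}.

Section Lists.
Variables (S : {set V}) (B : eqType).
Implicit Types (L : seq (Qs S * B)).

Definition lcoef L (k : B) : Qs S := \sum_(x <- L | x.2 == k) x.1.
Definition lkeys L : seq B := undup [seq x.2 | x <- L].

Lemma sum_lcoef (R : zmodType) (F : Qs S -> B -> R) L :
  (forall k, {morph F^~ k : x y / x + y}) -> (forall k, F 0 k = 0) ->
  \sum_(x <- L) F x.1 x.2 = \sum_(k <- lkeys L) F (lcoef L k) k.
Proof.
move=> FD F0.
have E k : F (lcoef L k) k = \sum_(x <- L) if x.2 == k then F x.1 x.2 else 0.
  rewrite /lcoef (big_morph (F^~ k) (FD k) (F0 k)) big_mkcond.
  by apply: eq_bigr => x _; case: eqP => // ->.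
under [RHS]eq_bigr do rewrite E.
rewrite exchange_big big_seq [RHS]big_seq; apply: eq_bigr => x hx.
rewrite (bigD1_seq x.2) ?undup_uniq ?mem_undup ?map_f //= eqxx.
by rewrite big1 ?addr0 // => k /negbTE; rewrite eq_sym => ->.
Qed.

Lemma whomog_lcoef L k (d : B -> int) :
  all (fun x => whomog wt (d x.2) x.1) L -> whomog wt (d k) (lcoef L k).
Proof.
move=> /allP h; rewrite /lcoef big_seq_cond.
apply: (big_ind (whomog wt (d k))) => [|p q|x /andP[/h hx /eqP <-]] //.
  exact: whomog0.
exact: whomogD.
Qed.
End Lists.

(** Spanning may be proved with lists in which basis elements are repeated; [lcoef] gathers the
    coefficients of equal ones. *)
Lemma free_gradedI S (M : gmod S) (B : eqType) (b : B -> M) (g : B -> int) :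
  (forall m, exists L : seq (Qs S * B), m = \sum_(x <- L) x.1 *: b x.2) ->
  (forall d m, gm_deg d m -> exists2 L : seq (Qs S * B),
     all (fun x => whomog wt (d - g x.2) x.1) L & m = \sum_(x <- L) x.1 *: b x.2) ->
  (forall d (s : seq B) (c : B -> Qs S), (forall k, whomog wt (d - g k) (c k)) ->
     gm_deg d (\sum_(k <- s) c k *: b k)) ->
  (forall (s : seq B) (c : B -> Qs S), uniq s ->
     \sum_(k <- s) c k *: b k = 0 -> forall k, k \in s -> c k = 0) ->
  free_graded wt M.
Proof.
have sumE (L : seq (Qs S * B)) :
    \sum_(x <- L) x.1 *: b x.2 = \sum_(k <- lkeys L) lcoef L k *: b k.
  apply: (sum_lcoef (F := fun x k => x *: b k)) => k; last exact: scale0r.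
  by move=> x y; rewrite scalerDl.
move=> h1 h2 h3 h4; exists B, b, g; split=> // [m|d m].
  by have [L ->] := h1 m; exists (lkeys L), (lcoef L); apply: sumE.
split=> [/h2[L hL ->]|[s [c [hc ->]]]]; last exact: h3.
exists (lkeys L), (lcoef L); split; last exact: sumE.
by move=> k; apply: (@whomog_lcoef _ _ L k (fun k => d - g k)).
Qed.

Lemma free_graded_shift S a (M : gmod S) :
  free_graded wt M -> free_graded wt (gshift a M).
Proof.
move=> [B [b [g [h1 h2 h3]]]]; exists B, b, (fun k => g k + a); split=> // d m.
have E k : d - (g k + a) = d - a - g k by rewrite opprD addrA addrAC.
apply: (iff_trans (h3 (d - a) m)).
by split=> -[s [c [hc ->]]]; exists s, c; split=> // k; have := hc k; rewrite E.
Qed.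

Definition msup (U : {set V}) (m : mon) : bool :=
  [forall k, (m k != 0%N) ==> (enum_val k \in U)].

Lemma msupP (U : {set V}) (m : mon) : reflect (forall k, m k != 0%N -> enum_val k \in U) (msup U m).
Proof.
by apply: (iffP forallP) => h k; [exact: implyP (h k) | apply/implyP/h].
Qed.

Lemma supported_monomial (U : {set V}) (m : mon) : msup U m -> supported U 'X_[m].
Proof.
by move=> h; rewrite /supported msuppX /= andbT.
Qed.

Lemma supportedZ (U : {set V}) c (p : amb V) : supported U p -> supported U (c *: p).
Proof.
move=> /supportedP h; apply/supportedP => m; rewrite mcoeffZ mulf_eq0 negb_or.
by case/andP => _ /h.
Qed.

Lemma ahomog_monomial (m : mon) : ahomog wt (mnmwt wt m)%:Z 'X_[m].
Proof.
by apply/ahomogP => m'; rewrite mcoeffX; case: (m =P m') => [->|_] //; rewrite eqxx.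
Qed.

Section RestrFree.
Variables (S T : {set V}) (I : finType) (g : I -> int).
Hypothesis hST : S \subset T.
Let B := (I * {m : mon | msup (T :\: S) m})%type.
Let mo (m : {m : mon | msup (T :\: S) m}) : Qs T := inQ T 'X_[val m].
Let b (k : B) : restr_free S T I := [ffun j => (j == k.1)%:R * mo k.2].

Let msupT m : msup (T :\: S) m -> msup T m.
Proof. by move=> /msupP h; apply/msupP => k /h; rewrite inE => /andP[]. Qed.
Let qval_mo m : qval (mo m) = 'X_[val m].
Proof. by apply: inQ_val; apply/supported_monomial/msupT/valP. Qed.

Let mS (m : mon) : mon := [multinom (if enum_val k \in S then m k else 0%N) | k < #|V|].
Let mU (m : mon) : mon := [multinom (if enum_val k \in T :\: S then m k else 0%N) | k < #|V|].
Let mS_sup m : msup S (mS m).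
Proof. by apply/msupP => k; rewrite mnmE; case: ifP. Qed.
Let mU_sup m : msup (T :\: S) (mU m).
Proof. by apply/msupP => k; rewrite mnmE; case: ifP. Qed.
Let mSU m : msup T m -> (mS m + mU m)%MM = m.
Proof.
move=> /msupP h; apply/mnmP => k; rewrite mnmDE !mnmE in_setD.
case hk : (enum_val k \in S) => /=; first by rewrite addn0.
rewrite add0n; case hk' : (enum_val k \in T) => //.
by apply/esym/eqP; apply: contraFT hk' => /h.
Qed.

Let rep (v : restr_free S T I) : seq (Qs S * B) :=
  [seq (inQ S ((qval (v i))@_m *: 'X_[mS m]), (i, exist _ (mU m) (mU_sup m)))
  | i <- enum I, m <- msupp (qval (v i))].

Let sup_msupp (p : Qs T) m : m \in msupp (qval p) -> msup T m.
Proof.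
rewrite mcoeff_msupp => hm; apply/msupP => k hk.
by have /supportedP/(_ m hm k hk) := valP p.
Qed.

Let repE v : v = \sum_(x <- rep v) x.1 *: b x.2.
Proof.
rewrite /rep big_allpairs_dep /=; apply/ffunP => j; rewrite sum_ffunE big_enum /=.
rewrite (bigD1 j) //= [X in _ + X]big1 ?addr0; last first.
  move=> i hi; rewrite sum_ffunE big1 // => m _; rewrite !ffunE /=.
  by rewrite eq_sym (negbTE hi) mul0r mulr0.
apply: val_inj; rewrite sum_ffunE /= qval_sum [LHS]mpolyE.
rewrite big_seq [RHS]big_seq; apply: eq_bigr => m hm.
have h1 : supported S ((qval (v j))@_m *: 'X_[mS m]).
  exact/supportedZ/supported_monomial.
rewrite !ffunE /= eqxx mul1r (subst_id h1) (subst_id (supportedW hST h1)).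
rewrite subst_id; last exact/supported_monomial/msupT.
by rewrite -scalerAl -mpolyXD mSU // (sup_msupp hm).
Qed.

(** A monomial in [T] is uniquely a monomial in [S] times one in [T :\: S]; the latter, placed in
    each coordinate, form the basis. *)
Lemma free_graded_restr : free_graded wt (restr_gmod wt S T g).
Proof.
apply: (@free_gradedI _ (restr_gmod wt S T g) B b
  (fun k => g k.1 + (mnmwt wt (val k.2))%:Z)).
- by move=> v; exists (rep v); apply: repE.
- move=> d v hv; exists (rep v); last exact: repE.
  apply/allP => _ /allpairsPdep[i [m [_ hm ->]]] /=.
  rewrite -[whomog _ _ _]/(ahomog wt _ (qval (inQ S _))) inQ_val; last first.
    exact/supportedZ/supported_monomial.
  apply: ahomogZ; have := hv i; move=> /whomogP/(_ m); rewrite -mcoeff_msupp => /(_ hm) e.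
  have -> : d - (g i + (mnmwt wt (mU m))%:Z) = (mnmwt wt (mS m))%:Z.
    move: e; rewrite -{1}(mSU (sup_msupp hm)) mnmwtD PoszD; lia.
  exact: ahomog_monomial.
- move=> d s c hc i; rewrite sum_ffunE.
  apply: (big_ind (whomog wt (d - g i))) => [|p q|k _]; first exact: whomog0.
    exact: whomogD.
  rewrite !ffunE; case: eqP => [->|_]; last by rewrite mul0r mulr0 whomog0.
  rewrite mul1r; have -> : d - g k.1 = d - (g k.1 + (mnmwt wt (val k.2))%:Z)
     + (mnmwt wt (val k.2))%:Z by ring.
  apply: whomogM; first by rewrite whomog_emb.
  by rewrite -[whomog _ _ _]/(ahomog wt _ (qval (mo _))) qval_mo ahomog_monomial.
(* Look at the coefficient of [m0 + val m] in the component [i]: by uniqueness of the factorization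
   of monomials, only the term of [(i, m)] contributes to it. *)
- move=> s c us E [i m] hk; apply: Qs_eqP => m0; rewrite mcoeff0.
  apply/eqP; apply: contraT => hm0.
  have /(congr1 (fun v : restr_free S T I => (qval (v i))@_(m0 + val m))) := E.
  rewrite sum_ffunE qval_sum !raddf_sum /= [in RHS]ffunE mcoeff0.
  rewrite (bigD1_seq (i, m)) //= [X in _ + X]big1_seq ?addr0.
    rewrite !ffunE /= eqxx mul1r -[subst _ _ _]/(qval (emb T (c (i, m)))) emb_val //.
    by rewrite [X in _ * X]qval_mo addmC mcoeffMX => /eqP; rewrite (negbTE hm0).
  move=> [i' m'] /andP[hne _]; rewrite !ffunE /=.
  have [hi|_] := eqVneq i i'; last by rewrite mul0r mulr0 mcoeff0.
  rewrite mul1r -[subst _ _ _]/(qval (emb T (c (i', m')))) emb_val // [X in _ * X]qval_mo.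
  apply/eqP; rewrite mcoeff_eq0; apply/negP => /msuppM_le/allpairsP[[m1 m2] /=].
  rewrite msuppX mem_seq1 => -[h1 /eqP -> h].
  case/eqP: hne; rewrite hi; congr (_, _); apply: val_inj; apply/mnmP => k.
  have := congr1 (fun m : mon => m k) h; rewrite !mnmDE.
  have hc1 := valP (c (i', m')); have hc0 := valP (c (i, m)).
  have k1 : enum_val k \notin S -> m1 k = 0%N.
    move=> hkS; apply/eqP; apply: contraNT hkS => hk1.
    by apply: (supportedP _ _ hc1 m1 _ k hk1); rewrite -mcoeff_msupp.
  have k0 : enum_val k \notin S -> m0 k = 0%N.
    by move=> hkS; apply/eqP; apply: contraNT hkS => hk1; apply: (supportedP _ _ hc0 m0).
  have kU (n : {m : mon | msup (T :\: S) m}) : enum_val k \in S -> val n k = 0%N.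
    move=> hkS; apply/eqP; apply: contraTT hkS => /(msupP _ _ (valP n)).
    by rewrite in_setD => /andP[].
  have [hkS|hkS] := boolP (enum_val k \in S); first by rewrite !kU.
  by rewrite k1 // k0.
Qed.
End RestrFree.
End FreeModules.

(** * Graded sections of free quotients *)

Section Sections.
Variables (V : finType) (wt : V -> nat) (S T : {set V}).
Variables (W : lmodType (Qs S)) (deg : int -> W -> Prop) (phi : {additive Qs T -> W}).
Hypothesis phiZ : forall r a, phi (emb T r * a) = r *: phi a.
Hypothesis phiM : forall a b, phi b = 0 -> phi (a * b) = 0.
Hypothesis phi_deg : forall d a, whomog wt d a -> deg d (phi a).
Hypothesis phi_surj_deg : forall d w, deg d w -> exists2 a, whomog wt d a & w = phi a.
Hypothesis hST : S \subset T.

(** Homogeneous lifts of the basis elements extend to a section. The isomorphisms [f] and [f']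
    remember the carrier, which the existential quantifier hides. *)
Lemma qdat_of_free : free_graded wt (@GMod _ S W deg) ->
  exists Q : qdat wt S T, exists f : {linear W -> qW Q}, exists f' : {linear qW Q -> W},
   [/\ cancel f f', cancel f' f, forall d w, deg d w <-> qdeg d (f w) &
     forall a, qphi Q a = f (phi a)].
Proof.
move=> [B [b [g [hspan hindep hdeg]]]].
have degb k : deg (g k) (b k).
  apply/hdeg; exists [:: k], (fun k' => if k' == k then 1 else 0); split.
    move=> k'; case: eqP => [->|_]; last exact: whomog0.
    by rewrite subrr; apply: ahomogC.
  by rewrite big_seq1 eqxx scale1r.
have lift k : exists a, whomog wt (g k) a /\ b k = phi a.
  by have [a ha E] := phi_surj_deg (degb k); exists a.
pose e k := sval (cid (lift k)).
have [he hphe] : (forall k, whomog wt (g k) (e k)) /\ (forall k, b k = phi (e k)).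
  by split=> k; have [] := svalP (cid (lift k)).
(* Lists are formal combinations of basis elements, with value [st] in the quotient and [ev] in
   Q[T]; independence makes [ev] a function of [st], and this function is the section. *)
pose st (L : seq (Qs S * B)) : W := \sum_(x <- L) x.1 *: b x.2.
pose ev (L : seq (Qs S * B)) : Qs T := \sum_(x <- L) emb T x.1 * e x.2.
have st0 L : st L = 0 -> ev L = 0.
  rewrite /st /ev.
  rewrite (sum_lcoef (F := fun x k => x *: b k)) => [|k x y|k];
    rewrite ?scalerDl ?scale0r //.
  rewrite (sum_lcoef (F := fun x k => emb T x * e k)) => [|k x y|k];
    rewrite ?rmorphD ?rmorph0 ?mulrDl ?mul0r //.
  move=> /hindep h; rewrite big_seq big1 // => k hk.
  by rewrite (h _ k hk) ?undup_uniq // rmorph0 mul0r.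
pose sc (a : Qs S) (L : seq (Qs S * B)) := [seq (a * x.1, x.2) | x <- L].
have stZ a L : st (sc a L) = a *: st L.
  by rewrite /st big_map scaler_sumr; apply: eq_bigr => x _; rewrite scalerA.
have evZ a L : ev (sc a L) = emb T a * ev L.
  by rewrite /ev big_map mulr_sumr; apply: eq_bigr => x _; rewrite rmorphM mulrA.
have stD L L' : st (L ++ L') = st L + st L' by rewrite /st big_cat.
have evD L L' : ev (L ++ L') = ev L + ev L' by rewrite /ev big_cat.
have uniq_ev L L' : st L = st L' -> ev L = ev L'.
  move=> E; have := @st0 (L ++ sc (-1) L').
  rewrite stD evD stZ evZ E scaleN1r subrr => /(_ erefl)/eqP.
  by rewrite rmorphN1 mulN1r subr_eq0 => /eqP.
have rep_ex w : exists L, w = st L.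
  have [s [c ->]] := hspan w; exists [seq (c k, k) | k <- s].
  by rewrite /st big_map.
pose rep w := sval (cid (rep_ex w)).
have repE w : st (rep w) = w by rewrite -(svalP (cid (rep_ex w))).
pose tau w := ev (rep w).
have tauZ r w : tau (r *: w) = emb T r * tau w.
  by rewrite /tau -evZ; apply: uniq_ev; rewrite stZ !repE.
have tauB u v : tau (u - v) = tau u - tau v.
  have -> : tau u - tau v = ev (rep u ++ sc (-1) (rep v)).
    by rewrite evD evZ rmorphN1 mulN1r.
  by apply: uniq_ev; rewrite stD stZ !repE scaleN1r.
have phi_ev L : phi (ev L) = st L.
  by rewrite /ev raddf_sum; apply: eq_bigr => x _; rewrite phiZ hphe.
have tauK : cancel tau phi by move=> w; rewrite phi_ev repE.
have tau_deg d w : deg d w -> whomog wt d (tau w).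
  move=> /hdeg[s [c [hc Ew]]].
  have -> : tau w = ev [seq (c k, k) | k <- s].
    by apply: uniq_ev; rewrite repE Ew /st big_map.
  rewrite /ev big_map; apply: (big_ind (whomog wt d)) => [|p q|k _].
  - exact: whomog0.
  - exact: whomogD.
  - have -> : d = (d - g k) + g k by ring.
    by apply: whomogM; rewrite ?whomog_emb.
pose tauM := GRing.isZmodMorphism.Build W (Qs T) tau tauB.
pose tau' : {additive W -> Qs T} := HB.pack tau tauM.
have phiM' a p : phi (a * tau (phi p)) = phi (a * p).
  apply/eqP; rewrite -subr_eq0 -raddfB -mulrBr; apply/eqP/phiM.
  by rewrite raddfB /= tauK subrr.
exists (@QDat _ wt S T W deg phi tau' phiZ tauZ tauK phiM' phi_deg tau_deg).
by exists idfun, idfun; split.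
Qed.
End Sections.

Lemma seq_argmax (I : eqType) (f : I -> nat) (s : seq I) (x0 : I) : x0 \in s ->
  exists2 x, x \in s & forall y, y \in s -> (f y <= f x)%N.
Proof.
elim: s x0 => // a [|a' s] IH x0 _.
  by exists a; rewrite ?mem_head // => y; rewrite mem_seq1 => /eqP ->.
have [x hx hm] := IH a' (mem_head _ _).
have [h|h] := leqP (f a) (f x).
  by exists x; rewrite ?inE ?[_ || (x \in s)]hx ?orbT // => y; rewrite in_cons => /predU1P[->|/hm].
exists a; rewrite ?mem_head // => y; rewrite in_cons => /predU1P[->//|/hm h'].
exact: leq_trans h' (ltnW h).
Qed.

(** * Quotients by homogeneous ideals are graded free over Q *)

Section FreeQuotient.
Variables (V : finType) (wt : V -> nat) (T : {set V}).
Local Notation mon := 'X_{1..#|V|}.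
Variables (r : nat) (g : 'I_r -> Qs T) (dg : 'I_r -> int).
Hypothesis hg : forall j, whomog wt (dg j) (g j).
Local Notation J := (quo_mod set0 g).
Local Notation pi := (@quo_pi V set0 T r g).

Lemma quo_pi_eq0 p : (pi p = 0) <-> exists c : 'I_r -> Qs T, p = \sum_j c j * g j.
Proof.
have E0 : pi 0 = 0.
  by apply: (addrI (pi 0)); rewrite -quo_piD !addr0.
rewrite -E0; split.
  move/eqP; rewrite /quo_pi -Quotient.idealrBE subr0 => /asboolP //.
by move=> h; apply/eqP; rewrite /quo_pi -Quotient.idealrBE subr0; apply/asboolP.
Qed.

Lemma quo_piB p q : pi (p - q) = pi p - pi q.
Proof. by apply/eqP; rewrite eq_sym subr_eq -quo_piD subrK. Qed.
HB.instance Definition _ := GRing.isZmodMorphism.Build (Qs T) J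
  (pi : Qs T -> J) quo_piB.

Lemma quo_pi_qcomp d p : pi p = 0 -> pi (qcomp wt d p) = 0.
Proof.
move=> /quo_pi_eq0[c ->]; apply/quo_pi_eq0.
exists (fun j => qcomp wt (d - dg j) (c j)); rewrite raddf_sum.
by apply: eq_bigr => j _ /=; rewrite mulrC (qcompM _ _ (hg j)) mulrC.
Qed.

Let scE a (x : J) : a *: x = quo_scale a x.
Proof. by []. Qed.

Let cst (c : rat) : Qs set0 := inQ set0 (c%:MP : amb V).
Let cst_val c : qval (cst c) = c%:MP. 
Proof. by apply: inQ_val; apply: supportedC. Qed.
Let Q0_cst (x : Qs (set0 : {set V})) : x = cst (qval x)@_0%MM.
Proof.
apply: Qs_eqP => m; rewrite cst_val mcoeffC.
have [->|hm] := eqVneq m 0%MM; first by rewrite mulr1.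
rewrite mulr0; apply/eqP; apply: contraNT hm => hx; apply/eqP/mnmP => k.
rewrite mnm0E; apply/eqP; apply: contraT => hk.
by have := supportedP _ _ (valP x) m hx k hk; rewrite in_set0.
Qed.

Let mo (m : mon) : Qs T := inQ T 'X_[m].
Let qval_mo m : msup T m -> qval (mo m) = 'X_[m].
Proof. by move=> hm; apply: inQ_val; apply: supported_monomial. Qed.

(* The monomial m reduces, modulo the ideal, to smaller monomials of the same
   degree; the irreducible ones form a basis of the quotient. *)
Let red (m : mon) : Prop := exists L : seq (Qs (set0 : {set V}) * mon),
  all (fun x => [&& msup T x.2, (pickle x.2 < pickle m)%N &
                    mnmwt wt x.2 == mnmwt wt m]) L /\
  pi (mo m) = \sum_(x <- L) x.1 *: pi (mo x.2).
Let std : pred mon := fun m => msup T m && ~~ `[< red m >].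
Let B := {m : mon | std m}.
Let b (k : B) : J := pi (mo (val k)).

Let stdP (k : B) : msup T (val k) /\ ~ red (val k).
Proof. by have /andP[h /asboolP h'] : std (val k) := valP k. Qed.

(** Strong induction on [pickle]. An arbitrary enumeration of the monomials can serve as the order,
    since the quotient is only treated as a graded vector space spanned by them. *)
Let span_mon m : msup T m -> exists2 L : seq (Qs (set0 : {set V}) * B),
  all (fun x => mnmwt wt (val x.2) == mnmwt wt m) L &
  pi (mo m) = \sum_(x <- L) x.1 *: b x.2.
Proof.
have [n hn] := ubnP (pickle m); elim: n m hn => // n IH m hn hm.
have [hs|] := boolP (std m).
  exists [:: (1, exist _ m hs : B)]; first by rewrite /= eqxx.
  by rewrite big_seq1 scale1r.
rewrite /std hm /= negbK => /asboolP[L [hL ->]].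
elim: L hL => [|[c m'] L IHL] /= => [_|/andP[/and3P[h1 h2 /eqP h3] /IHL[L1 hL1 E1]]].
  by exists [::]; rewrite ?big_nil.
have [L2 hL2 E2] := IH m' (leq_trans h2 hn) h1.
exists ([seq (c * x.1, x.2) | x <- L2] ++ L1).
  rewrite all_cat hL1 andbT; apply/allP => _ /mapP[x hx ->] /=.
  by rewrite -h3; apply: (allP hL2).
rewrite big_cons big_cat E1 big_map /= E2 scaler_sumr; congr (_ + _).
by apply: eq_bigr => x _; rewrite scalerA.
Qed.

(** With [P] always true this is plain spanning; with [P] fixing the weight it is spanning by
    elements of the right degree. *)
Let span_deg (P : pred nat) (p : Qs T) :
  (forall m, (qval p)@_m != 0 -> P (mnmwt wt m)) ->
  exists2 L : seq (Qs (set0 : {set V}) * B),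
    all (fun x => P (mnmwt wt (val x.2))) L & pi p = \sum_(x <- L) x.1 *: b x.2.
Proof.
have hp : forall m, (qval p)@_m != 0 -> msup T m.
  by move=> m hm; apply/msupP => k; apply: (supportedP _ _ (valP p)).
have Ep : p = \sum_(m <- msupp (qval p)) emb T (cst (qval p)@_m) * mo m.
  apply: val_inj; rewrite /= qval_sum [LHS]mpolyE big_seq [RHS]big_seq.
  apply: eq_bigr => m; rewrite mcoeff_msupp => hm.
  rewrite -[RHS]/(qval (emb T _) * qval (mo m)) emb_val ?sub0set // cst_val.
  by rewrite qval_mo ?hp // mul_mpolyC.
move=> hP; rewrite [X in pi X]Ep.
have : all (fun m => (qval p)@_m != 0) (msupp (qval p)).
  by apply/allP => m; rewrite mcoeff_msupp.
elim: (msupp _) => [_|m s IH /andP[hm /IH[L hL E]]].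
  by exists [::]; rewrite ?big_nil // (raddf0 (pi : Qs T -> J)).
have [L2 hL2 E2] := span_mon (hp _ hm).
exists ([seq (cst (qval p)@_m * x.1, x.2) | x <- L2] ++ L).
  rewrite all_cat hL andbT; apply/allP => _ /mapP[x hx ->] /=.
  by rewrite (eqP (allP hL2 _ hx)); apply: hP.
rewrite !big_cons big_cat quo_piD E big_map /= -quo_scale_pi E2.
rewrite -scE scaler_sumr; congr (_ + _).
by apply: eq_bigr => x _; rewrite scalerA.
Qed.

Lemma free_graded_quo : free_graded wt (quo_gmod wt set0 g).
Proof.
apply: (@free_gradedI _ _ _ (quo_gmod wt set0 g) B b
  (fun k => (mnmwt wt (val k))%:Z)).
- move=> x; have [p ->] := quo_piP x.
  by have [//|L _ E] := @span_deg predT p; exists L.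
- move=> d x [p hp ->].
  have [m hm|L hL E] := @span_deg (fun k => k%:Z == d) p.
    by apply/eqP; apply: (whomogP _ _ _ hp).
  exists L => //; apply/allP => y hy; rewrite (eqP (allP hL _ hy)) subrr.
  by rewrite (Q0_cst y.1) -[whomog _ _ _]/(ahomog wt 0 (qval (cst _))) cst_val ahomogC.
- move=> d s c hc.
  exists (\sum_(k <- s) emb T (c k) * mo (val k)).
    apply: (big_ind (whomog wt d)) => [|p q|k _]; first exact: whomog0.
      exact: whomogD.
    have -> : d = (d - (mnmwt wt (val k))%:Z) + (mnmwt wt (val k))%:Z by ring.
    apply: whomogM; first by rewrite whomog_emb ?sub0set.
    rewrite -[whomog _ _ _]/(ahomog wt _ (qval (mo _))) qval_mo ?ahomog_monomial //.
    by have [] := stdP k.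
  rewrite (raddf_sum (pi : Qs T -> J)); apply: eq_bigr => k _.
  by rewrite /= -quo_scale_pi.
(* If [c k0] were nonzero, keep the part of the relation in the degree of [k0], which is still a
   relation as the ideal is homogeneous. The largest monomial left in it, [k1], has an invertible
   rational coefficient and so reduces to smaller ones, against its irreducibility. *)
- move=> s c us E k0 hk0; apply/eqP; apply: contraT => nz.
  pose e := mnmwt wt (val k0).
  pose s' := [seq k <- s | (c k != 0) && (mnmwt wt (val k) == e)].
  have hk0' : k0 \in s' by rewrite mem_filter nz eqxx.
  have [k1 hk1 hmax] : exists2 k1, k1 \in s' &
      forall k, k \in s' -> (pickle (val k) <= pickle (val k1))%N.
    exact: seq_argmax hk0'.
  move: hk1; rewrite mem_filter => /andP[/andP[nz1 /eqP wt1] hs1].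
  pose ga k := (qval (c k))@_0%MM.
  have cE k : c k = cst (ga k) by apply: Q0_cst.
  have ga1 : ga k1 != 0.
    by apply: contraNneq nz1 => h; rewrite cE h; apply/eqP/Qs_eqP => m; rewrite cst_val.
  have moh (k : B) : whomog wt (mnmwt wt (val k))%:Z (mo (val k)).
    rewrite -[whomog _ _ _]/(ahomog wt _ (qval (mo _))) qval_mo ?ahomog_monomial //.
    by have [] := stdP k.
  have Es : \sum_(k <- s | mnmwt wt (val k) == e) c k *: b k = 0.
    have : pi (\sum_(k <- s) emb T (c k) * mo (val k)) = 0.
      rewrite (raddf_sum (pi : Qs T -> J)) -[RHS]E; apply: eq_bigr => k _.
      by rewrite /= -quo_scale_pi.
    move/(@quo_pi_qcomp e%:Z); rewrite raddf_sum (raddf_sum (pi : Qs T -> J)) => E'.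
    rewrite -[RHS]E' big_mkcond; apply: eq_bigr => k _ /=.
    have h : whomog wt (mnmwt wt (val k))%:Z (emb T (c k) * mo (val k)).
      rewrite -[X in whomog wt X]add0r whomogM // whomog_emb ?sub0set // cE.
      by rewrite -[whomog _ _ _]/(ahomog wt 0 (qval (cst _))) cst_val ahomogC.
    rewrite (qcomp_homog _ h) eqz_nat; case: eqP => // _.
      by rewrite -quo_scale_pi.
    by rewrite (raddf0 (pi : Qs T -> J)).
  have [_] := stdP k1; case.
  exists [seq (cst (- ga k / ga k1), val k) | k <- s' & k != k1]; split.
    apply/allP => _ /mapP[k + ->] /=; rewrite mem_filter => /andP[hne hk].
    have := hk; rewrite mem_filter => /andP[/andP[_ /eqP ->] _].
    rewrite wt1 eqxx andbT ltn_neqAle hmax // andbT; apply/andP; split.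
      by have [] := stdP k.
    apply: contraNneq hne => /(pcan_inj pickleK) h; apply/eqP; exact: val_inj.
  have Es' : \sum_(k <- s') c k *: b k = 0.
    rewrite big_filter -[RHS]Es [LHS]big_mkcond [RHS]big_mkcond; apply: eq_bigr => k _ /=.
    by have [->|] := eqVneq (c k) 0; rewrite ?scale0r ?if_same.
  have hk1' : k1 \in s' by rewrite mem_filter nz1 wt1 eqxx.
  have inv : cst (ga k1)^-1 * c k1 = 1.
    apply: val_inj; rewrite cE -[LHS]/(qval (cst _) * qval (cst _)) !cst_val.
    by rewrite -mpolyCM mulVf.
  rewrite -[LHS]scale1r -inv -scalerA.
  have -> : c k1 *: pi (mo (val k1)) = - \sum_(k <- s' | k != k1) c k *: b k.
    apply/eqP; rewrite -subr_eq0 opprK -[X in _ == X]Es'.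
    by rewrite [X in _ == X](bigD1_seq k1) //= filter_uniq.
  rewrite scalerN scaler_sumr -sumrN big_map big_filter; apply: eq_bigr => k _.
  rewrite scalerA -scaleNr; congr (_ *: _); apply: val_inj.
  rewrite [in LHS]cE -[LHS]/(- (qval (cst _) * qval (cst _))) -[RHS]/(qval (cst _)) !cst_val.
  by rewrite -mpolyCM -mpolyCN mulNr [in RHS]mulrC.
Qed.
End FreeQuotient.

(** * Regular sequences of homogeneous elements *)

Section RegularSequences.

Variables (V : finType) (wt : V -> nat) (T : {set V}).
Local Notation A := (Qs T).
Implicit Types (s : seq A) (a b p q t u : A).

(** The recursion peels off the head just as [reg] does, so working modulo the tail is a matter of
    unfolding; the ideal depends only on the set of generators, by [idl_subset]. *)
Fixpoint idl s p : Prop :=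
  if s is a :: s' then exists t, idl s' (p - t * a) else p = 0.

Lemma idl0 s : idl s 0.
Proof. by elim: s => //= a s IH; exists 0; rewrite mul0r subrr. Qed.

Lemma idlD s p q : idl s p -> idl s q -> idl s (p + q).
Proof.
elim: s p q => [|a s IH] p q /=; first by move=> -> ->; rewrite addr0.
move=> [t ht] [u hu]; exists (t + u).
by have := IH _ _ ht hu; congr idl; ring.
Qed.

Lemma idlM s q p : idl s p -> idl s (q * p).
Proof.
elim: s p => [|a s IH] p /=; first by move=> ->; rewrite mulr0.
by move=> [t /IH ht]; exists (q * t); rewrite -mulrA -mulrBr.
Qed.

Lemma idlN s p : idl s p -> idl s (- p).
Proof. by move=> /(idlM (-1)); rewrite mulN1r. Qed.

Lemma idlB s p q : idl s p -> idl s q -> idl s (p - q).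
Proof. by move=> hp /idlN; apply: idlD. Qed.

Lemma idl_sum s (I : Type) (r : seq I) (P : pred I) F :
  (forall i, P i -> idl s (F i)) -> idl s (\sum_(i <- r | P i) F i).
Proof. by move=> h; apply: big_ind => //; [apply: idl0 | apply: idlD]. Qed.

Lemma idl_tail a s p : idl s p -> idl (a :: s) p.
Proof. by move=> h; exists 0; rewrite mul0r subr0. Qed.

Lemma idl_mem s a : a \in s -> idl s a.
Proof.
elim: s => // b s IH; rewrite in_cons => /predU1P[->|/IH]; last exact: idl_tail.
by exists 1; rewrite mul1r subrr; apply: idl0.
Qed.

Lemma idl_sub s s' p : (forall a, a \in s -> idl s' a) -> idl s p -> idl s' p.
Proof.
elim: s p => [|a s IH] p h /=; first by move=> ->; apply: idl0.
move=> [t ht]; rewrite -[p](subrK (t * a)); apply: idlD.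
  by apply: IH => // b hb; apply: h; rewrite in_cons hb orbT.
by apply: idlM; apply: h; rewrite mem_head.
Qed.

Lemma idl_subset s s' p : {subset s <= s'} -> idl s p -> idl s' p.
Proof. by move=> h; apply: idl_sub => a /h; apply: idl_mem. Qed.

Definition nzd s a : Prop := forall t, idl s (a * t) -> idl s t.

(* The regular sequence is read from the end of the list: its head comes last. *)
Fixpoint reg s : Prop := if s is a :: s' then nzd s' a /\ reg s' else True.

Lemma nzd_mem s s' a : s =i s' -> nzd s a -> nzd s' a.
Proof.
move=> h ha t ht; apply: (@idl_subset s) => [x|]; first by rewrite h.
by apply: ha; apply: idl_subset ht => x; rewrite h.
Qed.

Lemma nzdM s a b : nzd s a -> nzd s b -> nzd s (a * b).
Proof. by move=> ha hb t; rewrite -mulrA => /ha/hb. Qed.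

Lemma nzdN s a : nzd s a -> nzd s (- a).
Proof. by move=> ha t; rewrite mulNr => /idlN; rewrite opprK => /ha. Qed.

Lemma nzd_mod s a b : idl s (a - b) -> nzd s b -> nzd s a.
Proof.
move=> hab hb t hat; apply: hb; have -> : b * t = a * t - t * (a - b) by ring.
by apply: idlB => //; apply: idlM.
Qed.

Definition homogs s : Prop :=
  forall a, a \in s -> exists2 d : nat, (0 < d)%N & whomog wt d%:Z a.

Lemma idl_qcomp s d p : homogs s -> idl s p -> idl s (qcomp wt d p).
Proof.
elim: s p => [|a s IH] p hs /=; first by move=> ->; rewrite raddf0.
have [e _ ha] := hs a (mem_head _ _).
move=> [t /IH ht]; exists (qcomp wt (d - e%:Z) t).
have : idl s (qcomp wt d (p - t * a)).
  by apply: ht => b hb; apply: hs; rewrite in_cons hb orbT.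
by rewrite raddfB /= [t * a]mulrC (qcompM _ _ ha) mulrC.
Qed.

Lemma qcomp_neg d p : (d < 0)%R -> qcomp wt d p = 0.
Proof. by move=> hd; apply: qcomp_eq0 => m _; lia. Qed.

(** A graded form of Krull's intersection theorem: since [a] has positive degree, a multiple of its
    power number |d|+1 has no component of degree d. *)
Lemma idl_separated s a t : homogs (a :: s) ->
  (forall k, exists u, idl s (t - a ^+ k * u)) -> idl s t.
Proof.
move=> has h; have hs : homogs s by move=> b hb; apply: has; rewrite in_cons hb orbT.
have [e e0 ha] := has a (mem_head _ _).
rewrite (qcomp_sum wt t); apply: idl_sum => d _.
have [u /(idl_qcomp d hs)] := h `|d|%N.+1.
have hak : whomog wt (e%:Z *+ `|d|%N.+1) (a ^+ `|d|%N.+1).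
  elim: (_.+1) => [|k IH]; first exact: ahomogC.
  by rewrite exprS mulrS whomogM.
rewrite raddfB /= (qcompM _ _ hak) (@qcomp_neg (d - _)) ?mulr0 ?subr0 //.
rewrite -mulr_natr natz -PoszM.
have h1 : (`|d|%N.+1 <= e * `|d|%N.+1)%N by apply: leq_pmull.
have h2 : d < `|d|%N.+1%:Z by lia.
by move: h1 h2; set K := (e * _)%N; lia.
Qed.

(* If b t = 0 modulo s then t is divisible by every power of a modulo s. *)
Lemma nzd_swap s a b : homogs (a :: s) -> nzd s a -> nzd (a :: s) b ->
  nzd s b /\ nzd (b :: s) a.
Proof.
move=> has ha hb.
have hsb : nzd s b.
  move=> t ht; apply: (idl_separated has) => k.
  suff [u [hu _]] : exists u, idl s (t - a ^+ k * u) /\ idl s (b * u) by exists u.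
  elim: k => [|k [u [hu hbu]]].
    by exists t; rewrite expr0 mul1r subrr; split => //; apply: idl0.
  have [v hv] := hb u (idl_tail a hbu).
  exists v; split.
    have -> : t - a ^+ k.+1 * v = (t - a ^+ k * u) + a ^+ k * (u - v * a).
      by rewrite exprSr; ring.
    by apply: idlD => //; apply: idlM.
  apply: ha; have -> : a * (b * v) = b * u - b * (u - v * a) by ring.
  by apply: idlB => //; apply: idlM.
split=> // t [u hu].
have [v hv] : idl (a :: s) u.
  apply: hb; exists t; have -> : b * u - t * a = - (a * t - u * b) by ring.
  exact: idlN.
exists v; apply: ha.
have -> : a * (t - v * b) = (a * t - u * b) + b * (u - v * a) by ring.
by apply: idlD => //; apply: idlM.
Qed.

Lemma homogs_cat s s' : homogs (s ++ s') <-> homogs s /\ homogs s'.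
Proof.
split=> [h|[h h'] a]; last by rewrite mem_cat => /orP[/h|/h'].
by split=> a ha; apply: h; rewrite mem_cat ha ?orbT.
Qed.

Lemma homogs_cons a s : homogs (a :: s) <-> homogs [:: a] /\ homogs s.
Proof. exact: (homogs_cat [:: a] s). Qed.

(** Repeated use of [nzd_swap]: [a] is exchanged with its successors in the regular sequence one at
    a time. *)
Lemma reg_first_last s a s0 : homogs (s ++ a :: s0) ->
  reg (s ++ a :: s0) -> reg (a :: s ++ s0).
Proof.
elim: s => //= b s IH /homogs_cons[hb hs] [h1 /(IH hs)[h2 h3]].
have h1' : nzd (a :: s ++ s0) b.
  by apply: nzd_mem h1 => x; rewrite !(mem_cat, in_cons); do !case: (_ \in _); do !case: (_ == _).
move: hs => /homogs_cat[hs /homogs_cons[ha hs0]].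
have [|h4 h5] := nzd_swap _ h2 h1'; last by [].
by apply/homogs_cons; split => //; apply/homogs_cat.
Qed.

Lemma reg_last_first s a s0 : homogs (a :: s ++ s0) ->
  reg (a :: s ++ s0) -> reg (s ++ a :: s0).
Proof.
elim: s => //= b s IH /homogs_cons[ha /homogs_cons[hb hs]] [h1 [h2 h3]].
have [|h4 h5] := nzd_swap _ h2 h1; first by apply/homogs_cons.
split; last by apply: IH => //; apply/homogs_cons.
apply: nzd_mem h5 => x; rewrite !(mem_cat, in_cons).
by do !case: (_ \in _); do !case: (_ == _).
Qed.

Lemma reg_rev s s0 : homogs (s ++ s0) -> reg (s ++ s0) -> reg (rev s ++ s0).
Proof.
elim: s s0 => // a s IH s0 hs /(reg_last_first hs).
move: hs; rewrite cat_cons => /homogs_cons[ha /homogs_cat[hs hs0]] h.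
rewrite rev_cons cat_rcons; apply: IH => //.
by apply/homogs_cat; split=> //; apply/homogs_cons.
Qed.

Lemma reg_cat s s0 : reg (s ++ s0) -> reg s0.
Proof. by elim: s => //= a s IH [_ /IH]. Qed.
End RegularSequences.

(** * Regularity of windows of a recurrent sequence *)

Section RecurrentSequences.
Variables (V : finType) (wt : V -> nat) (T : {set V}).
Local Notation A := (Qs T).
Variables (N M : nat) (x c : nat -> A) (u : A).

Let X l := [seq x j | j <- iota l (N - l)].
Let C m l := rev [seq c k | k <- iota m l].

Hypothesis xreg : reg (X 0).
Hypothesis xhom : forall j, (j < N)%N -> homogs wt [:: x j].
Hypothesis chom : forall k, (0 < k)%N -> homogs wt [:: c k].
Hypothesis c0 : u * c 0%N = 1.
Hypothesis cS : forall k, (k < M)%N -> c k.+1 = - \sum_(j < N | (j <= k)%N) x j * c (k - j)%N.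

Let homX l : homogs wt (X l).
Proof.
move=> a /mapP[j]; rewrite mem_iota => /andP[h1 h2] ->.
by apply: (xhom (j := j)); rewrite ?mem_head //; lia.
Qed.
Let homC m l : (0 < m)%N -> homogs wt (C m l).
Proof.
move=> hm a; rewrite mem_rev => /mapP[k]; rewrite mem_iota => /andP[h1 h2] ->.
by apply: (chom (k := k)); rewrite ?mem_head //; lia.
Qed.
Let XS l : (l < N)%N -> X l = x l :: X l.+1.
Proof. by move=> h; rewrite /X -(subnSK h). Qed.

(* Modulo x_(l+1), ..., x_(N-1) and c_m, ..., c_(m+l-1), the recurrence gives
   c_(m+l) = - x_l c_(m-1). *)
Lemma reg_recurrent l m : (l <= N)%N -> (0 < m)%N -> (m + l <= M.+1)%N -> reg (C m l ++ X l).
Proof.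
elim: l m => [|l IHl] m hl hm hM; first exact: xreg.
elim: m hm hM => // m IHm _ hM.
have hC : C m.+1 l.+1 = c (m.+1 + l)%N :: C m.+1 l.
  by rewrite /C -[l.+1]addn1 iotaD map_cat rev_cat.
rewrite hC cat_cons.
(* The outer induction gives a regular sequence containing [x l], which is moved to its end; hence
   [x l] is a nonzerodivisor modulo the other elements. *)
have [h1 h2] : reg (x l :: C m.+1 l ++ X l.+1).
  apply: (reg_first_last (wt := wt)); rewrite -XS //; last by apply: IHl => //; lia.
  by apply/homogs_cat; split; [apply: homC | apply: homX].
split=> //.
(* [c m] is a nonzerodivisor modulo the same elements: it is a unit when m = 0, and otherwise the
   inner induction applies to the window that starts one index earlier. *)
have h3 : nzd (C m.+1 l ++ X l.+1) (c m).
  case: m hM IHm {h1 h2 hC} => [_ _|m hM IHm].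
    by move=> t /(idlM u); rewrite mulrA c0 mul1r.
  have E : C m.+1 l.+1 ++ X l.+1 = C m.+2 l ++ c m.+1 :: X l.+1.
    by rewrite /C /= rev_cons cat_rcons.
  have [] : reg (c m.+1 :: C m.+2 l ++ X l.+1); last by [].
  apply: (reg_first_last (wt := wt)); rewrite -E; last by apply: IHm; lia.
  by apply/homogs_cat; split; [apply: homC | apply: homX].
apply: nzd_mod (nzdM (nzdN h1) h3).
rewrite addSn cS; last by lia.
rewrite (bigD1 (Ordinal hl)) /= ?leq_addl // addnK.
rewrite mulNr opprK opprD addrAC addNr add0r; apply/idlN/idl_sum => j /andP[hj hjl].
have hjl' : (j != l :> nat) by apply: contraNneq hjl => e; apply/eqP/val_inj.
have [h|h] := ltnP j l; last first.
  rewrite mulrC; apply/idlM/idl_mem; rewrite mem_cat; apply/orP; right.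
  by apply: map_f; rewrite mem_iota; have := ltn_ord j; lia.
apply/idlM/idl_mem; rewrite mem_cat mem_rev; apply/orP; left.
by apply: map_f; rewrite mem_iota; lia.
Qed.

Lemma reg_recurrent_rev m : (0 < m)%N -> (m + N <= M.+1)%N -> reg [seq c k | k <- iota m N].
Proof.
move=> hm hM; have := reg_recurrent (leqnn N) hm hM.
rewrite /X subnn /= => h; have := reg_rev _ h; rewrite !cats0 revK; apply.
by apply: (homC (m := m) (l := N)).
Qed.
End RecurrentSequences.

(** * Distinct variables form a regular sequence *)

Section RegularVariables.
Variables (V : finType) (wt : V -> nat) (T : {set V}).
Local Notation mon := 'X_{1..#|V|}.
Variables (N : nat) (v : nat -> V).
Hypothesis vT : forall j, (j < N)%N -> v j \in T.
Hypothesis v_inj : forall i j, (i < N)%N -> (j < N)%N -> v i = v j -> i = j.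

Definition qvar j : Qs T := inQ T 'X_(enum_rank (v j)).

Lemma qval_qvar j : (j < N)%N -> qval (qvar j) = 'X_(enum_rank (v j)).
Proof. by move=> h; apply: inQ_val; apply/supportedX/vT. Qed.

Lemma idl_variables s (p : Qs T) : {in s, forall j, (j < N)%N} ->
  idl [seq qvar j | j <- s] p <->
  (forall m : mon, (qval p)@_m != 0 -> exists2 j, j \in s & m (enum_rank (v j)) != 0%N).
Proof.
move=> hs; split.
  elim: s p hs => [|j s IH] p hs /=; first by move=> -> m; rewrite mcoeff0 eqxx.
  have hj : (j < N)%N by apply: hs; rewrite mem_head.
  move=> [t /IH h] m hm.
  have hs' : {in s, forall j, (j < N)%N} by move=> k hk; apply: hs; rewrite in_cons hk orbT.
  have [hz|/(h hs')[k hk hmk]] := eqVneq (qval (p - t * qvar j))@_m 0; last first.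
    by exists k => //; rewrite in_cons hk orbT.
  exists j; first by rewrite mem_head.
  have : (qval t * 'X_(enum_rank (v j)))@_m != 0.
    have -> : qval t * 'X_(enum_rank (v j)) = qval p - qval (p - t * qvar j).
      by rewrite -(qval_qvar hj) -[RHS]/(qval p - (qval p - qval t * qval (qvar j))); ring.
    by rewrite mcoeffB hz subr0.
  rewrite -mcoeff_msupp => /msuppM_le/allpairsP[[m1 m2] /=].
  rewrite msuppX mem_seq1 => -[_ /eqP -> ->].
  by rewrite mnmDE mnm1E eqxx addn1.
move=> h.
have -> : p = \sum_(m <- msupp (qval p)) inQ T ((qval p)@_m *: 'X_[m]).
  apply: val_inj; rewrite /= qval_sum [LHS]mpolyE big_seq [RHS]big_seq.
  apply: eq_bigr => m; rewrite mcoeff_msupp => hm.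
  rewrite inQ_val //; apply/supportedZ/supported_monomial/msupP => k hk.
  exact: (supportedP _ _ (valP p)) hm k hk.
rewrite big_seq; apply: idl_sum => m; rewrite mcoeff_msupp => hm.
have [j hj hmj] := h m hm; have hjN := hs j hj.
have -> : inQ T ((qval p)@_m *: 'X_[m]) =
    inQ T ((qval p)@_m *: 'X_[m - U_(enum_rank (v j))]) * qvar j.
  have hle : (U_(enum_rank (v j)) <= m)%MM by rewrite lep1mP.
  apply: val_inj; rewrite /= -!rmorphM; congr (subst _ _ _).
  by rewrite -scalerAl -mpolyXD submK.
by apply/idlM/idl_mem/map_f.
Qed.

Lemma reg_variables l : reg [seq qvar j | j <- iota l (N - l)].
Proof.
have [k hk] := ubnP (N - l)%N; elim: k l hk => // k IH l hk.
have [hl|hl] := leqP N l; first by rewrite (eqP hl).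
rewrite -(subnSK hl) /=; split; last by apply: IH; lia.
have hs : {in iota l.+1 (N - l.+1), forall j, (j < N)%N}.
  by move=> j; rewrite mem_iota; lia.
move=> t /(idl_variables _ hs) h; apply/(idl_variables _ hs) => m hm.
have [|j hj] := h (m + U_(enum_rank (v l)))%MM.
  by rewrite /= -/(qvar l) -[subst _ _ _]/(qval (qvar l)) qval_qvar // mulrC addmC mcoeffMX.
rewrite mnmDE mnm1E; case: (_ =P enum_rank (v j)) => [/enum_rank_inj E|_]; last first.
  by rewrite addn0; exists j.
have E' := v_inj hl (hs j hj) E.
by move: hj; rewrite mem_iota -E' ltnn.
Qed.
End RegularVariables.

(** * Successive quotients by a sequence of homogeneous elements *)

Section QuotientChain.
Variables (V : finType) (wt : V -> nat) (T : {set V}).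
Variables (a : nat -> Qs T) (da : nat -> int).
Hypothesis ha : forall k, whomog wt (da k) (a k).
Local Notation gens k := (fun j : 'I_k => a j).

Lemma idl_enum (I : eqType) (s : seq I) (F : I -> Qs T) p : uniq s ->
  idl [seq F j | j <- s] p <-> exists c : I -> Qs T, p = \sum_(j <- s) c j * F j.
Proof.
elim: s p => [|i s IH] p /=.
  by move=> _; split=> [->|[c]]; [exists (fun=> 0)|]; rewrite big_nil.
move=> /andP[his us]; split=> [[t /(IH _ us)[c E]]|[c ->]].
  exists (fun j => if j == i then t else c j).
  rewrite big_cons eqxx -[p](subrK (t * F i)) E addrC; congr (_ + _).
  apply: eq_big_seq => j hj.
  by case: eqP => // Ej; rewrite -Ej hj in his.
exists (c i); apply/(IH _ us); exists c.
by rewrite big_cons addrC addKr.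
Qed.

Lemma quo_idl k p :
  quo_pi set0 (gens k) p = 0 <-> idl [seq a j | j <- iota 0 k] p.
Proof.
apply: (iff_trans (quo_pi_eq0 _ _)); apply: iff_sym.
apply: (iff_trans (idl_enum _ _ (iota_uniq 0 k))).
have E (c : nat -> Qs T) : \sum_(j <- iota 0 k) c j * a j = \sum_(j < k) c j * a j.
  by rewrite -[in LHS](subn0 k) -/(index_iota 0 k) big_mkord.
split=> [[c ->]|[c ->]]; first by exists (fun j : 'I_k => c (val j)); apply: E.
exists (fun j => if insub j is Some i then c i else 0); rewrite E.
by apply: eq_bigr => j _; rewrite valK.
Qed.

Lemma quo_qdat_ex k : exists Q : qdat wt set0 T,
  exists f : {linear quo_mod set0 (gens k) -> qW Q},
  exists f' : {linear qW Q -> quo_mod set0 (gens k)},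
   [/\ cancel f f', cancel f' f,
       forall d w, @gm_deg _ _ (quo_gmod wt set0 (gens k)) d w <-> qdeg d (f w) &
     forall p, qphi Q p = f (quo_pi set0 (gens k) p)].
Proof.
apply: (@qdat_of_free _ wt set0 T (quo_mod set0 (gens k))
  (@gm_deg _ _ (quo_gmod wt set0 (gens k)))
  (quo_pi set0 (gens k) : Qs T -> quo_mod set0 (gens k))).
- by move=> r p; rewrite /= -quo_scale_pi.
- move=> p q /quo_idl h; apply/quo_idl; exact: idlM.
- by move=> d p hp; exists p.
- by move=> d w [p hp ->]; exists p.
- exact: sub0set.
- by apply: (free_graded_quo (dg := fun j : 'I_k => da j)) => j; apply: ha.
Qed.

Definition quo_qdat k : qdat wt set0 T := sval (cid (quo_qdat_ex k)).

Lemma quo_qdat_ker k p : qphi (quo_qdat k) p = 0 <-> idl [seq a j | j <- iota 0 k] p.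
Proof.
have [f [f' [fK fK' _ hphi]]] := svalP (cid (quo_qdat_ex k)).
rewrite -[qphi _]/(qphi (sval (cid (quo_qdat_ex k)))) hphi -quo_idl; split=> [h|->].
  by rewrite -[LHS]fK h raddf0.
by rewrite raddf0.
Qed.

Lemma qphi_eq (Q : qdat wt set0 T) p q :
  qphi Q p = qphi Q q <-> qphi Q (p - q) = 0.
Proof.
rewrite raddfB; split=> [->|/eqP]; first by rewrite subrr.
by rewrite subr_eq0 => /eqP.
Qed.

(** The quotients enter only through their kernels, so that a chain may start at the polynomial ring
    itself instead of its quotient by the zero ideal. *)
Lemma qstep_idl (Q Q' : qdat wt set0 T) k :
  (forall p, qphi Q p = 0 <-> idl [seq a j | j <- iota 0 k] p) ->
  (forall p, qphi Q' p = 0 <-> idl [seq a j | j <- iota 0 k.+1] p) ->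
  nzd [seq a j | j <- iota 0 k] (a k) -> qstep Q Q' (a k) (da k).
Proof.
move=> kQ kQ' hnz.
have hk p : idl [seq a j | j <- iota 0 k.+1] p <->
    exists t, idl [seq a j | j <- iota 0 k] (p - t * a k).
  rewrite -[X in iota 0 X]addn1 iotaD map_cat /= add0n.
  set s := [seq a j | j <- iota 0 k]; split=> [h|h].
    have : idl (a k :: s) p by apply: idl_subset h => x; rewrite mem_cat !inE orbC.
    by [].
  by apply: (@idl_subset _ _ (a k :: s)) => // x; rewrite mem_cat !inE orbC.
split; first exact: ha.
- by move=> p /kQ h; apply/kQ'/hk; exists 0; rewrite mul0r subr0.
- by apply/kQ'/hk; exists 1; rewrite mul1r subrr; apply: idl0.
- by move=> p /kQ'/hk[t ht]; exists t; apply/qphi_eq/kQ; rewrite mulrC.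
- apply: ker_deg => [|d p /kQ/quo_idl h|p /kQ'/hk[t ht]].
  + exact: ha.
  + apply/kQ/quo_idl.
    by apply: (quo_pi_qcomp (dg := fun j : 'I_k => da j)).
  + by exists t; apply/qphi_eq/kQ; rewrite mulrC.
- by move=> t /kQ/hnz h; apply/kQ.
Qed.

Section Even.
Variables (Q : qdat wt set0 T) (W : lmodType (Qs (set0 : {set V}))).
Variables (f : {linear W -> qW Q}) (f' : {linear qW Q -> W}).
Definition even_to (v : {ffun unit -> qW Q}) : W := f' (v tt).
Definition even_of (w : W) : {ffun unit -> qW Q} := [ffun _ => f w].
Fact even_to_linear : linear even_to.
Proof. by move=> c u v; rewrite /even_to !ffunE linearP. Qed.
Fact even_of_linear : linear even_of.
Proof. by move=> c u v; apply/ffunP => i; rewrite !ffunE linearP. Qed.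
HB.instance Definition _ := GRing.isLinear.Build _ {ffun unit -> qW Q} W _
  even_to even_to_linear.
HB.instance Definition _ := GRing.isLinear.Build _ W {ffun unit -> qW Q} _
  even_of even_of_linear.
End Even.

Lemma heq_quo_even k e :
  heq (gq (quo_qdat k) (ff_shift e (ff_unit T)))
      (gf_shift e (gf_even wt (quo_gmod wt set0 (gens k)))).
Proof.
apply: heq_trans (heq_gq_shift _ _ _) _; apply: heq_shift.
have [f [f' [fK fK' hdeg _]]] := svalP (cid (quo_qdat_ex k)).
rewrite -/(quo_qdat k) in f f' fK fK' hdeg *.
apply: (@heq_iso _ _ (gq (quo_qdat k) (ff_unit T))
  (gf_even wt (quo_gmod wt set0 (gens k)))
  (even_to f') \0 (even_of f) \0).
- by move=> v; apply/ffunP => -[]; rewrite ffunE fK'.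
- by move=> w; rewrite /= /even_to ffunE fK.
- by move=> v; apply/ffunP => -[].
- by move=> v; apply/ffunP => -[].
- by move=> d v hv; apply/hdeg; rewrite fK'; have := hv tt; rewrite subr0.
- by move=> d v _ [].
- by move=> d w /hdeg hw i; rewrite ffunE subr0.
- by move=> d v _ [].
- by [].
- by move=> m; rewrite /= /even_to ffunE big1 ?raddf0 ?raddf0.
Qed.
End QuotientChain.

(** * Power sums through the logarithmic derivative *)

Section LogarithmicDerivative.
Variable (n : nat).

Section Ring.
Variable (A : comNzRingType).
Implicit Types (E p q : {poly A}).

(* When E has constant term 1, this is 1 / E modulo X^(n+2). *)
Definition geo E : {poly A} := \sum_(k < n.+2) (1 - E) ^+ k.

(* With E = prod_j (1 + t_j X), X E' / E has the coefficient
   (-1)^n (t_1^(n+1) + ... + t_r^(n+1)) in degree n + 1. *)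
Definition logd E : {poly A} := 'X * E^`() * geo E.
Definition pscoef E : A := (-1) ^+ n * (logd E)`_n.+1.

(** Congruence modulo X^(n+2), the lowest power that leaves the coefficient of X^(n+1), which
    carries the power sum, intact. *)
Definition eqX p q : Prop := exists h, p = q + h * 'X^(n.+2).

Lemma eqX_coef p q k : (k < n.+2)%N -> eqX p q -> p`_k = q`_k.
Proof. by move=> hk [h ->]; rewrite coefD coefMXn hk addr0. Qed.

Lemma eqX_trans p q r : eqX p q -> eqX q r -> eqX p r.
Proof. by move=> [h ->] [h' ->]; exists (h' + h); ring. Qed.
Lemma eqX_sym p q : eqX p q -> eqX q p.
Proof. by move=> [h ->]; exists (- h); ring. Qed.
Lemma eqXM r p q : eqX p q -> eqX (r * p) (r * q).
Proof. by move=> [h ->]; exists (r * h); ring. Qed.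
Lemma eqXD p q p' q' : eqX p q -> eqX p' q' -> eqX (p + p') (q + q').
Proof. by move=> [h ->] [h' ->]; exists (h + h'); ring. Qed.

Lemma coef0_eq0 p : p`_0 = 0 -> exists q, p = q * 'X.
Proof.
elim/poly_ind: p => [|p c _]; first by exists 0; rewrite mul0r.
rewrite coefD coefMX coefC /= add0r => ->.
by exists p; rewrite polyC0 addr0.
Qed.

Lemma geo_inv E : E`_0 = 1 -> eqX (E * geo E) 1.
Proof.
move=> hE; have [u hu] : exists u, 1 - E = u * 'X.
  by apply: coef0_eq0; rewrite coefB coef1 hE subrr.
exists (- u ^+ n.+2).
have -> : E * geo E = - (((1 - E) - 1) * \sum_(k < n.+2) (1 - E) ^+ k).
  by rewrite /geo; ring.
by rewrite -subrX1 hu exprMn; ring.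
Qed.

Lemma geo_uniq E p : E`_0 = 1 -> eqX (E * p) 1 -> eqX p (geo E).
Proof.
move=> /geo_inv h1 h2.
have h3 := eqXM p h1; have h4 := eqXM (geo E) h2.
move: h3 h4; rewrite !mulr1 (_ : p * (E * _) = geo E * (E * p)); last by ring.
by move=> /eqX_sym h3 /(eqX_trans h3).
Qed.

Lemma geoM E E' : E`_0 = 1 -> E'`_0 = 1 -> eqX (geo (E * E')) (geo E * geo E').
Proof.
move=> h h'; apply: eqX_sym; apply: geo_uniq.
  by rewrite coef0M h h' mulr1.
have -> : E * E' * (geo E * geo E') = (E * geo E) * (E' * geo E') by ring.
apply: eqX_trans (geo_inv h); rewrite -[X in eqX _ X]mulr1.
exact/eqXM/geo_inv.
Qed.

(** The logarithmic derivative turns products into sums. *)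
Lemma pscoefM E E' : E`_0 = 1 -> E'`_0 = 1 ->
  pscoef (E * E') = pscoef E + pscoef E'.
Proof.
move=> h h'; rewrite /pscoef -mulrDr -coefD; congr (_ * _).
apply: eqX_coef => //; rewrite /logd.
apply: eqX_trans (eqXM _ (geoM h h')) _; rewrite derivM.
have -> : 'X * (E^`() * E' + E * E'^`()) * (geo E * geo E') =
   'X * E^`() * geo E * (E' * geo E') + 'X * E'^`() * geo E' * (E * geo E) by ring.
apply: eqXD; rewrite -[X in eqX _ X]mulr1; exact/eqXM/geo_inv.
Qed.

Lemma pscoef1 : pscoef 1 = 0.
Proof. by rewrite /pscoef /logd derivC mulr0 mul0r coef0 mulr0. Qed.

Lemma pscoef_linear (t : A) : pscoef (1 + t *: 'X) = t ^+ n.+1.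
Proof.
rewrite /pscoef /logd derivD derivC add0r derivZ derivX alg_polyC /geo.
rewrite -mulrA coefXM /= mul_polyC coefZ coef_sum.
(* Only the term k = n of the geometric series has degree n; its sign cancels the (-1)^n in
   [pscoef]. *)
rewrite (bigD1 (Ordinal (leqnSn n.+1))) //= big1 ?addr0 => [|k hk].
  rewrite opprD addrA subrr add0r -scaleNr exprZn coefZ coefXn eqxx mulr1.
  by rewrite [(- t) ^+ n]exprNn exprS -signr_odd; case: odd; rewrite ?expr0 ?expr1; ring.
rewrite opprD addrA subrr add0r -scaleNr exprZn coefZ coefXn.
case: eqP => [E|]; last by rewrite mulr0.
by case/eqP: hk; apply: val_inj.
Qed.

Lemma pscoef_prod I (r : seq I) (t : I -> A) :
  pscoef (\prod_(i <- r) (1 + t i *: 'X)) = \sum_(i <- r) t i ^+ n.+1.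
Proof.
have h s : (\prod_(i <- s) (1 + t i *: 'X))`_0 = 1.
  rewrite -horner_coef0 horner_prod big1 // => i _.
  by rewrite hornerD hornerZ hornerX mulr0 hornerC addr0.
elim: r => [|i r IH]; first by rewrite !big_nil pscoef1.
rewrite !big_cons pscoefM ?IH ?pscoef_linear //.
by rewrite coefD coefZ coefX mulr0 coef1 addr0.
Qed.
End Ring.

Lemma map_geo (A B : comNzRingType) (f : {rmorphism A -> B}) (E : {poly A}) :
  map_poly f (geo E) = geo (map_poly f E).
Proof.
by rewrite rmorph_sum; apply: eq_bigr => k _; rewrite rmorphXn rmorphB rmorph1.
Qed.

Lemma pscoef_map (A B : comNzRingType) (f : {rmorphism A -> B}) (E : {poly A}) :
  f (pscoef E) = pscoef (map_poly f E).
Proof.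
rewrite /pscoef rmorphM rmorph_sign -coef_map; congr (_ * _`__).
by rewrite /logd !rmorphM /= map_polyX deriv_map map_geo.
Qed.

(** The generating polynomial of the w_j. For elementary symmetric polynomials it is the product of
    the 1 + t_j X. *)
Definition epoly (A : comNzRingType) (r : nat) (w : 'I_r -> A) : {poly A} :=
  1 + \sum_(j < r) w j *: 'X^(j.+1).

Lemma map_epoly (A B : comNzRingType) (f : {rmorphism A -> B}) r (w : 'I_r -> A) :
  map_poly f (epoly w) = epoly (f \o w).
Proof.
rewrite rmorphD rmorph1 rmorph_sum; congr (_ + _); apply: eq_bigr => j _.
by rewrite /= map_polyZ map_polyXn.
Qed.

Lemma coef_epoly (A : comNzRingType) r (w : 'I_r -> A) k :
  (epoly w)`_k = if k is k'.+1 then (if insub k' is Some j then w j else 0) else 1.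
Proof.
rewrite coefD coef1 coef_sum; case: k => [|k].
  by rewrite big1 ?addr0 // => j _; rewrite coefZ coefXn mulr0.
rewrite add0r; case: insubP => [j hj <-|hk].
  rewrite (bigD1 j) //= coefZ coefXn eqxx mulr1 big1 ?addr0 // => i hi.
  by rewrite coefZ coefXn eqSS (inj_eq val_inj) eq_sym (negbTE hi) mulr0.
rewrite big1 // => j _; rewrite coefZ coefXn eqSS; case: eqP => [E|]; last by rewrite mulr0.
by rewrite E ltn_ord in hk.
Qed.

Lemma epoly_mesym r :
  epoly (fun j : 'I_r => mesym r rat j.+1) = \prod_(j < r) (1 + 'X_j *: 'X).
Proof.
rewrite (eq_bigr (fun j => 'X_j *: 'X + 1)) => [|j _]; last by rewrite addrC.
rewrite bigA_distr; apply/polyP => k; rewrite coef_sum coef_epoly.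
have E (h : {set 'I_r}) :
    (\prod_i (if i \in h then 'X_i *: 'X else 1 : {poly {mpoly rat[r]}}))`_k
   = if #|h| == k then \prod_(i in h) 'X_i else 0.
  rewrite -big_mkcond /= scaler_prod prodr_const coefZ coefXn eq_sym.
  by case: eqP => _; rewrite ?mulr0 ?mulr1.
rewrite (eq_bigr _ (fun h _ => E h)) -big_mkcond /= -/(mesym r rat k).
case: k {E} => [|k]; first by rewrite mesym0E.
case: insubP => [j hj <-|hk] //.
by rewrite mesym_geqnE // ltnS leqNgt.
Qed.

(** At the elementary symmetric polynomials the right side becomes [pscoef] of a product of linear
    factors, that is the power sum; uniqueness of F_r does the rest. *)
Lemma FpolyE r : Fpoly n r = pscoef (epoly (fun j : 'I_r => 'X_j)).
Proof.
apply/esym/Fpoly_uniq; rewrite pscoef_map map_epoly.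
have -> : epoly (comp_mpoly [tuple mesym r rat j.+1 | j < r] \o (fun j : 'I_r => 'X_j))
   = epoly (fun j : 'I_r => mesym r rat j.+1).
  congr (_ + _); apply: eq_bigr => j _; congr (_ *: _).
  by rewrite /= comp_mpolyXU -tnth_nth tnth_mktuple.
by rewrite epoly_mesym pscoef_prod.
Qed.

Lemma pevalE (W : finType) r (w : 'I_r -> amb W) :
  peval (Fpoly n r) w = pscoef (epoly w).
Proof.
rewrite FpolyE -[LHS]/(mmap (@mpolyC _ rat) w _) (pscoef_map (mmap (@mpolyC _ rat) w)).
rewrite map_epoly; congr (pscoef (_ + _)); apply: eq_bigr => j _; congr (_ *: _).
by rewrite /= mmapX mmap1U.
Qed.
End LogarithmicDerivative.

(** * Additivity, weights and derivatives of F *)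

Section PowerSums.
Variables (n : nat).

Lemma epoly_ev (E : finType) p q (x y : E) :
  epoly (fun j : 'I_(p + q) => ev n p q x y j) =
  epoly (fun j : 'I_p => xv n x j) * epoly (fun j : 'I_q => xv n y j).
Proof.
have X r (z : E) k : (epoly (fun j : 'I_r => xv n z j))`_k = xs n r z k.
  rewrite coef_epoly; case: k => // k /=.
  by case: insubP => [j hj <-|/negbTE ->] //; rewrite ltn_ord.
apply/polyP => k; rewrite coefM coef_epoly.
under [RHS]eq_bigr do rewrite !X.
case: k => [|k]; first by rewrite big_ord1 /= mulr1.
case: insubP => [j hj <-|hk] //.
rewrite big1 // => -[a ha] _ /=.
case: a ha => [|a] ha; first by rewrite subn0 /= ifN ?mulr0 //; lia.
rewrite subSS /xs; case: ifP => [h1|_]; last by rewrite mul0r.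
have -> : (k - a = (k - a.+1).+1)%N by lia.
by rewrite ifN ?mulr0 //; lia.
Qed.

(** The generating polynomial of the e_j(x, y) is the product of those of x and y, and [pscoef] is
    additive; hence the potential of a vertex splits as a sum over its three ends. *)
Lemma peval_ev (E : finType) p q (x y : E) :
  peval (Fpoly n (p + q)) (fun j => ev n p q x y j) = Fat n p x + Fat n q y.
Proof.
rewrite /Fat !pevalE epoly_ev pscoefM // coef_epoly //.
Qed.

Section Weights.
Variables (k : nat) (ww : 'I_k -> nat) (s : nat).
(** Homogeneity when X is given weight -s. It is used with s = 1 for the arguments of F_r and with s
    = 2 for named variables. *)
Definition ghomog (P : {poly {mpoly rat[k]}}) : Prop :=
  forall j, phomog ww (s * j)%:Z P`_j.

Lemma ghomog1 : ghomog 1.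
Proof.
move=> j; rewrite coef1; case: j => [|j]; first by rewrite muln0; apply: (phomogC _ 1).
exact: phomog0.
Qed.
Lemma ghomogB P Q : ghomog P -> ghomog Q -> ghomog (P - Q).
Proof. by move=> hP hQ j; rewrite coefB phomogB. Qed.
Lemma ghomogM P Q : ghomog P -> ghomog Q -> ghomog (P * Q).
Proof.
move=> hP hQ j; rewrite coefM; apply: phomog_sum => i _.
have -> : (s * j)%:Z = (s * i)%:Z + (s * (j - i))%:Z.
  by rewrite -PoszD -mulnDr subnKC // -ltnS.
exact: phomogM.
Qed.
Lemma ghomog_geo P : ghomog P -> ghomog (geo n P).
Proof.
move=> hP j; rewrite coef_sum; apply: phomog_sum => i _.
elim: (i : nat) j => [|d IH] j; first by rewrite expr0; apply: ghomog1.
by rewrite exprS; apply: ghomogM => //; apply: ghomogB => //; apply: ghomog1.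
Qed.
Lemma phomog_pscoef P : ghomog P -> phomog ww (s * n.+1)%:Z (pscoef n P).
Proof.
move=> hP; have h : ghomog (logd n P).
  apply: ghomogM; last exact: ghomog_geo.
  move=> [|j]; rewrite coefXM /=; first exact: phomog0.
  by rewrite coef_deriv -scaler_nat -mul_mpolyC -[_%:Z]add0r phomogM ?phomogC.
rewrite /pscoef -signr_odd; case: odd.
  by rewrite expr1 mulN1r; apply: phomogN; apply: h.
by rewrite expr0 mul1r; apply: h.
Qed.
End Weights.

Lemma phomog_Fpoly r : phomog (fun j : 'I_r => j.+1) n.+1%:Z (Fpoly n r).
Proof.
rewrite FpolyE -[n.+1]mul1n; apply: phomog_pscoef => j; rewrite mul1n coef_epoly.
case: j => [|j]; first exact: (phomogC _ 1).
case: insubP => [i _ <-|_]; last exact: phomog0.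
exact: (phomogX (fun j : 'I_r => j.+1)).
Qed.

Lemma Fpoly_wt r (m : 'X_{1..r}) : m \in msupp (Fpoly n r) ->
  (\sum_(l < r) m l * l.+1 = n.+1)%N.
Proof.
rewrite mcoeff_msupp; move/phomogP: (phomog_Fpoly r) => /[apply] h.
by apply/eqP; rewrite -eqz_nat -h.
Qed.

Section Derivative.
Variables (r : nat) (j : 'I_r).
Local Notation A := {mpoly rat[r]}.
Local Notation D := (map_poly (mderiv j) : {poly A} -> {poly A}).
Local Notation E := (epoly (fun l : 'I_r => 'X_l : A)).
Local Notation C := (geo n E).

Let DM (p q : {poly A}) : D (p * q) = D p * q + p * D q.
Proof.
apply/polyP => k; rewrite coef_map /= coefD !coefM raddf_sum -big_split.
by apply: eq_bigr => i _; rewrite !coef_map /= mderivM.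
Qed.

Let DX k : D 'X^k = 0.
Proof.
apply/polyP => l; rewrite coef_map /= coefXn coef0 -mpolyC_nat.
by rewrite mderivC.
Qed.

Let D1 : D 1 = 0.
Proof. by rewrite -(expr0 'X) DX. Qed.

Let DE : D E = 'X^(j.+1).
Proof.
apply/polyP => k; rewrite coef_map /= coef_epoly coefXn.
case: k => [|k]; first by rewrite /= -[1]mpolyC1 mderivC.
rewrite eqSS; case: insubP => [l _ <-|hk] /=.
  rewrite mderivX mnm1E (inj_eq val_inj); have [->|_] := eqVneq l j.
    have -> : (U_(j) - U_(j))%MM = 0%MM :> 'X_{1..r}.
      by apply/mnmP => i; rewrite mnmBE subnn mnm0E.
    by rewrite scale1r mpolyX0.
  by rewrite scale0r.
rewrite mderiv0; case: eqP => // e.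
by rewrite e ltn_ord in hk.
Qed.

Let Dderiv (p : {poly A}) : D p^`() = (D p)^`().
Proof. by apply/polyP => k; rewrite !(coef_map, coef_deriv) /= raddfMn. Qed.

Let E0 : E`_0 = 1.
Proof. by rewrite coef_epoly. Qed.

(** Apply [D] to E C = 1, using D E = X^(j+1), and multiply by C. *)
Let DC : eqX n (D C) (- 'X^(j.+1) * (C * C)).
Proof.
have [h hE] := geo_inv n E0.
have := congr1 D hE; rewrite raddfD /= (DM E C) (DM h) DE DX D1 mulr0 addr0 add0r => H.
apply: (eqX_trans (q := C * (E * D C))).
  apply: eqX_sym; rewrite (_ : C * (E * D C) = D C * (E * C)); last by ring.
  by rewrite -[X in eqX _ _ X]mulr1; apply: eqXM; apply: geo_inv E0.
exists (C * D h).
have -> : E * D C = D h * 'X^(n.+2) - 'X^(j.+1) * C by rewrite -H; ring.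
by ring.
Qed.

(** Differentiating the congruence E C = 1 with respect to X loses one order; the extra factor X
    restores it. *)
Let XEC : eqX n ('X * E^`() * (C * C)) (- ('X * C^`())).
Proof.
have [h hE] := geo_inv n E0.
have := congr1 deriv hE; rewrite derivD (derivM E C) (derivM h) derivXn derivC add0r => H.
apply: (eqX_trans (q := - ('X * C^`() * (E * C)))).
  exists (C * ('X * h^`() + h *+ n.+2)).
  have -> : 'X * E^`() * (C * C) = C * ('X * (E^`() * C + E * C^`()))
     - 'X * C^`() * (E * C) by ring.
  rewrite H; have -> : 'X^(n.+2) = 'X * 'X^(n.+1) :> {poly A} by rewrite exprS.
  by rewrite [n.+2.-1]/=; ring.
rewrite -mulNr -[X in eqX _ _ X]mulr1 -mulNr; apply: eqXM; exact: geo_inv E0.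
Qed.

(** Modulo X^(n+2), [D] maps X E' C to X^(j+1) ((j+1) C + X C'). In degree n+1 the two terms give
    j+1 times and n-j times the coefficient of C in degree n-j, hence n+1 times in all. *)
Lemma mderiv_pscoef : (j <= n)%N ->
  mderiv j (pscoef n E) = (-1) ^+ n * C`_(n - j) *+ n.+1.
Proof.
move=> hj; rewrite /pscoef -signr_odd.
have -> : mderiv j ((-1) ^+ odd n * (logd n E)`_n.+1) =
    (-1) ^+ odd n * (D (logd n E))`_n.+1.
  by rewrite coef_map; case: odd; rewrite ?expr0 ?expr1 ?mul1r ?mulN1r ?mderivN.
rewrite signr_odd -mulrnAr; congr (_ * _).
transitivity ('X^(j.+1) * (C *+ j.+1 + 'X * C^`()))`_n.+1; last first.
  rewrite coefXnM ltnNge ltnS hj /= subSS coefD coefMn coefXM coef_deriv.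
  case: (n - j)%N (subnKC hj) => [|d] E' /=; first by rewrite addr0; congr (_ *+ _); lia.
  by rewrite -mulrnDr; congr (_ *+ _); lia.
apply: (eqX_coef (n := n)) => //.
rewrite /logd (DM ('X * _)) (DM 'X) -(expr1 'X) DX mul0r add0r expr1 Dderiv DE derivXn /=.
apply: (eqX_trans (q := 'X * ('X^j *+ j.+1) * C + 'X * E^`() * (- 'X^(j.+1) * (C * C)))).
  apply: eqXD; [by exists 0; rewrite mul0r addr0 | exact/eqXM/DC].
rewrite mulrDr; apply: eqXD.
  by exists 0; rewrite mul0r addr0 exprS !mulrnAr mulrnAl; ring.
have := eqXM (- 'X^(j.+1)) XEC.
by rewrite mulrNN; congr eqX; ring.
Qed.
End Derivative.

Lemma peval_mderiv (W : finType) r (j : 'I_r) (w : 'I_r -> amb W) : (j <= n)%N ->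
  peval (Fpoly n r)^`M(j) w = (-1) ^+ n * (geo n (epoly w))`_(n - j) *+ n.+1.
Proof.
move=> hj; rewrite FpolyE mderiv_pscoef // -[LHS]/(mmap (@mpolyC _ rat) w _).
rewrite rmorphMn rmorphM rmorph_sign -coef_map map_geo map_epoly.
congr (_ * (geo n (_ + _))`__ *+ _); apply: eq_bigr => l _; congr (_ *: _).
by rewrite /= mmapX mmap1U.
Qed.

(** Closing a line into a circle equates the two arguments of each divided difference, and so turns
    the first entries into partial derivatives. *)
Lemma ddiff_diag (W : finType) r (G : {mpoly rat[r]}) (j : 'I_r) (w : 'I_r -> amb W) :
  ddiff G j w (w j) (w j) = peval G^`M(j) w.
Proof.
rewrite /ddiff [X in peval (mderiv _ X)]mpolyE raddf_sum /=.
rewrite /peval raddf_sum /=; apply: eq_bigr => m _.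
rewrite mderivZ mderivX /= !mmapZ mmapX -mul_mpolyC; congr (_ * _).
have -> : \sum_(k < m j) w j ^+ ((m j).-1 - k) * w j ^+ k = w j ^+ (m j).-1 *+ m j.
  rewrite (eq_bigr (fun=> w j ^+ (m j).-1)) => [|k _].
    by rewrite sumr_const card_ord.
  by rewrite -exprD subnK // -ltnS (ltn_predK (ltn_ord k)).
rewrite rmorph_nat mulr_natl mulrnAr /mmap1 [in RHS](bigD1 j (P := predT)) //=.
rewrite mnmBE mnm1E eqxx subn1 mulrC; congr (_ * _ *+ _).
apply: eq_bigr => l hl; rewrite mnmBE mnm1E eq_sym (negbTE hl) subn0 //.
Qed.
End PowerSums.

(** * The Koszul products attached to lines and vertices *)

Section Telescopes.
Variables (n : nat) (E : finType).
Local Notation V := (nvar n E).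
Local Notation wt := (@nwt n E).
Implicit Types (S T : {set V}).

Lemma supportedD S (p q : amb V) : supported S p -> supported S q -> supported S (p + q).
Proof. exact: rpredD. Qed.
Lemma supportedB S (p q : amb V) : supported S p -> supported S q -> supported S (p - q).
Proof. exact: rpredB. Qed.
Lemma supportedM S (p q : amb V) : supported S p -> supported S q -> supported S (p * q).
Proof. exact: rpredM. Qed.
Lemma supportedXn S (p : amb V) k : supported S p -> supported S (p ^+ k).
Proof. exact: rpredX. Qed.
Lemma supported_sum S I (r : seq I) (P : pred I) (F : I -> amb V) :
  (forall i, P i -> supported S (F i)) -> supported S (\sum_(i <- r | P i) F i).
Proof. exact: rpred_sum. Qed.
Lemma supported_prod S I (r : seq I) (P : pred I) (F : I -> amb V) :
  (forall i, P i -> supported S (F i)) -> supported S (\prod_(i <- r | P i) F i).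
Proof. exact: rpred_prod. Qed.

Lemma supported_ddiff S r (G : {mpoly rat[r]}) j (w : 'I_r -> amb V) a b :
  (forall l, supported S (w l)) -> supported S a -> supported S b ->
  supported S (ddiff G j w a b).
Proof.
move=> hw ha hb; apply: supported_sum => m _; apply/supportedZ/supportedM.
  by apply: supported_prod => l _; apply: supportedXn.
by apply: supported_sum => k _; apply: supportedM; apply: supportedXn.
Qed.

Lemma supported_peval S r (G : {mpoly rat[r]}) (w : 'I_r -> amb V) :
  (forall l, supported S (w l)) -> supported S (peval G w).
Proof.
move=> hw; apply: supported_sum => m _; apply: supportedM.
  exact: supportedC.
by apply: supported_prod => l _; apply: supportedXn.
Qed.

Lemma subst_ddiff s T r (G : {mpoly rat[r]}) j (w : 'I_r -> amb V) a b :
  subst s T (ddiff G j w a b) =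
  ddiff G j (fun l => subst s T (w l)) (subst s T a) (subst s T b).
Proof.
rewrite [LHS]rmorph_sum; apply: eq_bigr => m _.
rewrite -!mul_mpolyC !rmorphM /= substC rmorph_prod rmorph_sum /=; congr (_ * (_ * _)).
  by apply: eq_bigr => l _; rewrite rmorphXn.
by apply: eq_bigr => k _; rewrite rmorphM !rmorphXn.
Qed.

Lemma subst_peval s T r (G : {mpoly rat[r]}) (w : 'I_r -> amb V) :
  subst s T (peval G w) = peval G (fun l => subst s T (w l)).
Proof.
rewrite [LHS]rmorph_sum; apply: eq_bigr => m _.
rewrite rmorphM /= substC rmorph_prod /=; congr (_ * _).
by apply: eq_bigr => l _; rewrite rmorphXn.
Qed.

Lemma eq_ddiff r (G : {mpoly rat[r]}) j (w w' : 'I_r -> amb V) a b :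
  w =1 w' -> ddiff G j w a b = ddiff G j w' a b.
Proof. by move=> /funext ->. Qed.

Lemma eq_peval r (G : {mpoly rat[r]}) (w w' : 'I_r -> amb V) :
  w =1 w' -> peval G w = peval G w'.
Proof. by move=> /funext ->. Qed.

Lemma ahomog_ddiff r (j : 'I_r) (w : 'I_r -> amb V) a b :
  (forall l : 'I_r, ahomog wt (2 * l.+1)%N%:Z (w l)) ->
  ahomog wt (2 * j.+1)%N%:Z a -> ahomog wt (2 * j.+1)%N%:Z b ->
  ahomog wt ((2 * n.+1)%N%:Z - (2 * j.+1)%N%:Z) (ddiff (Fpoly n r) j w a b).
Proof.
move=> hw ha hb; rewrite /ddiff big_seq; apply: ahomog_sum => m /Fpoly_wt hm.
apply: ahomogZ.
(* If the argument [j] does not occur in the monomial, the difference quotient is an empty sum; the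
   degree count below needs the predecessor of a positive exponent. *)
have [mj|mj] := posnP (m j).
  rewrite [X in _ * X]big1 ?mulr0 ?ahomog0 // => -[k hk] _.
  by exfalso; rewrite mj in hk.
have hd : (2 * n.+1)%N%:Z - (2 * j.+1)%N%:Z =
    \sum_(l < r | l != j) (2 * l.+1)%N%:Z *+ m l + (2 * j.+1)%N%:Z *+ (m j).-1.
  have -> : (2 * n.+1)%N%:Z = \sum_(l < r) (2 * l.+1)%N%:Z *+ m l.
    rewrite -hm big_distrr /= (big_morph Posz PoszD (erefl _)).
    by apply: eq_bigr => l _; rewrite -mulr_natr natz -PoszM mulnCA mulnC.
  rewrite (bigD1 j) //= -[in _ *+ m j](prednK mj) mulrS; ring.
rewrite hd; apply: ahomogM.
  by apply: ahomog_prod => l _; apply: ahomogXn.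
apply: ahomog_sum => -[k hk] _ /=.
have -> : (2 * j.+1)%N%:Z *+ (m j).-1 =
    (2 * j.+1)%N%:Z *+ ((m j).-1 - k) + (2 * j.+1)%N%:Z *+ k.
  by rewrite -mulrnDr subnK // -ltnS (prednK mj).
by apply: ahomogM; apply: ahomogXn.
Qed.

Lemma ahomog_peval r (w : 'I_r -> amb V) :
  (forall l : 'I_r, ahomog wt (2 * l.+1)%N%:Z (w l)) ->
  ahomog wt (2 * n.+1)%N%:Z (peval (Fpoly n r) w).
Proof.
move=> hw; rewrite /peval /mmap big_seq; apply: ahomog_sum => m /Fpoly_wt hm.
rewrite mul_mpolyC; apply: ahomogZ.
have -> : (2 * n.+1)%N%:Z = \sum_(l < r) (2 * l.+1)%N%:Z *+ m l.
  rewrite -hm big_distrr /= (big_morph Posz PoszD (erefl _)).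
  by apply: eq_bigr => l _; rewrite -mulr_natr natz -PoszM mulnCA mulnC.
by apply: ahomog_prod => l _; apply: ahomogXn.
Qed.

Section OneTelescope.
Variables (r : nat) (u v : nat -> amb V).

Definition tmix (j : 'I_r) : 'I_r -> amb V :=
  fun l : 'I_r => if (l < j)%N then v l else u l.
Definition tfirst T j : Qs T :=
  inQ T (ddiff (Fpoly n r) j (tmix j) (u j) (v j)).
Definition tsecond T (j : 'I_r) : Qs T := inQ T (u j - v j).
Definition tda (j : 'I_r) : int := (2 * n.+1)%N%:Z - (2 * j.+1)%N%:Z.
Definition tdb (j : 'I_r) : int := (2 * j.+1)%N%:Z.

Lemma telescopeE T :
  telescope T r u v = kfold (tfirst T) (tsecond T) tda tdb (enum 'I_r).
Proof. by []. Qed.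

Lemma tdaD j : tda j + tdb j = n.+1%:Z + n.+1%:Z.
Proof. by rewrite /tda /tdb; lia. Qed.

Section Support.
Variable T : {set V}.
Hypothesis hu : forall j : 'I_r, supported T (u j).
Hypothesis hv : forall j : 'I_r, supported T (v j).

Lemma supported_tfirst j :
  supported T (ddiff (Fpoly n r) j (tmix j) (u j) (v j)).
Proof. by apply: supported_ddiff => // l; rewrite /tmix; case: ifP. Qed.

Lemma qval_tfirst j :
  qval (tfirst T j) = ddiff (Fpoly n r) j (tmix j) (u j) (v j).
Proof. by apply/inQ_val/supported_tfirst. Qed.
Lemma qval_tsecond j : qval (tsecond T j) = u j - v j.
Proof. by apply/inQ_val/supportedB. Qed.

Lemma sum_telescope :
  qval (\sum_(j <- enum 'I_r) tfirst T j * tsecond T j) =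
  peval (Fpoly n r) (fun j => u j) - peval (Fpoly n r) (fun j => v j).
Proof.
rewrite qval_sum big_enum /=.
(* [H k] has its first k arguments taken from [v] and the others from [u]; the factor j contributes
   the difference of F at [H j] and [H j.+1]. *)
pose H k : 'I_r -> amb V := fun l : 'I_r => if (l < k)%N then v l else u l.
transitivity (\sum_(j < r) (peval (Fpoly n r) (H j) - peval (Fpoly n r) (H j.+1))).
  apply: eq_bigr => j _; rewrite (subst_id (supported_tfirst j)).
  rewrite (subst_id (supportedB (hu j) (hv j))) mulrC ddiffP; congr (_ - _); apply: eq_peval => l; rewrite /upd /tmix /H.
    by case: eqP => [->|_] //; rewrite ltnn.
  case: eqP => [->|hl]; first by rewrite ltnSn.
  rewrite ltnS [(l <= j)%N]leq_eqVlt.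
  by case: eqP => // h; case: hl; apply: val_inj.
rewrite -(big_mkord xpredT (fun j => peval (Fpoly n r) (H j) - peval (Fpoly n r) (H j.+1))).
rewrite (eq_bigr (fun j => (- peval (Fpoly n r) (H j.+1)) - (- peval (Fpoly n r) (H j)))).
  rewrite (telescope_sumr (fun j => - peval (Fpoly n r) (H j))) // opprK addrC.
  by congr (_ - _); apply: eq_peval => l; rewrite /H ?ltn_ord.
by move=> j _; rewrite opprK addrC.
Qed.

Lemma mfpot_telescope : mfpot (telescope T r u v)
  (inQ T (peval (Fpoly n r) (fun j => u j) - peval (Fpoly n r) (fun j => v j))).
Proof.
rewrite telescopeE; have := mfpot_kfold (tfirst T) (tsecond T) tda tdb (enum 'I_r).
congr mfpot; apply: val_inj; rewrite [LHS]sum_telescope /= subst_id //.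
by apply: supportedB; apply: supported_peval.
Qed.

Hypothesis wu : forall j : 'I_r, ahomog wt (2 * j.+1)%N%:Z (u j).
Hypothesis wv : forall j : 'I_r, ahomog wt (2 * j.+1)%N%:Z (v j).

Lemma whomog_tfirst j : whomog wt (tda j) (tfirst T j).
Proof.
rewrite -[whomog _ _ _]/(ahomog wt _ (qval _)) qval_tfirst.
by apply: ahomog_ddiff => // l; rewrite /tmix; case: ifP.
Qed.
Lemma whomog_tsecond j : whomog wt (tdb j) (tsecond T j).
Proof.
by rewrite -[whomog _ _ _]/(ahomog wt _ (qval _)) qval_tsecond; apply: ahomogB;
  [apply: wu | apply: wv].
Qed.

Lemma fhomog_telescope : fhomog wt n.+1%:Z (telescope T r u v).
Proof.
rewrite telescopeE; apply: fhomog_kfold.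
- exact: tdaD.
- exact: whomog_tfirst.
- exact: whomog_tsecond.
Qed.
End Support.
End OneTelescope.

Lemma psubst_inQ s S T (p p' : amb V) :
  supported S p -> subst s T p = p' -> psubst s T (inQ S p) = inQ T p'.
Proof.
move=> hp hE; apply: val_inj; rewrite /= (subst_id hp) hE subst_id //.
by rewrite -hE subst_supported.
Qed.

Lemma ff_map_telescope s S T r (u v u' v' : nat -> amb V) :
  (forall j : 'I_r, supported S (u j)) -> (forall j : 'I_r, supported S (v j)) ->
  (forall j : 'I_r, subst s T (u j) = u' j) ->
  (forall j : 'I_r, subst s T (v j) = v' j) ->
  ff_map (psubst s T) (telescope S r u v) = telescope T r u' v'.
Proof.
move=> hu hv eu ev; rewrite !telescopeE ff_map_kfold; congr kfold.
- apply/funext => j /=; apply: psubst_inQ; first exact: supported_tfirst.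
  rewrite subst_ddiff eu ev; apply: eq_ddiff => l; rewrite /tmix.
  by case: ifP; rewrite ?eu ?ev.
- apply/funext => j /=; apply: psubst_inQ; first exact: supportedB.
  by rewrite rmorphB /= eu ev.
Qed.
End Telescopes.

(** * Essential pieces over an arbitrary ring of variables *)

Section Pieces.
Variables (n : nat) (E : finType).
Local Notation V := (nvar n E).
Local Notation wt := (@nwt n E).
Implicit Types (S T : {set V}) (P : piece E) (d : E * nat).

Lemma evarsP d (v : V) : (v \in evars n d) = (v.1 == d.1) && (v.2 < d.2)%N.
Proof. by rewrite inE. Qed.

Lemma lvarsP (s : seq (E * nat)) (v : V) :
  reflect (exists2 d, d \in s & (v.1 = d.1) /\ (v.2 < d.2)%N) (v \in lvars n s).
Proof.
rewrite /lvars; elim: s => [|d s IH].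
  by rewrite big_nil in_set0; constructor; case.
rewrite big_cons in_setU evarsP; apply: (iffP orP).
  case=> [/andP[/eqP h1 h2]|/IH[d' h1 h2]]; first by exists d; rewrite ?mem_head.
  by exists d' => //; rewrite in_cons h1 orbT.
move=> [d' +[h1 h2]]; rewrite in_cons => /predU1P[E'|h].
  by left; rewrite -E' h1 eqxx.
by right; apply/IH; exists d'.
Qed.

Lemma lvars_cat s t : lvars n (s ++ t) = lvars n s :|: lvars n t :> {set V}.
Proof. by rewrite /lvars big_cat. Qed.

Lemma evars_lvars (s : seq (E * nat)) d : d \in s -> evars n d \subset lvars n s.
Proof.
move=> h; apply/subsetP => v; rewrite evarsP => /andP[/eqP h1 h2].
by apply/lvarsP; exists d.
Qed.

Lemma supported_xv T e c j : evars n (e, c) \subset T -> (j < c)%N ->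
  supported T (xv n e j).
Proof.
move=> hT hj; rewrite /xv; case: insubP => [k _ hk|_]; last exact: (rpred0 (supported T)).
by apply/supportedX/(subsetP hT); rewrite evarsP /= eqxx hk.
Qed.

Lemma supported_xs T p x a : evars n (x, p) \subset T -> supported T (xs n p x a).
Proof.
move=> hT; rewrite /xs; case: a => [|a]; first exact: (supportedC T 1).
by case: ifP => h; [apply: supported_xv hT h | exact: (rpred0 (supported T))].
Qed.

Lemma supported_ev T p q x y j :
  evars n (x, p) \subset T -> evars n (y, q) \subset T ->
  supported T (ev n p q x y j).
Proof.
by move=> hx hy; apply: supported_sum => a _; apply: supportedM; apply: supported_xs.
Qed.

Lemma ahomog_xv e j : ahomog wt (2 * j.+1)%N%:Z (xv n e j).
Proof.
rewrite /xv; case: insubP => [k _ <-|_]; last exact: ahomog0.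
exact: (ahomogX (@nwt n E) (e, k)).
Qed.

Lemma ahomog_xs p x a : ahomog wt (2 * a)%N%:Z (xs n p x a).
Proof.
rewrite /xs; case: a => [|a]; first by rewrite muln0; apply: (ahomogC _ 1).
by case: ifP => _; [apply: ahomog_xv | apply: ahomog0].
Qed.

Lemma ahomog_ev p q x y j : ahomog wt (2 * j.+1)%N%:Z (ev n p q x y j).
Proof.
apply: ahomog_sum => -[a ha] _ /=.
have -> : (2 * j.+1)%N%:Z = (2 * a)%N%:Z + (2 * (j.+1 - a))%N%:Z.
  by rewrite -PoszD -mulnDr subnKC // -ltnS.
by apply: ahomogM; apply: ahomog_xs.
Qed.

Lemma ahomog_Fat c e : ahomog wt (2 * n.+1)%N%:Z (Fat n c e).
Proof. by apply: ahomog_peval => l; apply: ahomog_xv. Qed.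

Lemma supported_Fat T c e : evars n (e, c) \subset T -> supported T (Fat n c e).
Proof. by move=> hT; apply: supported_peval => l; apply: supported_xv hT _. Qed.

Section Renamed.
Variables (s : V -> V) (f : E -> E) (T' : {set V}).
Definition renames d : Prop := forall k : 'I_n, (k < d.2)%N ->
  s (d.1, k) = (f d.1, k) /\ (f d.1, k) \in T'.

Lemma subst_xv e c j : renames (e, c) -> (j < c)%N ->
  subst s T' (xv n e j) = xv n (f e) j.
Proof.
move=> h hj; rewrite /xv; case: insubP => [k _ hk|_]; last by rewrite rmorph0.
by rewrite substX; have [|-> ->] := h k; rewrite ?hk.
Qed.

Lemma subst_xs p x a : renames (x, p) -> subst s T' (xs n p x a) = xs n p (f x) a.
Proof.
move=> h; rewrite /xs; case: a => [|a]; first by rewrite rmorph1.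
by case: ifP => h'; [rewrite (subst_xv h) | rewrite rmorph0].
Qed.

Lemma subst_ev p q x y j : renames (x, p) -> renames (y, q) ->
  subst s T' (ev n p q x y j) = ev n p q (f x) (f y) j.
Proof.
move=> hx hy; rewrite [LHS]rmorph_sum; apply: eq_bigr => a _.
by rewrite rmorphM /= !subst_xs.
Qed.

Lemma subst_Fat c e : renames (e, c) -> subst s T' (Fat n c e) = Fat n c (f e).
Proof.
by move=> h; rewrite /Fat subst_peval; apply: eq_peval => l; rewrite (subst_xv h).
Qed.
End Renamed.

Definition apfact T P : ffact T :=
  match P with
  | Line i x y => telescope T i (xv n x) (xv n y)
  | Merge p q x y z => telescope T (p + q) (xv n z) (ev n p q x y)
  | Defs.Split p q x y z =>
      ff_shift (- (p * q)%N%:Z) (telescope T (p + q) (ev n p q x y) (xv n z))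
  end.

Definition prelabel (f : E -> E) P : piece E :=
  match P with
  | Line i a b => Line i (f a) (f b)
  | Merge p q a b c => Merge p q (f a) (f b) (f c)
  | Defs.Split p q a b c => Defs.Split p q (f a) (f b) (f c)
  end.

Definition pends P := pouts P ++ pins P.

Lemma pvarsE P : pvars n P = lvars n (pends P).
Proof. by []. Qed.

Lemma ff_map_apfact s f T T' P :
  pvars n P \subset T -> (forall d, d \in pends P -> renames s f T' d) ->
  ff_map (psubst s T') (apfact T P) = apfact T' (prelabel f P).
Proof.
move=> hT hr.
have hd d : d \in pends P -> evars n d \subset T.
  by move=> h; apply: subset_trans hT; apply: evars_lvars.
case: P hT hr hd => [i x y|p q x y z|p q x y z] _ hr hd /=.
- have hx : (x, i) \in pends (Line i x y) by rewrite !inE eqxx.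
  have hy : (y, i) \in pends (Line i x y) by rewrite !inE eqxx ?orbT.
  apply: ff_map_telescope => j.
  + exact: supported_xv (hd _ hx) _.
  + exact: supported_xv (hd _ hy) _.
  + exact: subst_xv (hr _ hx) _.
  + exact: subst_xv (hr _ hy) _.
- have hz : (z, (p + q)%N) \in pends (Merge p q x y z) by rewrite !inE eqxx.
  have hx : (x, p) \in pends (Merge p q x y z) by rewrite !inE eqxx ?orbT.
  have hy : (y, q) \in pends (Merge p q x y z) by rewrite !inE eqxx ?orbT.
  apply: ff_map_telescope => j.
  + exact: supported_xv (hd _ hz) _.
  + exact: supported_ev (hd _ hx) (hd _ hy).
  + exact: subst_xv (hr _ hz) _.
  + exact: subst_ev (hr _ hx) (hr _ hy).
- have hz : (z, (p + q)%N) \in pends (Defs.Split p q x y z) by rewrite !inE eqxx ?orbT.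
  have hx : (x, p) \in pends (Defs.Split p q x y z) by rewrite !inE eqxx ?orbT.
  have hy : (y, q) \in pends (Defs.Split p q x y z) by rewrite !inE eqxx ?orbT.
  rewrite -[LHS]/(ff_shift _ (ff_map (psubst s T') (telescope T (p + q) _ _))).
  congr ff_shift; apply: ff_map_telescope => j.
  + exact: supported_ev (hd _ hx) (hd _ hy).
  + exact: supported_xv (hd _ hz) _.
  + exact: subst_ev (hr _ hx) (hr _ hy).
  + exact: subst_xv (hr _ hz) _.
Qed.

(** All ends are counted, glued ones included. This makes the sum additive over pieces; the glued
    ends cancel afterwards, in [potentialE]. *)
Definition dpot (outs ins : seq (E * nat)) : amb V :=
  \sum_(d <- outs) Fat n d.2 d.1 - \sum_(d <- ins) Fat n d.2 d.1.

Lemma mfpot_apfact T P : pvars n P \subset T ->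
  mfpot (apfact T P) (inQ T (dpot (pouts P) (pins P))).
Proof.
move=> hT; have hd d : d \in pends P -> evars n d \subset T.
  by move=> h; apply: subset_trans hT; apply: evars_lvars.
have key r (u v : nat -> amb V) a b : (forall j : 'I_r, supported T (u j)) ->
    (forall j : 'I_r, supported T (v j)) ->
    peval (Fpoly n r) (fun j => u j) = a -> peval (Fpoly n r) (fun j => v j) = b ->
    mfpot (telescope T r u v) (inQ T (a - b)).
  by move=> hu hv <- <-; apply: mfpot_telescope.
case: P {hT} hd => [i x y|p q x y z|p q x y z] hd;
  rewrite /dpot /= !big_cons !big_nil ?addr0 /=.
- apply: key => // j; apply: supported_xv (ltn_ord j); apply: hd.
    by rewrite !inE eqxx.
  by rewrite !inE eqxx ?orbT.
- apply: key => [j|j||] //; last exact: peval_ev.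
    by apply: supported_xv (ltn_ord j); apply: hd; rewrite !inE eqxx.
  by apply: supported_ev; apply: hd; rewrite !inE eqxx ?orbT.
- apply: mfpot_shift; apply: key => [j|j||] //; last exact: peval_ev.
    by apply: supported_ev; apply: hd; rewrite !inE eqxx ?orbT.
  by apply: supported_xv (ltn_ord j); apply: hd; rewrite !inE eqxx ?orbT.
Qed.

Lemma fhomog_apfact T P : pvars n P \subset T -> fhomog wt n.+1%:Z (apfact T P).
Proof.
move=> hT; have hd d : d \in pends P -> evars n d \subset T.
  by move=> h; apply: subset_trans hT; apply: evars_lvars.
case: P {hT} hd => [i x y|p q x y z|p q x y z] hd /=; try apply: fhomog_shift;
  apply: fhomog_telescope => j;
  try (by apply: ahomog_xv); try (by apply: ahomog_ev).
- by apply: supported_xv (ltn_ord j); apply: hd; rewrite !inE eqxx.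
- by apply: supported_xv (ltn_ord j); apply: hd; rewrite !inE eqxx ?orbT.
- by apply: supported_xv (ltn_ord j); apply: hd; rewrite !inE eqxx.
- by apply: supported_ev; apply: hd; rewrite !inE eqxx ?orbT.
- by apply: supported_ev; apply: hd; rewrite !inE eqxx ?orbT.
- by apply: supported_xv (ltn_ord j); apply: hd; rewrite !inE eqxx ?orbT.
Qed.
End Pieces.

(** * Factorizations of diagrams *)

Section DiagramFactorizations.
Variables (n : nat) (E : finType).
Local Notation V := (nvar n E).
Local Notation wt := (@nwt n E).
Implicit Types (S T : {set V}) (G : diagram E) (d : E * nat).

(* C'(G) with all the pieces taken over one ring Q[T]: changes of T and of the
   labels then give equal factorizations, not just isomorphic ones. *)
Fixpoint CF T G : ffact T :=
  if G is P :: G' then tens (apfact T P) (CF T G') else ff_unit T.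

Definition ends G := outs G ++ ins G.

Lemma dvarsE G : dvars n G = lvars n (ends G).
Proof.
rewrite /ends; elim: G => [|P G IH]; first by rewrite /lvars big_nil.
rewrite /= IH pvarsE /pends /outs /ins /= -/(outs G) -/(ins G) !lvars_cat.
by rewrite -!setUA; congr (_ :|: _); rewrite setUCA.
Qed.

Lemma ff_map_CF s f T T' G :
  dvars n G \subset T -> (forall d, d \in ends G -> renames s f T' d) ->
  ff_map (psubst s T') (CF T G) = CF T' [seq prelabel f P | P <- G].
Proof.
elim: G => [|P G IH]; first by move=> _ _; apply: ff_map_unit.
rewrite /= subUset => /andP[hP hG] hr; rewrite ff_map_tens; congr tens.
  apply: ff_map_apfact => // d hd; apply: hr; move: hd.
  by rewrite /ends /pends /outs /ins /= !mem_cat => /orP[] ->; rewrite ?orbT.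
apply: IH => // d hd; apply: hr; move: hd.
by rewrite /ends /outs /ins /= !mem_cat => /orP[] ->; rewrite ?orbT.
Qed.

Lemma prelabel_id G : [seq prelabel id P | P <- G] = G.
Proof. by rewrite -[RHS]map_id; apply: eq_map => -[]. Qed.

Lemma ff_map_CF_emb T T' G : dvars n G \subset T -> dvars n G \subset T' ->
  ff_map (emb T') (CF T G) = CF T' G.
Proof.
move=> hT hT'; rewrite (ff_map_CF (f := id) hT) ?prelabel_id // => d hd k hk.
split=> //; apply: (subsetP hT'); rewrite dvarsE.
by apply/lvarsP; exists d.
Qed.

Lemma CfactE G : Cfact n G = CF (dvars n G) G.
Proof.
elim: G => //= P G IH; rewrite /boxtimes IH; congr tens.
  have hP : pfact n P = apfact (pvars n P) P by case: P.
  rewrite hP (ff_map_apfact (f := id)) //; first by case: (P).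
  move=> d hd k hk; split=> //; rewrite in_setU; apply/orP; left.
  by rewrite pvarsE; apply/lvarsP; exists d.
by apply: ff_map_CF_emb; rewrite // subsetUr.
Qed.

Lemma inQD T p q : inQ T (p + q) = inQ T p + inQ T q.
Proof. by apply: val_inj; rewrite /= rmorphD. Qed.

Lemma supported_dpot T G : dvars n G \subset T ->
  supported T (dpot n (outs G) (ins G)).
Proof.
move=> hT; have h d : d \in ends G -> supported T (Fat n d.2 d.1).
  move=> hd; apply: supported_Fat; rewrite -surjective_pairing.
  by apply: subset_trans hT; rewrite dvarsE; apply: evars_lvars.
apply: supportedB; rewrite big_seq; apply: supported_sum => d hd; apply: h;
  by rewrite mem_cat hd ?orbT.
Qed.

Lemma mfpot_CF T G : dvars n G \subset T ->
  mfpot (CF T G) (inQ T (dpot n (outs G) (ins G))).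
Proof.
elim: G => [_|P G IH] /=.
  rewrite /dpot !big_nil subrr; have := mfpot_unit T; congr mfpot.
  by apply: val_inj; rewrite /= rmorph0.
rewrite subUset => /andP[hP /IH hG].
have := mfpot_tens (mfpot_apfact hP) hG; rewrite -inQD; congr (mfpot _ (inQ T _)).
by rewrite /dpot /outs /ins /= !big_cat /= -/(outs G) -/(ins G); ring.
Qed.

Lemma fhomog_CF T G : dvars n G \subset T -> fhomog wt n.+1%:Z (CF T G).
Proof.
elim: G => [_|P G IH] /=; first exact: fhomog_unit.
by rewrite subUset => /andP[hP /IH hG]; apply: fhomog_tens => //; apply: fhomog_apfact.
Qed.

Lemma is_mf_restr S T (M : ffact T) (v : Qs T) (w : Qs S) : S \subset T ->
  mfpot M v -> v = emb T w -> (exists c : int, whomog wt c w) -> is_mf wt w (restr wt S M).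
Proof.
move=> hST [m0 m1] hv hw.
have H (I : finType) (D : I -> I -> Qs T) (m : restr_free S T I) :
    (forall i i', D i i' = (i == i')%:R * v) -> mxact D m = w *: m.
  move=> hD; apply/ffunP => i; rewrite !ffunE.
  by under eq_bigr do rewrite hD -mulrA; rewrite sum_delta hv.
have C (I J K : finType) (D : J -> I -> Qs T) (D' : K -> J -> Qs T) m :
    mxact (S := S) D' (mxact D m) = mxact (fun k i => \sum_j D' k j * D j i) m.
  apply/ffunP => k; rewrite !ffunE; under eq_bigr do rewrite ffunE mulr_sumr.
  rewrite exchange_big; apply: eq_bigr => i _; rewrite mulr_suml.
  by apply: eq_bigr => j _; rewrite mulrA.
split=> //.
- exact: free_graded_restr.
- exact: free_graded_restr.
- by move=> m; apply: etrans (C _ _ _ _ _ m) _; apply: H => i i'; apply: m0.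
- by move=> m; apply: etrans (C _ _ _ _ _ m) _; apply: H => i i'; apply: m1.
Qed.
End DiagramFactorizations.

Lemma heq_gq_ren_id (V : finType) (wt : V -> nat) (S T U : {set V}) (s : V -> V)
    (hs : renaming_on wt S T s U) (N : ffact T) :
  U = T -> (forall v, v \in T -> s v = v) -> heq (gq (qren hs) N) (restr wt S N).
Proof.
move=> hU; move: hs; rewrite hU => hs hid.
apply: heq_trans (heq_gq_ren hs N) _.
rewrite ff_map_id => [|p]; last by rewrite (@eq_psubst _ _ id) ?psubst_id.
exact: heq_refl.
Qed.

(** * Gluing a line to a boundary end *)

Section Gluing.
Variables (n i : nat) (E : finType) (G : diagram E) (e x1 x2 : E).
Local Notation V := (nvar n E).
Local Notation wt := (@nwt n E).
Hypothesis hi : (1 <= i <= n)%N.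
Hypothesis he : (e, i) \in ends G.
Hypothesis hc : forall c, (e, c) \in ends G -> c = i.
Hypothesis av1 : available G e x1.
Hypothesis av2 : available G e x2.
Hypothesis hx : x1 != x2.

Let f (x : E) l := if l == e then x else l.
Let relabelE x : relabel e x G = [seq prelabel (f x) P | P <- G].
Proof. by []. Qed.

Lemma eq_prelabel (g g' : E -> E) h P :
  (forall d, d \in pends P -> g' (h d.1) = g d.1) ->
  prelabel g' (prelabel h P) = prelabel g P.
Proof.
rewrite /pends; case: P => [c x y|p q x y z|p q x y z] H /=.
- by rewrite (H (x, c)) ?(H (y, c)) // !inE eqxx ?orbT.
- by rewrite (H (x, p)) ?(H (y, q)) ?(H (z, (p + q)%N)) // !inE eqxx ?orbT.
- by rewrite (H (x, p)) ?(H (y, q)) ?(H (z, (p + q)%N)) // !inE eqxx ?orbT.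
Qed.

Lemma map_prelabel_comp (g g' h : E -> E) (H : diagram E) :
  (forall d, d \in ends H -> g' (h d.1) = g d.1) ->
  [seq prelabel g' P | P <- [seq prelabel h P | P <- H]] =
  [seq prelabel g P | P <- H].
Proof.
elim: H => //= P H IH hg; rewrite (eq_prelabel (g := g)) => [|d hd]; last first.
  apply: hg; move: hd.
  by rewrite /ends /pends /outs /ins /= !mem_cat => /orP[] ->; rewrite ?orbT.
rewrite IH // => d hd; apply: hg; move: hd.
by rewrite /ends /outs /ins /= !mem_cat => /orP[] ->; rewrite ?orbT.
Qed.

Lemma ends_prelabel (g : E -> E) (H : diagram E) :
  (outs [seq prelabel g P | P <- H] = [seq (g d.1, d.2) | d <- outs H]) /\
  (ins [seq prelabel g P | P <- H] = [seq (g d.1, d.2) | d <- ins H]).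
Proof.
rewrite /outs /ins; elim: H => //= P H [-> ->].
by rewrite !map_cat; split; congr (_ ++ _); case: P.
Qed.

Let endsE x : ends (relabel e x G) = [seq (f x d.1, d.2) | d <- ends G].
Proof. by rewrite /ends relabelE map_cat; have [-> ->] := ends_prelabel (f x) G. Qed.

Let avail_ne x l c : available G e x -> (l, c) \in ends G -> l != e -> l != x.
Proof.
move=> /orP[/eqP ->|h1 h2 _] //; apply: contraNneq h1 => <-.
by apply/mapP; exists (l, c).
Qed.

Let dvars_relabel x (v : V) : available G e x ->
  (v \in dvars n (relabel e x G)) =
  (v.1 == x) && (v.2 < i)%N ||
  [&& v.1 != e, v.1 != x & v \in dvars n G].
Proof.
move=> av; rewrite !dvarsE endsE; apply/lvarsP/orP.
  move=> [_ /mapP[[l c] hd ->] /= [h1 h2]]; move: h1; rewrite /f.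
  case: eqP => [El|/eqP El] h1.
    by left; rewrite h1 eqxx -(hc (c := c)) // -El.
  right; rewrite h1 El (avail_ne av hd El) /=.
  by apply/lvarsP; exists (l, c).
case=> [/andP[/eqP h1 h2]|/and3P[h1 h2 /lvarsP[[l c] hd [h3 h4]]]].
  exists (x, i) => //; apply/mapP; exists (e, i) => //=.
  by rewrite /f eqxx.
exists (l, c) => //; apply/mapP; exists (l, c) => //=.
by rewrite /= in h3; rewrite /f -h3 (negbTE h1).
Qed.

Let other_vars_sub (v : V) : v \in other_vars n G e -> v.1 != e /\ v \in dvars n G.
Proof.
move=> /lvarsP[d]; rewrite mem_filter => /andP[hd hd'] [h1 h2].
split; first by rewrite h1.
rewrite dvarsE; apply/lvarsP; exists d => //; move: hd'.
by rewrite /ends !mem_cat !mem_filter => /orP[] /andP[_ ->]; rewrite ?orbT.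
Qed.

Let dvars_ne x (v : V) : available G e x -> v.1 != e -> v \in dvars n G -> v.1 != x.
Proof.
move=> av hv; rewrite dvarsE => /lvarsP[[l c] hd [/= h1 h2]].
by rewrite h1 (avail_ne av hd) // -h1.
Qed.

(** The orientation of the distinguished end: false if it points out, the line being L_i(x1; x2),
    and true if it points in, the line being L_i(x2; x1). *)
Variable eps : bool.
Let a := if eps then x2 else x1.
Let b := if eps then x1 else x2.
Local Notation S := (evars n (x1, i) :|: other_vars n G e).
Let T := dvars n (relabel e x2 G) :|: pvars n (Line i a b).

Let inT v : (v \in T) = [|| (v.1 == x1) && (v.2 < i)%N, (v.1 == x2) && (v.2 < i)%N |
   [&& v.1 != e, v.1 != x1, v.1 != x2 & v \in dvars n G]].
Proof.
rewrite /T in_setU dvars_relabel // /pvars /lvars /= !big_cons big_nil setU0 in_setU !evarsP /=.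
have -> : (v.1 == a) && (v.2 < i)%N || (v.1 == b) && (v.2 < i)%N =
   (v.1 == x1) && (v.2 < i)%N || (v.1 == x2) && (v.2 < i)%N.
  by rewrite /a /b; case: eps; rewrite // orbC.
case h3: (v \in dvars n G); rewrite ?andbF ?orbF; last first.
  by rewrite orbCA orbb.
case: (boolP (v.1 == e)) => /= [_|h]; first by rewrite !orbF orbCA orbb.
rewrite (dvars_ne av1 h h3) (dvars_ne av2 h h3) /= !orbT.
by [].
Qed.

Lemma dvars_sub_glued : dvars n (relabel e x2 G) \subset T /\ pvars n (Line i a b) \subset T.
Proof. by rewrite subsetUl subsetUr. Qed.

Lemma boundary_sub_relabel : S \subset dvars n (relabel e x1 G).
Proof.
apply/subsetP => v; rewrite in_setU evarsP dvars_relabel // => /orP[->|/other_vars_sub[h1 h2]] //.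
by rewrite h1 h2 (dvars_ne av1 h1 h2) orbT.
Qed.

Lemma boundary_sub_glued : S \subset T.
Proof.
apply/subsetP => v; rewrite in_setU evarsP inT => /orP[->|/other_vars_sub[h1 h2]] //.
by rewrite h1 h2 (dvars_ne av1 h1 h2) (dvars_ne av2 h1 h2) /= !orbT.
Qed.

Lemma boxtimes_CF : boxtimes (Cfact n (relabel e x2 G)) (line n i a b) =
  tens (CF T (relabel e x2 G)) (apfact T (Line i a b)).
Proof.
have [h1 h2] := dvars_sub_glued.
rewrite /boxtimes CfactE; congr tens; first exact: ff_map_CF_emb.
rewrite -[LHS]/(ff_map (emb T) (apfact (pvars n (Line i a b)) (Line i a b))).
rewrite (ff_map_apfact (f := id)) // => d hd k hk; split=> //.
by apply: (subsetP h2); rewrite pvarsE; apply/lvarsP; exists d.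
Qed.

(** The variables of [x2] already replaced by those of [x1] after k steps. The bound by [i] keeps
    the target (x1, j) in [T] for every k, as [ren] requires. *)
Let done k (v : V) := (v.1 == x2) && (v.2 < minn k i)%N.
Let U k := T :\: [set v | done k v].
Let s k (v : V) : V := if done k v then (x1, v.2) else v.

Let inU k v : (v \in U k) = ~~ done k v && (v \in T).
Proof. by rewrite in_setD inE. Qed.

Let ren k : renaming_on wt S T (s k) (U k).
Proof.
split.
- apply/subsetP => v hv; rewrite inU (subsetP boundary_sub_glued) // andbT /done.
  move: hv; rewrite in_setU evarsP => /orP[/andP[/eqP -> _]|/other_vars_sub[h1 h2]].
    by rewrite (negbTE hx).
  by rewrite (negbTE (dvars_ne av2 h1 h2)).
- exact: subsetDl.
- by move=> v; rewrite inU /s => /andP[/negbTE ->].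
- move=> v hv; rewrite inU /s; case: ifPn => hd; last by rewrite hd hv.
  have /andP[_] := hd; rewrite leq_min => /andP[_ h].
  by rewrite /done /= (negbTE hx) inT /= eqxx h.
- by move=> v _; rewrite /s; case: ifP.
Qed.

Let U_last : U i = dvars n (relabel e x1 G).
Proof.
apply/setP => v; rewrite inU inT dvars_relabel // /done minnn.
have [->|h1] := eqVneq v.1 x1; first by rewrite (negbTE hx) /= andbF !orbF.
have [h2|h2] := eqVneq v.1 x2 => /=.
  have -> : (v.1 != e) && (v \in dvars n G) = false.
    by apply/negP => /andP[he2 /(dvars_ne av2 he2)]; rewrite h2 eqxx.
  by case: (v.2 < i)%N; rewrite //= !andbF.
by [].
Qed.

(** The second entry number j involves only the variables number j, which the earlier renamings
    leave alone; up to orientation it is their difference. *)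
Let step (j : 'I_i) : qstep (qren (ren j)) (qren (ren j.+1))
  (tsecond (xv n a) (xv n b) T j) (tdb j).
Proof.
have hn : (j < n)%N by have := ltn_ord j; lia.
pose k : 'I_n := Ordinal hn.
have xvE l : xv n l j = 'X_(enum_rank ((l, k) : V)).
  by rewrite /xv; case: insubP => [k' _ hk'|]; [congr 'X_(enum_rank (_, _)); apply: val_inj | rewrite hn].
have m1 : minn j i = j by apply/minn_idPl/ltnW.
have m2 : minn j.+1 i = j.+1 by apply/minn_idPl.
have hT l : (l == x1) || (l == x2) -> ((l, k) : V) \in T.
  by rewrite inT /= ltn_ord !andbT => /orP[] ->; rewrite ?orbT.
have hU l : (l == x1) || (l == x2) -> ((l, k) : V) \in U j.
  by move=> h; rewrite inU hT // andbT /done m1 /= ltnn andbF.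
have hab l : (l == a) || (l == b) -> (l == x1) || (l == x2).
  by rewrite /a /b; case: eps => //; rewrite orbC.
apply: (@qstep_ren _ _ _ _ _ _ _ _ (ren j) (ren j.+1) (x1, k) (x2, k) _ _ eps).
- by rewrite inU hT ?eqxx // /done /= (negbTE hx).
- by apply: hU; rewrite eqxx orbT.
- by rewrite xpair_eqE negb_and hx.
- apply/subsetP => v; rewrite !inU /done m1 m2 => /andP[h ->]; rewrite andbT.
  by apply: contra h => /andP[-> h]; apply: ltnW.
- apply/subsetP => v; rewrite in_setU1 !inU /done m1 m2 => /andP[h ->]; rewrite andbT.
  have [//|hv] := eqVneq v (x2, k); apply: contra h => /andP[h1 h2]; rewrite h1 /=.
  move: h2; rewrite ltnS leq_eqVlt => /orP[/eqP h2|//]; case/eqP: hv.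
  by rewrite [v]surjective_pairing (eqP h1); congr (_, _); apply: val_inj.
- move=> v hv; rewrite /s /done m1 m2.
  have [/andP[h1 h2]|h] := boolP ((v.1 == x2) && (v.2 < j)%N).
    by rewrite h1 (leqW h2) xpair_eqE (negbTE hx).
  have [->|hv'] := eqVneq v (x2, k); first by rewrite /= eqxx ltnSn.
  case: ifP => // /andP[h1 h2]; case/eqP: hv'.
  rewrite h1 /= -leqNgt in h; rewrite [v]surjective_pairing (eqP h1).
  by congr (_, _); apply/val_inj/eqP; rewrite /= eqn_leq h -ltnS h2.
- rewrite -[whomog _ _ _]/(ahomog wt _ (qval _)) inQ_val; last first.
    by rewrite !xvE; apply: supportedB; apply/supportedX/hT/hab; rewrite eqxx ?orbT.
  by apply: ahomogB; apply: ahomog_xv.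
- rewrite /= subst_id; last first.
    by rewrite !xvE; apply: supportedB; apply/supportedX/hT/hab; rewrite eqxx ?orbT.
  rewrite !xvE rmorphB /= !substX.
  have sid l : s j (l, k) = (l, k) by rewrite /s /done m1 /= ltnn andbF.
  rewrite !sid !hU ?eqxx ?orbT //; try by apply: hab; rewrite eqxx ?orbT.
  by rewrite /a /b; case: eps; rewrite ?expr0 ?mul1r // expr1 mulN1r opprB.
Qed.

(** The whole chain lives over one ring Q[T]: it starts with nothing renamed and ends with every
    variable of [x2] renamed to [x1], when only the factorization of the diagram is left. *)
Lemma heq_glue (w : Qs S) :
  dpot n (outs (relabel e x2 G)) (ins (relabel e x2 G)) +
    (Fat n i a - Fat n i b) = qval w ->
  heq (restr wt S (boxtimes (Cfact n (relabel e x2 G)) (line n i a b)))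
      (restr wt S (Cfact n (relabel e x1 G))).
Proof.
move=> hw; have [h1 h2] := dvars_sub_glued.
rewrite boxtimes_CF.
apply: (@heq_trans _ _ (gq (qren (ren 0)) (tens (CF T (relabel e x2 G)) (apfact T (Line i a b))))).
  apply/heq_sym/heq_gq_ren_id => [|v _].
    by apply/setP => v; rewrite inU /done min0n ltn0 andbF.
  by rewrite /s /done min0n ltn0 andbF.
have supE l : (l == a) || (l == b) -> forall j : 'I_i, supported T (xv n l j).
  move=> hl j; apply: supported_xv (ltn_ord j); apply: subset_trans h2.
  by apply: evars_lvars; rewrite !inE !xpair_eqE !eqxx !andbT.
have wE l : forall j : 'I_i, ahomog wt (2 * j.+1)%N%:Z (xv n l j).
  by move=> j; apply: ahomog_xv.
have sa : forall j : 'I_i, supported T (xv n a j) by apply: supE; rewrite eqxx.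
have sb : forall j : 'I_i, supported T (xv n b j) by apply: supE; rewrite eqxx orbT.
have j0 : 'I_i by apply: (@Ordinal i 0); lia.
apply: (@heq_trans _ _ (gq (qren (ren i)) (CF T (relabel e x2 G)))).
  have sE : size (enum 'I_i) = i by rewrite size_enum_ord.
  have P := @peel_kfold _ wt S T n.+1%:Z _ (tfirst (xv n a) (xv n b) T)
    (tsecond (xv n a) (xv n b) T) (@tda n i) (@tdb i) (@tdaD n i)
    (whomog_tfirst sa sb (wE a) (wE b)) (whomog_tsecond sa sb (wE a) (wE b))
    _ _ w j0 (enum 'I_i) (fun k => qren (ren k)) (fhomog_CF h1) (mfpot_CF h1).
  rewrite sE in P; apply: P => [k hk|].
    have -> : k = Ordinal hk by [].
    by rewrite nth_ord_enum; apply: step.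
  congr (qphi _ _); apply: val_inj.
  rewrite -[LHS]/(qval _ + qval _) -[RHS]/(qval (emb T w)) sum_telescope //.
  rewrite emb_val ?boundary_sub_glued //.
  rewrite -hw inQ_val //.
  exact: supported_dpot.
rewrite CfactE -U_last.
apply: heq_trans (heq_gq_ren (ren i) _) _.
(* Relabelling [e] as [x2] and then [x2] as [x1] amounts to relabelling [e] as [x1], because [x2]
   labels no other end. *)
pose g l := if l == x2 then x1 else l.
have gE l c : (l, c) \in ends G -> g (f x2 l) = f x1 l.
  move=> hl; rewrite /g /f; have [_|hle] := eqVneq l e; first by rewrite eqxx.
  by rewrite (negbTE (avail_ne av2 hl hle)).
rewrite (ff_map_CF (f := g) h1) => [|d hd k hk].
  have -> : [seq prelabel g P | P <- relabel e x2 G] = relabel e x1 G.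
    by rewrite !relabelE; apply: map_prelabel_comp => -[l c]; apply: gE.
  exact: heq_refl.
move: hd; rewrite endsE => /mapP[[l c] hd E']; rewrite E' /= in hk *.
have hlk : s i (f x2 l, k) = (g (f x2 l), k).
  rewrite (gE _ _ hd) /s /done minnn /f; have [El|hle] /= := eqVneq l e.
    by rewrite eqxx -(hc (c := c)) ?hk // -El.
  by rewrite (negbTE (avail_ne av2 hd hle)).
split=> //; rewrite U_last dvars_relabel // (gE _ _ hd) /f /=.
have [El|hle] := eqVneq l e.
  by rewrite eqxx -(hc (c := c)) ?hk // -El.
rewrite hle (avail_ne av1 hd hle) dvarsE orbC; apply/orP; left.
by apply/lvarsP; exists (l, c).
Qed.

Lemma hmf_iso_glue (w : Qs S) :
  dpot n (outs (relabel e x2 G)) (ins (relabel e x2 G)) +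
    (Fat n i a - Fat n i b) = qval w ->
  dpot n (outs (relabel e x1 G)) (ins (relabel e x1 G)) = qval w ->
  (exists c : int, whomog wt c w) ->
  hmf_iso wt w
      (restr wt S (boxtimes (Cfact n (relabel e x2 G)) (line n i a b)))
      (restr wt S (Cfact n (relabel e x1 G))).
Proof.
move=> hw2 hw1 hwt; apply: heq_hmf_iso; last exact: (heq_glue hw2).
- have [h1 h2] := dvars_sub_glued; rewrite boxtimes_CF.
  apply: (is_mf_restr boundary_sub_glued (mfpot_tens (mfpot_CF h1) (mfpot_apfact h2))) => //.
  rewrite -inQD; apply: val_inj.
  rewrite -[RHS]/(qval (emb T w)) emb_val ?boundary_sub_glued // -hw2.
  rewrite [LHS]inQ_val; last first.
    apply: supportedD; first exact: supported_dpot.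
    have E' : dpot n (pouts (Line i a b)) (pins (Line i a b)) =
        dpot n (outs [:: Line i a b]) (ins [:: Line i a b]) by [].
    by rewrite E'; apply: supported_dpot; rewrite /= setU0.
  by congr (_ + _); rewrite /dpot /= !big_seq1.
- rewrite CfactE.
  apply: (is_mf_restr boundary_sub_relabel (mfpot_CF (subxx _))) => //.
  apply: val_inj; rewrite -[RHS]/(qval (emb _ w)) emb_val ?boundary_sub_relabel // -hw1.
  by rewrite [LHS]inQ_val //; apply: supported_dpot.
Qed.
End Gluing.

(** * Potentials of glued and relabelled diagrams *)

Section Potentials.
Variables (n : nat) (E : finType).
Local Notation V := (nvar n E).
Local Notation wt := (@nwt n E).

Lemma uniq_map_fst (s : seq (E * nat)) l c c' :
  uniq [seq d.1 | d <- s] -> (l, c) \in s -> (l, c') \in s -> c = c'.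
Proof.
elim: s => //= d s IH /andP[h1 h2]; rewrite !in_cons.
move=> /predU1P[E1|h] /predU1P[E2|h'].
- by move: E2; rewrite -E1 => -[].
- by move: h1; rewrite -E1 /= => /mapP[]; exists (l, c').
- by move: h1; rewrite -E2 /= => /mapP[]; exists (l, c).
- exact: IH.
Qed.

(** By validity each glued label occurs once as an outgoing and once as an incoming end, with the
    same color, so its two contributions cancel. *)
Lemma potentialE (G : diagram E) : valid n G -> potential n G = dpot n (outs G) (ins G).
Proof.
case/and4P => _ uo ui /allP hc; rewrite /potential /dpot.
have mem_fst (s : seq (E * nat)) d : d \in s -> d.1 \in [seq d'.1 | d' <- s].
  by move=> h; apply/mapP; exists d.
pose X := [seq d <- outs G | d.1 \in [seq d'.1 | d' <- ins G]].
pose Y := [seq d <- ins G | d.1 \in [seq d'.1 | d' <- outs G]].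
have XY : perm_eq X Y.
  apply: uniq_perm; try by apply: filter_uniq; apply: map_uniq; eassumption.
  move=> d; rewrite !mem_filter; apply/andP/andP => -[/mapP[d' hd' e'] hd].
    split; last by have -> : d = d' by
      rewrite [d]surjective_pairing [d']surjective_pairing e'; congr (_, _);
      apply/eqP; have /allP/(_ d' hd') := hc d hd; rewrite e' eqxx.
    exact: mem_fst.
  split; first exact: mem_fst.
  have -> : d = d'.
    rewrite [d]surjective_pairing [d']surjective_pairing e'; congr (_, _).
    by apply/esym/eqP; have /allP/(_ d hd) := hc d' hd'; rewrite e' eqxx.
  by [].
rewrite [X in _ = X - _](bigID (fun d => d.1 \in [seq d'.1 | d' <- ins G])) /=.
rewrite [X in _ = _ - X](bigID (fun d => d.1 \in [seq d'.1 | d' <- outs G])) /=.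
rewrite -!(big_filter _ (fun d => d.1 \in _)) -/X -/Y (perm_big _ XY) /=.
by rewrite /bouts /bins !big_filter; ring.
Qed.

Variables (i : nat) (G : diagram E) (e x : E) (w : Qs (other_vars n G e)).

Let s (v : V) : V := if v.1 == e then (x, v.2) else v.

(** The hypothesis is an identity of polynomials, to which the substitution e := x is applied; [w]
    does not involve the variables of [e]. The target [setT] prevents any variable from being sent
    to 0. *)
Lemma dpot_relabel (r : bool) :
  dpot n (outs G) (ins G) = qval w + (-1) ^+ r * Fat n i e ->
  dpot n (outs (relabel e x G)) (ins (relabel e x G)) =
    qval w + (-1) ^+ r * Fat n i x.
Proof.
have rn (d : E * nat) : renames s (fun l => if l == e then x else l) setT d.
  by move=> k _; rewrite in_setT /s /=; case: eqP.
have hF (t : seq (E * nat)) : subst s setT (\sum_(d <- t) Fat n d.2 d.1) =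
    \sum_(d <- [seq (if d.1 == e then x else d.1, d.2) | d <- t]) Fat n d.2 d.1.
  rewrite rmorph_sum big_map; apply: eq_bigr => -[l c] _.
  exact: subst_Fat (rn (l, c)).
have [-> ->] := ends_prelabel (fun l => if l == e then x else l) G.
move=> /(congr1 (subst s setT)); rewrite /dpot rmorphB /= !hF => ->.
rewrite rmorphD rmorphM rmorph_sign /= (subst_Fat (rn (e, i))) eqxx; congr (_ + _).
rewrite -[RHS](subst_id (T := setT)); last first.
  exact: supportedW (subsetT _) (valP w).
apply: (eq_subst _ _ (valP w)) => v; last by rewrite !in_setT.
move=> /lvarsP[d]; rewrite mem_filter => /andP[hd _] [h1 _].
by rewrite /s h1 (negbTE hd).
Qed.
End Potentials.

Lemma qvalD (V : finType) (S : {set V}) (p q : Qs S) :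
  qval (p + q) = qval p + qval q.
Proof. by []. Qed.

Section BoundaryGluing.
Variables (n i : nat) (E : finType) (G : diagram E) (e x1 x2 : E).
Local Notation wt := (@nwt n E).

Lemma hmf_iso_boundary (r : bool) (w : Qs (other_vars n G e)) :
  (1 <= i <= n)%N -> valid n G -> (e, i) \in (if r then bins G else bouts G) ->
  available G e x1 -> available G e x2 -> x1 != x2 ->
  potential n G = qval w + (-1) ^+ r * Fat n i e ->
  let S := evars n (x1, i) :|: other_vars n G e in
  hmf_iso wt (emb S w + (-1) ^+ r * inQ S (Fat n i x1))
    (restr wt S (boxtimes (Cfact n (relabel e x2 G))
       (line n i (if r then x2 else x1) (if r then x1 else x2))))
    (restr wt S (Cfact n (relabel e x1 G))).
Proof.
move=> hi hG hb av1 av2 hx hw S.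
(* A boundary label occurs among ends of one orientation only, and there only once, so its color is
   determined. *)
have [he hc] : (e, i) \in ends G /\ (forall c, (e, c) \in ends G -> c = i).
  have [_ uo ui _] := and4P hG.
  have ex (s : seq (E * nat)) c : (e, c) \in s -> e \in [seq d.1 | d <- s].
    by move=> h; apply/mapP; exists (e, c).
  move: hb; rewrite /ends; case: (r); rewrite mem_filter => /andP[/= h1 h2].
    split=> [|c]; rewrite mem_cat ?h2 ?orbT // => /orP[/ex h|h].
      by rewrite h in h1.
    exact: uniq_map_fst ui h h2.
  split=> [|c]; rewrite mem_cat ?h2 // => /orP[h|/ex h].
    exact: uniq_map_fst uo h h2.
  by rewrite h in h1.
have hd := hw; rewrite (potentialE hG) in hd.
have sQ (z : Qs S) : qval ((-1) ^+ r * z) = (-1) ^+ r * qval z.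
  by case: (r); rewrite ?expr0 ?expr1 ?mul1r ?mulN1r.
have qv : qval (emb S w + (-1) ^+ r * inQ S (Fat n i x1)) =
    qval w + (-1) ^+ r * Fat n i x1.
  have hF : supported S (Fat n i x1) by apply: supported_Fat; apply: subsetUl.
  rewrite qvalD; congr (_ + _); first exact: (emb_val w (subsetUr _ _)).
  exact: etrans (sQ _) (congr1 _ (inQ_val hF)).
have FE (r' : bool) (y z : E) : Fat n i (if r' then y else z) =
    (if r' then Fat n i y else Fat n i z) :> amb (nvar n E) by case: r'.
have wF l : ahomog wt (2 * n.+1)%N%:Z ((-1) ^+ r * Fat n i l).
  case: (r); rewrite ?expr0 ?expr1 ?mul1r ?mulN1r; try apply: ahomogN;
    exact: ahomog_Fat.
apply: (hmf_iso_glue hi he hc av1 av2 hx (eps := r)).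
- rewrite qv (dpot_relabel x2 hd) !FE.
  move: (Fat n i x1) (Fat n i x2) (qval w) => f1 f2 q.
  by case: (r); rewrite ?expr0 ?expr1; ring.
- exact: etrans (dpot_relabel x1 hd) (esym qv).
exists (2 * n.+1)%N%:Z; rewrite -[whomog _ _ _]/(ahomog wt _ (qval _)) qv.
apply: ahomogD; last exact: wF.
have -> : qval w = dpot n (outs G) (ins G) - (-1) ^+ r * Fat n i e by rewrite hd addrK.
apply: ahomogB; last exact: wF.
by apply: ahomogB; apply: ahomog_sum => d _; apply: ahomog_Fat.
Qed.
End BoundaryGluing.

(** * The circle *)

Section Circle.
Variables (n i : nat) (E : finType) (x1 x2 : E).
Local Notation V := (nvar n E).
Local Notation wt := (@nwt n E).
Hypothesis hi : (1 <= i <= n)%N.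
Local Notation T := (evars n (x1, i)).
Local Notation A := (Qs T).

Lemma circleE : circle n i x1 x2 = telescope T i (xv n x1) (xv n x1).
Proof.
pose f l := if l == x2 then x1 else l.
have fx1 : f x1 = x1 by rewrite /f; case: eqP.
have fx2 : f x2 = x1 by rewrite /f eqxx.
rewrite /circle -[line n i x1 x2]/(apfact (pvars n (Line i x1 x2)) (Line i x1 x2)).
rewrite (ff_map_apfact (f := f)) //= ?fx1 ?fx2 // => d hd k hk.
have {hd} : (d == (x1, i)) || (d == (x2, i)) by move: hd; rewrite !inE.
case/orP => /eqP E'; rewrite E' /= in hk *.
  by rewrite fx1 if_same evarsP /= eqxx hk.
by rewrite fx2 eqxx evarsP /= eqxx hk.
Qed.

Let n_gt0 : (0 < n)%N. Proof. by lia. Qed.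
Let vx (j : nat) : V := (x1, insubd (Ordinal n_gt0) j).
Let vxE j (hj : (j < n)%N) : vx j = (x1, Ordinal hj).
Proof. by congr (_, _); apply: val_inj; rewrite val_insubd hj. Qed.
Let vxT j : (j < i)%N -> vx j \in T.
Proof. by move=> hj; rewrite evarsP eqxx /= val_insubd ifT //; lia. Qed.
Let vx_inj j k : (j < i)%N -> (k < i)%N -> vx j = vx k -> j = k.
Proof.
move=> hj hk [] /(congr1 val); rewrite !val_insubd !ifT //; lia.
Qed.
Let xq : nat -> A := qvar T vx.
Let xqE j : (j < i)%N -> qval (xq j) = xv n x1 j.
Proof.
move=> hj; rewrite (qval_qvar vxT) //; have hn : (j < n)%N by lia.
rewrite vxE /xv; case: insubP => [k _ hk|]; last by rewrite hn.
by congr 'X_(enum_rank (_, _)); apply: val_inj.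
Qed.

Let qincl : A -> amb V := @qval V T.
Fact qincl_zmod : zmod_morphism qincl. Proof. by []. Qed.
Fact qincl_monoid : monoid_morphism qincl. Proof. by []. Qed.
HB.instance Definition _ := GRing.isZmodMorphism.Build A (amb V) qincl qincl_zmod.
HB.instance Definition _ := GRing.isMonoidMorphism.Build A (amb V) qincl qincl_monoid.

Let Ex : {poly A} := epoly (fun j : 'I_i => xq j).
(* Up to sign, 1 / Ex is the generating function of the complete symmetric
   polynomials, and the partial derivatives of F_i are (n + 1) times its
   coefficients. *)
Let cx (k : nat) : A := (-1) ^+ n * (geo n Ex)`_k *+ n.+1.

Let map_Ex : map_poly qincl Ex = epoly (fun j : 'I_i => xv n x1 j).
Proof.
rewrite map_epoly; congr (_ + _); apply: eq_bigr => j _; congr (_ *: _).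
exact: xqE.
Qed.

Let qval_cx k : qval (cx k) =
  (-1) ^+ n * (geo n (epoly (fun j : 'I_i => xv n x1 j)))`_k *+ n.+1.
Proof.
rewrite -[LHS]/(qincl (cx k)) rmorphMn rmorphM rmorph_sign -coef_map map_geo.
by rewrite map_Ex.
Qed.

Let cx_hom k : whomog wt (2 * k)%N%:Z (cx k).
Proof.
rewrite -[whomog _ _ _]/(ahomog wt _ (qval _)) qval_cx ahomogE.
set P := epoly _; set c := (geo n P)`_k.
have hc : phomog (wt \o enum_val) (2 * k)%N%:Z c.
  apply: (ghomog_geo n) => j; rewrite coef_epoly.
  case: j => [|j]; first by rewrite muln0; apply: (phomogC _ 1).
  case: insubP => [l _ <-|_]; last exact: phomog0.
  by have := ahomog_xv n x1 l; rewrite ahomogE.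
have -> : (-1) ^+ n * c *+ n.+1 = (((-1) ^+ n * n.+1%:R)%:MP : amb V) * c.
  by rewrite rmorphM rmorph_sign rmorph_nat; ring.
have := phomogM (phomogC (wt \o enum_val) ((-1) ^+ n * n.+1%:R)) hc.
by rewrite add0r.
Qed.

Let Ex0 : Ex`_0 = 1. Proof. by rewrite coef_epoly. Qed.

(** Compare the coefficients of X^(k+1) in E (1/E) = 1, which holds up to the order of
    truncation. *)
Let cxS k : (k < n)%N ->
  cx k.+1 = - \sum_(j < i | (j <= k)%N) xq j * cx (k - j)%N.
Proof.
move=> hk; have hk' : (k.+1 < n.+2)%N by lia.
have := eqX_coef hk' (geo_inv n Ex0); rewrite coef1 coefM big_ord_recl /= subn0 Ex0 mul1r.
move=> /eqP; rewrite addr_eq0 => /eqP E0.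
rewrite /cx E0 mulrN mulNrn; congr (- _).
rewrite mulr_sumr -sumrMnl.
pose F j : A := if (j < i)%N then (-1) ^+ n * (xq j * (geo n Ex)`_(k - j)) *+ n.+1 else 0.
transitivity (\sum_(j < k.+1) F j).
  apply: eq_bigr => j _; rewrite /F coef_epoly /= /bump /= add1n subSS.
  case: insubP => [l hl ->|/negbTE ->]; first by rewrite hl.
  by rewrite mul0r mulr0 mul0rn.
pose H j : A := (-1) ^+ n * (xq j * (geo n Ex)`_(k - j)) *+ n.+1.
transitivity (\sum_(j < i | (j <= k)%N) H j); last first.
  by apply: eq_bigr => j _; rewrite /H; ring.
(* Either of i and k+1 may be the smaller bound, so both sums are extended to the common range i + k
   + 1. *)
rewrite (big_ord_widen (i + k.+1) F) ?leq_addl //.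
rewrite (@big_ord_widen_cond _ _ _ i (i + k.+1) (fun j => j <= k)%N H) ?leq_addr //.
rewrite [LHS]big_mkcond [RHS]big_mkcond; apply: eq_bigr => j _.
by rewrite /F ltnS; case: (j <= k)%N; case: (j < i)%N.
Qed.

(** The inverse of c_0 = (-1)^n (n+1). *)
Let u : A := inQ T ((((-1) ^+ n * n.+1%:R) : rat)^-1%:MP : amb V).
Let cx0 : u * cx 0 = 1.
Proof.
apply: val_inj; rewrite -[LHS]/(qval u * qval (cx 0)) qval_cx.
have -> : (geo n (epoly (fun j : 'I_i => xv n x1 j)))`_0 = 1.
  have h : (epoly (fun j : 'I_i => xv n x1 j))`_0 = 1 by rewrite coef_epoly.
  have := eqX_coef (ltn0Sn _) (geo_inv n h).
  by rewrite coef0M h mul1r coef1.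
rewrite inQ_val; last exact: supportedC.
have -> : (-1) ^+ n * 1 *+ n.+1 = (((-1) ^+ n * n.+1%:R : rat)%:MP : amb V).
  by rewrite rmorphM rmorph_sign rmorph_nat; ring.
rewrite -mpolyCM mulVf ?mpolyC1 // mulf_neq0 ?signr_eq0 //.
by rewrite pnatr_eq0.
Qed.

Let xq_hom j : (j < i)%N -> homogs wt [:: xq j].
Proof.
move=> hj p; rewrite mem_seq1 => /eqP ->; exists (2 * j.+1)%N => //.
by rewrite -[whomog _ _ _]/(ahomog wt _ (qval _)) xqE //; apply: ahomog_xv.
Qed.

Let cx_homogs k : (0 < k)%N -> homogs wt [:: cx k].
Proof.
move=> hk p; rewrite mem_seq1 => /eqP ->; exists (2 * k)%N; first by lia.
exact: cx_hom.
Qed.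

(** The window c_(n+1-i), ..., c_n has positive indices because i <= n; its elements thus have
    positive degree, as exchanging them requires. *)
Let cx_reg : reg [seq cx k | k <- iota (n.+1 - i) i].
Proof.
apply: (reg_recurrent_rev (M := n) (x := xq) (u := u) _ xq_hom cx_homogs cx0 cxS).
- by have := reg_variables vxT vx_inj 0; rewrite subn0.
- by lia.
- by lia.
Qed.

(* In the order in which they appear in L_i, the partial derivatives are
   proportional to c_n, c_(n-1), ..., c_(n+1-i). *)
Let ax (k : nat) : A := cx (n - k).
Let dx (k : nat) : int := (2 * (n - k))%N%:Z.

Let ax_hom k : whomog wt (dx k) (ax k).
Proof. exact: cx_hom. Qed.

(** The head of a [reg] list comes last, so [cx_reg] is a regular sequence starting with c_n; its
    suffixes as a list correspond to the initial segments of [ax]. *)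
Let ax_nzd k : (k < i)%N -> nzd [seq ax j | j <- iota 0 k] (ax k).
Proof.
move=> hk; have e1 : i = (i - k.+1 + k.+1)%N by lia.
have := cx_reg; rewrite [X in iota _ X]e1 iotaD map_cat => /reg_cat.
have -> : (n.+1 - i + (i - k.+1) = n - k)%N by lia.
move=> [+ _]; apply: nzd_mem => p; apply/mapP/mapP => -[j].
  rewrite mem_iota => hj ->; exists (n - j)%N; first by rewrite mem_iota; lia.
  by rewrite /ax; congr cx; lia.
rewrite mem_iota => hj ->; exists (n - j)%N => //.
by rewrite mem_iota; lia.
Qed.

Let tfirst_ax (j : 'I_i) : tfirst (xv n x1) (xv n x1) T j = ax j.
Proof.
have hj : (j <= n)%N by have := ltn_ord j; lia.
apply: val_inj; rewrite /= -/(qval (cx _)) qval_cx -peval_mderiv // -ddiff_diag.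
rewrite subst_id; last first.
  by apply: supported_tfirst => l; apply: supported_xv (ltn_ord l).
by apply: eq_ddiff => l; rewrite /tmix if_same.
Qed.

Let jacobi_ax (j : 'I_i) :
  inQ T (peval (Fpoly n i)^`M(j) (fun l => xv n x1 l)) = ax j.
Proof.
have hj : (j <= n)%N by have := ltn_ord j; lia.
apply: val_inj; rewrite /= -/(qval (cx _)) qval_cx -peval_mderiv // subst_id //.
by apply: supported_peval => l; apply: supported_xv (ltn_ord l).
Qed.

Let ren_id : renaming_on wt set0 T id T.
Proof. by split=> //; apply: sub0set. Qed.

(** The chain starts at the polynomial ring, viewed as a trivial renaming, in order to match the
    restriction of the circle. *)
Let Qf (k : nat) : qdat wt set0 T :=
  if k is 0 then qren ren_id else quo_qdat ax_hom k.

Let Qf_ker k p : qphi (Qf k) p = 0 <-> idl [seq ax j | j <- iota 0 k] p.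
Proof.
case: k => [|k]; last exact: quo_qdat_ker.
by rewrite /= -[X in X = 0]/(emb T p) psubst_id.
Qed.

Lemma heq_circle :
  heq (restr wt set0 (circle n i x1 x2))
    (iter i (@gf_flip V set0)
       (gf_shift (- (i * n)%N%:Z + (i ^ 2)%N%:Z)
          (gf_even wt (jacobi_algebra n i x1)))).
Proof.
rewrite circleE.
apply: (@heq_trans _ _ (gq (Qf 0) (telescope T i (xv n x1) (xv n x1)))).
  by apply/heq_sym/heq_gq_ren_id.
have sx : forall j : 'I_i, supported T (xv n x1 j).
  by move=> j; apply: supported_xv (ltn_ord j).
have wx : forall j : 'I_i, ahomog wt (2 * j.+1)%N%:Z (xv n x1 j).
  by move=> j; apply: ahomog_xv.
have j0 : 'I_i by apply: (@Ordinal i 0); lia.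
have P := @peel_kfold_flip _ wt set0 T n.+1%:Z _ (tfirst (xv n x1) (xv n x1) T)
  (tsecond (xv n x1) (xv n x1) T) (@tda n i) (@tdb i) (@tdaD n i)
  (whomog_tfirst sx sx wx wx) (whomog_tsecond sx sx wx wx) j0 (enum 'I_i) Qf.
rewrite size_enum_ord in P; apply: heq_trans; first apply: P.
- move=> k hk; have -> : k = Ordinal hk by [].
  rewrite nth_ord_enum tfirst_ax.
  have -> : tda n (Ordinal hk) = dx k by rewrite /tda /dx /=; lia.
  by apply: (qstep_idl ax_hom) => //; apply: ax_nzd.
- by move=> j; apply: val_inj; rewrite /= subrr rmorph0.
apply: heq_iter_flip.
have QfE k : (0 < k)%N -> Qf k = quo_qdat ax_hom k by case: k.
rewrite QfE; last by case/andP: hi.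
(* Counting factors from 1, the shifts are 2j - (n+1), with sum i(i+1) - i(n+1). *)
have -> : \sum_(j <- enum 'I_i) (tdb j - n.+1%:Z) = - (i * n)%N%:Z + (i ^ 2)%N%:Z.
  rewrite big_enum /= /tdb.
  rewrite -(big_mkord xpredT (fun j => (2 * j.+1)%N%:Z - n.+1%:Z)).
  elim: (i) => [|k IH]; first by rewrite big_geq.
  rewrite big_nat_recr //= IH; nia.
have -> : jacobi_algebra n i x1 = quo_gmod wt set0 (fun j : 'I_i => ax j).
  rewrite /jacobi_algebra; have -> // : (fun j : 'I_i => inQ T
    (peval (Fpoly n i)^`M(j) (fun l => xv n x1 l))) = (fun j : 'I_i => ax j).
  by apply/funext => j; apply: jacobi_ax.
exact: heq_quo_even.
Qed.
End Circle.

(** * The factorization of the Jacobi algebra satisfies [is_mf] *)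

Section EvenFactorizations.
Variables (V : finType) (wt : V -> nat) (S : {set V}).

Lemma is_mf_flip (w : Qs S) (M : gfact S) : is_mf wt w M -> is_mf wt w (gf_flip M).
Proof.
move=> [hw h0 h1 hd0 hd1]; split=> // m /=; rewrite raddfN opprK; [exact: hd1 | exact: hd0].
Qed.

Lemma is_mf_iter_flip (w : Qs S) (M : gfact S) k :
  is_mf wt w M -> is_mf wt w (iter k (@gf_flip V S) M).
Proof. by move=> hM; elim: k => //= k; apply: is_mf_flip. Qed.

Lemma is_mf_shift (w : Qs S) (M : gfact S) a : is_mf wt w M -> is_mf wt w (gf_shift a M).
Proof. by move=> [hw h0 h1 hd0 hd1]; split=> //; apply: free_graded_shift. Qed.

Lemma is_mf_even (M : gmod S) : free_graded wt M -> is_mf wt 0 (gf_even wt M).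
Proof.
move=> hM; split=> //.
- by exists 0; apply: whomog0.
- exact: free_graded_restr.
- by move=> m; rewrite scale0r.
- by move=> m; rewrite scale0r.
Qed.
End EvenFactorizations.

Lemma hmf_iso_circle (n i : nat) (E : finType) (x1 x2 : E) : (1 <= i <= n)%N ->
  hmf_iso (@nwt n E) (0 : Qs set0)
    (restr (@nwt n E) set0 (circle n i x1 x2))
    (iter i (@gf_flip _ set0)
       (gf_shift (- (i * n)%N%:Z + (i ^ 2)%N%:Z)
          (gf_even (@nwt n E) (jacobi_algebra n i x1)))).
Proof.
move=> hi; apply: heq_hmf_iso; last exact: heq_circle.
- rewrite circleE //.
  have sx : forall j : 'I_i, supported (evars n (x1, i)) (xv n x1 j).
    by move=> j; apply: supported_xv (ltn_ord j).
  apply: (is_mf_restr (sub0set _) (mfpot_telescope sx sx)).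
    by apply: val_inj; rewrite /= subrr !rmorph0.
  by exists 0; apply: whomog0.
- apply/is_mf_iter_flip/is_mf_shift/is_mf_even.
  apply: (free_graded_quo (dg := @tda n i)) => j.
  rewrite -[whomog _ _ _]/(ahomog (@nwt n E) _ (qval _)) inQ_val; last first.
    by apply: supported_peval => l; apply: supported_xv (ltn_ord l).
  (* Read as a diagonal divided difference, the partial derivative is homogeneous by
     [ahomog_ddiff]. *)
  rewrite -ddiff_diag; apply: ahomog_ddiff => [l||]; exact: ahomog_xv.
Qed.

Theorem proposition3p5 (n i : nat) (hi : (1 <= i <= n)%N) (E : finType) :
  (forall (G : diagram E) (e x1 x2 : E) (w : Qs (other_vars n G e)),
     valid n G -> (e, i) \in bouts G ->
     available G e x1 -> available G e x2 -> x1 != x2 ->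
     potential n G = qval w + Fat n i e ->
     let S := evars n (x1, i) :|: other_vars n G e in
     hmf_iso (@nwt n E)
       (emb S w + inQ S (Fat n i x1))
       (restr (@nwt n E) S
          (boxtimes (Cfact n (relabel e x2 G)) (line n i x1 x2)))
       (restr (@nwt n E) S (Cfact n (relabel e x1 G)))) /\
  (forall (G : diagram E) (e x1 x2 : E) (w : Qs (other_vars n G e)),
     valid n G -> (e, i) \in bins G ->
     available G e x1 -> available G e x2 -> x1 != x2 ->
     potential n G = qval w - Fat n i e ->
     let S := evars n (x1, i) :|: other_vars n G e in
     hmf_iso (@nwt n E)
       (emb S w - inQ S (Fat n i x1))
       (restr (@nwt n E) S
          (boxtimes (Cfact n (relabel e x2 G)) (line n i x2 x1)))
       (restr (@nwt n E) S (Cfact n (relabel e x1 G)))) /\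
  (forall x1 x2 : E, x1 != x2 ->
     hmf_iso (@nwt n E)
       (0 : Qs set0)
       (restr (@nwt n E) set0 (circle n i x1 x2))
       (iter i (@gf_flip _ set0)
          (gf_shift (- (i * n)%N%:Z + (i ^ 2)%N%:Z)
             (gf_even (@nwt n E) (jacobi_algebra n i x1))))).
Proof.
split=> [G e x1 x2 w hG he av1 av2 hx hw S|].
  have -> : inQ S (Fat n i x1) = (-1) ^+ false * inQ S (Fat n i x1).
    by rewrite expr0 mul1r.
  apply: (hmf_iso_boundary (r := false)) => //.
  by rewrite hw expr0 mul1r.
split=> [G e x1 x2 w hG he av1 av2 hx hw S|x1 x2 _].
  have -> : - inQ S (Fat n i x1) = (-1) ^+ true * inQ S (Fat n i x1).
    by rewrite expr1 mulN1r.
  apply: (hmf_iso_boundary (r := true)) => //.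
  by rewrite hw expr1 mulN1r.
exact: hmf_iso_circle.
Qed.
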